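(* Let $f_i=f_i(\bar\omega,t,y',z',y,z)$, $i=1,2$, be two drivers satisfying (A3) and (A4). Suppose moreover that (i) one of the two coefficients $f_1,f_2$ is independent of $z'$; (ii) one of the two coefficients $f_1,f_2$ is nondecreasing in $y'$ (the conditions (i) and (ii) may be satisfied by the same coefficient or by different ones). Let $\xi_1,\xi_2\in L^2(\Omega,\mathcal{F}_T,P)$ and let $(Y^i,Z^i)\in\mathcal{S}^2_{\mathbb{F}}(0,T;\mathbb{R})\times\mathcal{H}^2_{\mathbb{F}}(0,T;\mathbb{R}^d)$, $i=1,2$, be the solution of the mean-field BSDE with data $(\xi_i,f_i)$, $$Y^i_t=\xi_i+\int_t^T E'[f_i(s,(Y^i_s)',(Z^i_s)',Y^i_s,Z^i_s)]\,ds-\int_t^T Z^i_s\,dB_s,\qquad 0\le t\le T.$$ If $\xi_1\le\xi_2$, $P$-a.s., and $f_1\le f_2$, $\bar P$-a.s., then $Y^1_t\le Y^2_t$, $t\in[0,T]$, $P$-a.s.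
   Context: $T>0$ is fixed and $B=(B_t)_{t\ge0}$ is a $d$-dimensional standard Brownian motion on a complete probability space $(\Omega,\mathcal{F},P)$. $\mathbb{F}=\{\mathcal{F}_s\}_{0\le s\le T}$ is the natural filtration of $B$ augmented by all $P$-null sets. $\mathcal{S}^2_{\mathbb{F}}(0,T;\mathbb{R})$ is the space of real-valued $\mathbb{F}$-adapted càdlàg processes $\psi$ with $E[\sup_{0\le t\le T}|\psi_t|^2]<\infty$; $\mathcal{H}^2_{\mathbb{F}}(0,T;\mathbb{R}^m)$ is the space of $\mathbb{R}^m$-valued $\mathbb{F}$-progressively measurable processes $\psi$ with $E[\int_0^T|\psi_t|^2dt]<\infty$. $(\bar\Omega,\bar{\mathcal{F}},\bar P)=(\Omega\times\Omega,\mathcal{F}\otimes\mathcal{F},P\otimes P)$ is the (non-completed) product space, with filtration $\bar{\mathbb{F}}=\{\mathcal{F}\otimes\mathcal{F}_t\}_{0\le t\le T}$; $\mathcal{H}^2_{\bar{\mathbb{F}}}(0,T;\mathbb{R})$ is defined analogously on it. A random variable $\xi$ on $\Omega$ has the copy $\xi'(\omega',\omega)=\xi(\omega')$ on $\bar\Omega$, and for $\theta\in L^1(\bar\Omega,\bar{\mathcal{F}},\bar P)$, $E'[\theta](\omega)=\int_\Omega\theta(\omega',\omega)P(d\omega')$. Thus $E'[f(s,Y'_s,Z'_s,Y_s,Z_s)](\omega)=\int_\Omega f(\omega',\omega,s,Y_s(\omega'),Z_s(\omega'),Y_s(\omega),Z_s(\omega))P(d\omega')$. A driver is a function $f=f(\omega',\omega,t,y',z',y,z):\bar\Omega\times[0,T]\times\mathbb{R}\times\mathbb{R}^d\times\mathbb{R}\times\mathbb{R}^d\to\mathbb{R}$,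 $\bar{\mathbb{F}}$-progressively measurable for all fixed $(y',z',y,z)$. The assumptions are: (A3) there exists $C\ge0$ such that, $\bar P$-a.s., for all $t\in[0,T]$ and all $y_i,y_i'\in\mathbb{R}$, $z_i,z_i'\in\mathbb{R}^d$ $(i=1,2)$, $|f(t,y_1',z_1',y_1,z_1)-f(t,y_2',z_2',y_2,z_2)|\le C(|y_1'-y_2'|+|z_1'-z_2'|+|y_1-y_2|+|z_1-z_2|)$; (A4) $f(\cdot,0,0,0,0)\in\mathcal{H}^2_{\bar{\mathbb{F}}}(0,T;\mathbb{R})$. Under (A3), (A4) the mean-field BSDE has a unique solution in $\mathcal{S}^2_{\mathbb{F}}(0,T;\mathbb{R})\times\mathcal{H}^2_{\mathbb{F}}(0,T;\mathbb{R}^d)$ for every terminal value in $L^2(\Omega,\mathcal{F}_T,P)$. *)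

(* Defs.v *)
From HB Require Import structures.
From mathcomp Require Import all_boot all_order all_algebra.
From mathcomp Require Import all_classical all_reals all_analysis.

Set Implicit Arguments.
Unset Strict Implicit.
Unset Printing Implicit Defensive.

Import Order.TTheory GRing.Theory Num.Theory.
Import numFieldNormedType.Exports.

Local Open Scope classical_set_scope.
Local Open Scope ring_scope.

(* The library norm on row vectors is the sup norm; the Euclidean structure of
   R^n is introduced here. *)
Definition dot (R : realType) (n : nat) (u v : 'rV[R]_n) : R :=
  \sum_(i < n) u ord0 i * v ord0 i.

Definition enorm (R : realType) (n : nat) (u : 'rV[R]_n) : R :=
  Num.sqrt (dot u u).

(* The events {X^i \in U}: a generating family of sigma(X), X being
   R^n-valued. *)
Definition coord_events (R : realType) (n : nat) (Om : Type)
    (X : Om -> 'rV[R]_n) : set_system Om :=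
  [set A | exists (i : 'I_n) (U : set R),
     measurable U /\ A = (fun w => X w ord0 i) @^-1` U].

Definition past_events (R : realType) (n : nat) (Om : Type)
    (B : R -> Om -> 'rV[R]_n) (t : R) : set_system Om :=
  [set A | exists s : R, 0 <= s <= t /\ coord_events (B s) A].

(* [sigma(B_s, s <= t)] enlarged by the P-null sets. *)
Definition aug_filtration (R : realType) (d : measure_display)
    (Om : measurableType d) (P : probability Om R) (n : nat)
    (B : R -> Om -> 'rV[R]_n) (t : R) : set_system Om :=
  <<s past_events B t `|` [set N | P.-negligible N] >>.

(* For a filtration (F_t) of a measurable space (Om, F), the filtration
   (F (x) F_t) of the product space; the second coordinate is the one on which
   the information of time t bears. *)
Definition bar_filtration (R : realType) (d : measure_display)
    (Om : measurableType d) (F : R -> set_system Om) (t : R) :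
    set_system (Om * Om)%type :=
  (@measurable _ (Om * g_sigma_algebraType (F t))%type).

(* n-dimensional standard Brownian motion, indexed by t >= 0; the values at
   negative times are irrelevant. Increments over [s, t] have law
   N(0, (t - s) I_n), and [normal_prob] takes the standard deviation. *)
Definition brownian_motion (R : realType) (d : measure_display)
    (Om : measurableType d) (P : probability Om R) (n : nat)
    (B : R -> Om -> 'rV[R]_n) : Prop :=
  [/\ forall t, 0 <= t -> forall i : 'I_n,
        measurable_fun [set: Om] (fun w => B t w ord0 i),
      {ae P, forall w, B 0 w = 0},
      {ae P, forall w, {within [set t : R | 0 <= t], continuous (B ^~ w)}},
      forall s t, 0 <= s -> s < t ->
        forall A : 'I_n -> set R,
          (forall i, measurable (A i)) ->
          P [set w | forall i, A i ((B t w - B s w) ord0 i)] =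
          (\prod_(i < n) normal_prob 0 (Num.sqrt (t - s)) (A i))%E
    & forall s t, 0 <= s -> s < t -> forall E D : set Om,
        <<s past_events B s >> E ->
        <<s coord_events (fun w => B t w - B s w) >> D ->
        P (E `&` D) = (P E * P D)%E].

Section processes.
Context (R : realType) (Om : pointedType).
Implicit Types (F : R -> set_system Om) (T : R).

Definition adapted F T (psi : R -> Om -> R) : Prop :=
  forall t, 0 <= t <= T ->
    measurable_fun [set: g_sigma_algebraType (F t)]
      (psi t : g_sigma_algebraType (F t) -> R).

(* For every t, the restriction of psi to [0, t] x Om is measurable for
   B([0, t]) (x) F_t, the trace on [0, t] x Om of B(R) (x) F_t. *)
Definition prog_measurable F T (psi : R -> Om -> R) : Prop :=
  forall t, 0 <= t <= T ->
    measurable_fun (`[0, t]%classic `*` [set: g_sigma_algebraType (F t)])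
      (fun x : R * g_sigma_algebraType (F t) =>
         psi x.1 x.2).

End processes.

Definition cadlag (R : realType) (T : R) (g : R -> R) : Prop :=
  (forall t, 0 <= t < T -> g s @[s --> t^'+] --> g t) /\
  (forall t, 0 < t <= T -> cvg (g s @[s --> t^'-])).

Section spaces.
Context (R : realType) (d : measure_display) (Om : measurableType d).
Implicit Types (P : set Om -> \bar R) (F : R -> set_system Om) (T : R).

Definition S2 P F T (psi : R -> Om -> R) : Prop :=
  [/\ adapted F T psi,
      {ae P, forall w, cadlag T (psi ^~ w)}
    & (\int[P]_w ereal_sup [set (`|psi t w| ^+ 2)%:E | t in `[0%R, T]]
        < +oo)%E].

Definition H2 P F T (psi : R -> Om -> R) : Prop :=
  prog_measurable F T psi /\
  (\int[P]_w \int[lebesgue_measure]_(t in `[0%R, T]) (`|psi t w| ^+ 2)%:E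
    < +oo)%E.

Definition H2vec P F T (m : nat) (psi : R -> Om -> 'rV[R]_m) : Prop :=
  (forall i : 'I_m, prog_measurable F T (fun t w => psi t w ord0 i)) /\
  (\int[P]_w \int[lebesgue_measure]_(t in `[0%R, T]) (enorm (psi t w) ^+ 2)%:E
    < +oo)%E.

(* L^2(Om, G, P) for a sub-sigma-algebra G. *)
Definition L2 P (G : set_system Om) (xi : Om -> R) : Prop :=
  measurable_fun [set: g_sigma_algebraType G]
    (xi : g_sigma_algebraType G -> R) /\
  (\int[P]_w (`|xi w| ^+ 2)%:E < +oo)%E.

End spaces.

(* Data of a simple process \sum_(k < N) eta_k 1_(t_k, t_(k+1)]. *)
Record step_data (R : realType) (Om : Type) (n : nat) := StepData {
  step_size : nat;
  step_time : nat -> R;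
  step_coef : nat -> Om -> 'rV[R]_n }.

Section ito_integral.
Context (R : realType) (d : measure_display) (Om : measurableType d).
Context (P : probability Om R) (n : nat).
Implicit Types (F : R -> set_system Om) (T : R) (B Z : R -> Om -> 'rV[R]_n).
Implicit Types (phi : step_data R Om n).

Definition simple_process F T phi : Prop :=
  [/\ forall k, (k <= step_size phi)%N -> 0 <= step_time phi k <= T,
      forall k, (k < step_size phi)%N -> step_time phi k <= step_time phi k.+1,
      forall k, (k < step_size phi)%N -> forall i : 'I_n,
        measurable_fun [set: g_sigma_algebraType (F (step_time phi k))]
          (fun w : g_sigma_algebraType (F (step_time phi k)) =>
             step_coef phi k w ord0 i)
    & exists M : R, forall k, (k < step_size phi)%N -> forall w,
        enorm (step_coef phi k w) <= M].

Definition step_value phi (s : R) (w : Om) : 'rV[R]_n :=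
  \sum_(k < step_size phi)
    if step_time phi k < s <= step_time phi k.+1 then step_coef phi k w else 0.

Definition step_integral B phi (t : R) (w : Om) : R :=
  \sum_(k < step_size phi)
    dot (step_coef phi k w)
        (B (Num.min (step_time phi k.+1) t) w - B (Num.min (step_time phi k) t) w).

(* I is (a version of) the process \int_0^t Z_s dB_s, t in [0, T]: a continuous
   adapted process which is the limit in L^2 of the integrals of simple
   processes approximating Z in L^2(dt (x) dP). *)
Definition is_ito_integral F T B Z (I : R -> Om -> R) : Prop :=
  [/\ adapted F T I,
      {ae P, forall w, {within `[0, T], continuous (I ^~ w)}}
    & exists phi : nat -> step_data R Om n,
      [/\ forall j, simple_process F T (phi j),
          (\int[P]_w \int[lebesgue_measure]_(s in `[0%R, T])
             (enorm (step_value (phi j) s w - Z s w) ^+ 2)%:E)%E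
            @[j --> \oo] --> 0%E
        & forall t, 0 <= t <= T ->
          (\int[P]_w (`|step_integral B (phi j) t w - I t w| ^+ 2)%:E)%E
            @[j --> \oo] --> 0%E]].

End ito_integral.

(* A coefficient f((w', w), t, y', z', y, z); its values for t outside [0, T]
   are irrelevant. *)
Definition coefficient (R : realType) (Om : Type) (n : nat) : Type :=
  Om * Om -> R -> R -> 'rV[R]_n -> R -> 'rV[R]_n -> R.

Section mean_field.
Context (R : realType) (d : measure_display) (Om : measurableType d).
Context (P : probability Om R) (n : nat).
Implicit Types (f : coefficient R Om n) (F : R -> set_system Om) (T : R).

Definition driver F T f : Prop :=
  forall y' z' y z,
    prog_measurable (bar_filtration F) T (fun t ww => f ww t y' z' y z).

Definition A3 T f : Prop :=
  exists2 C : R, 0 <= C &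
    {ae (P \x P)%E, forall ww, forall t, 0 <= t <= T ->
      forall y1' z1' y1 z1 y2' z2' y2 z2,
        `|f ww t y1' z1' y1 z1 - f ww t y2' z2' y2 z2| <=
        C * (`|y1' - y2'| + enorm (z1' - z2') + `|y1 - y2| + enorm (z1 - z2))}.

Definition A4 F T f : Prop :=
  H2 (P \x P)%E (bar_filtration F) T (fun t ww => f ww t 0 0 0 0).

Definition independent_of_z' T f : Prop :=
  {ae (P \x P)%E, forall ww, forall t, 0 <= t <= T ->
    forall y' z1' z2' y z, f ww t y' z1' y z = f ww t y' z2' y z}.

Definition nondecreasing_in_y' T f : Prop :=
  {ae (P \x P)%E, forall ww, forall t, 0 <= t <= T ->
    forall y1' y2' z' y z, y1' <= y2' -> f ww t y1' z' y z <= f ww t y2' z' y z}.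

Definition coefficient_le T f1 f2 : Prop :=
  {ae (P \x P)%E, forall ww, forall t, 0 <= t <= T ->
    forall y' z' y z, f1 ww t y' z' y z <= f2 ww t y' z' y z}.

(* E'[f(s, Y'_s, Z'_s, Y_s, Z_s)](w): the primed copies are read at the
   integration variable w'. *)
Definition mean_field_driver f (Y : R -> Om -> R) (Z : R -> Om -> 'rV[R]_n)
    (s : R) (w : Om) : R :=
  Rintegral P [set: Om]
    (fun w' => f (w', w) s (Y s w') (Z s w') (Y s w) (Z s w)).

Definition mfbsde_solution (B : R -> Om -> 'rV[R]_n) T (xi : Om -> R) f
    (Y : R -> Om -> R) (Z : R -> Om -> 'rV[R]_n) : Prop :=
  let F := aug_filtration P B in
  [/\ S2 P F T Y,
      H2vec P F T Z
    & exists2 I : R -> Om -> R, is_ito_integral P F T B Z I &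
      {ae P, forall w, forall t, 0 <= t <= T ->
        Y t w = xi w
              + Rintegral lebesgue_measure `[t, T] (mean_field_driver f Y Z ^~ w)
              - (I T w - I t w)}].

End mean_field.

(* Main.v *)
Require Import Defs.

(* Put X = Y^1 - Y^2 and let zeta = Z^1 - Z^2, g = E'[f_1] - E'[f_2]. Conditions
   (i) and (ii) allow one to pass from f_1 at the first solution to f_2 at the
   second one while changing z' only in the coefficient that ignores it and y'
   monotonically, so that g <= C (E[X^+] + |X| + |zeta|). With a C^2 convex phi
   vanishing exactly on x <= 0, growing quadratically and satisfying
   phi'^2 <= 2 phi'' phi, Ito's formula for E[phi(X_t)] would give
   E[phi(X_s)] <= E[phi(X_t)] + K \int_s^t E[phi(X_r)] dr, and Gronwall's lemma
   E[phi(X_t)] = 0. Ito's formula is replaced by a second order Taylor expansion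
   on a partition of [t, T]: the expansion only requires E[G M] = 0,
   a lower bound of E[H M^2] by the weighted energy of zeta, and a fourth moment
   bound, for increments M of the stochastic integral, which all follow from the
   approximation by simple integrands. A discrete Gronwall argument then lets the
   mesh tend to 0. *)
From HB Require Import structures.
From mathcomp Require Import all_boot all_order all_algebra.
From mathcomp Require Import all_classical all_reals all_analysis.
From mathcomp Require Import measurable_realfun ring lra.

Set Implicit Arguments.
Unset Strict Implicit.
Unset Printing Implicit Defensive.

Import Order.TTheory GRing.Theory Num.Theory.
Import numFieldNormedType.Exports.

Local Open Scope classical_set_scope.
Local Open Scope ring_scope.

(** The obstacle to a Taylor expansion is that [zeta] is only square integrable: an increment M of
    the stochastic integral has a second moment, while the remainder is cubic in M. So M is split as
    M' + (M - M'), where M' integrates a fixed simple integrand. Then M' has a fourth moment of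
    order (t - s)^2, and M - M' is small in L^2; convexity of [phi] takes over where the second part
    dominates. The errors are of two kinds: some carry a small factor e and add up along any
    partition, the others have constants that blow up as e tends to 0 but carry the length of the
    step. Hence the mesh is sent to 0 first and e afterwards.

    The z-dependence of the drivers costs a multiple of E[phi1 |zeta|]. The inequality phi1^2 <= 2
    phi2 phi turns it into a small share of E[phi2 |zeta|^2] plus a multiple of E[phi], and the
    second order term of the expansion pays for that share. As [phi2] is frozen at the left end of a
    step, the energy bound carries a bounded weight known at that time. It is only claimed up to a
    constant factor, which survives approximation by simple integrands through a^2 <= 2 b^2 + 2 (a -
    b)^2. *)

Section integrable_functions.
Context (d : measure_display) (T : measurableType d) (R : realType).
Variable mu : {measure set T -> \bar R}.
Implicit Types f g h : T -> R.

Definition intg f := mu.-integrable [set: T] (EFin \o f).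

Definition sqintg f :=
  measurable_fun [set: T] f /\ (\int[mu]_x ((f x) ^+ 2)%:E < +oo)%E.

Lemma intg_mfun f : intg f -> measurable_fun [set: T] f.
Proof. by move=> /integrableP[/measurable_EFinP]. Qed.

Lemma eq_intg f g : f =1 g -> intg f -> intg g.
Proof. by move=> /funext ->. Qed.

Lemma ge0_intg f : measurable_fun [set: T] f -> (forall x, 0 <= f x) ->
  (\int[mu]_x (f x)%:E < +oo)%E -> intg f.
Proof.
move=> mf f0 foo; apply/integrableP; split; first exact/measurable_EFinP.
by under eq_integral do rewrite gee0_abs ?lee_fin//.
Qed.

Lemma intg_lty f : intg f -> (\int[mu]_x (f x)%:E < +oo)%E.
Proof. exact: integrable_lty. Qed.

Lemma intg_dom f g : measurable_fun [set: T] f -> (forall x, `|f x| <= g x) ->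
  intg g -> intg f.
Proof.
move=> mf fg; apply: le_integrable => //; first exact/measurable_EFinP.
move=> x _ /=; rewrite lee_fin; apply: le_trans (fg x) _; exact: ler_norm.
Qed.

Lemma intgD f g : intg f -> intg g -> intg (fun x => f x + g x).
Proof.
move=> f1 g1; have := integrableD measurableT f1 g1.
exact: eq_integrable.
Qed.

Lemma intgN f : intg f -> intg (fun x => - f x).
Proof.
by move=> f1; have := integrableN f1; apply: eq_integrable.
Qed.

Lemma intgB f g : intg f -> intg g -> intg (fun x => f x - g x).
Proof. by move=> f1 g1; apply: intgD => //; apply: intgN. Qed.

Lemma intgZ k f : intg f -> intg (fun x => k * f x).
Proof.
by move=> f1; have := integrableZl measurableT k f1; apply: eq_integrable.
Qed.

Lemma intg0 : intg (fun=> 0).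
Proof. exact: integrable0. Qed.

Lemma intg_sum (I : Type) (s : seq I) (F : I -> T -> R) :
  (forall i, intg (F i)) -> intg (fun x => \sum_(i <- s) F i x).
Proof.
move=> iF; elim: s => [|i s ih].
  by apply: eq_intg intg0 => x; rewrite big_nil.
by apply: eq_intg (intgD (iF i) ih) => x; rewrite big_cons.
Qed.

Lemma intg_norm f : intg f -> intg (fun x => `|f x|).
Proof.
move=> f1; have := integrable_abse f1; exact: eq_integrable.
Qed.

Lemma intg_mulbnd f h (M : R) : measurable_fun [set: T] h ->
  (forall x, `|h x| <= M) -> intg f -> intg (fun x => h x * f x).
Proof.
move=> mh hM f1; apply: (intg_dom (g := fun x => M * `|f x|)).
- by apply: measurable_funM => //; exact: intg_mfun.
- by move=> x; rewrite normrM ler_wpM2r.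
- exact/intgZ/intg_norm.
Qed.

Lemma sqintgP f : sqintg f <-> measurable_fun [set: T] f /\ intg (fun x => f x ^+ 2).
Proof.
split => [] [mf h]; split => //.
  by apply: ge0_intg => //; [exact: measurable_funX|move=> x; exact: sqr_ge0].
exact: intg_lty h.
Qed.

Lemma sqintg_mfun f : sqintg f -> measurable_fun [set: T] f.
Proof. by case. Qed.

Lemma sqintg_sqr f : sqintg f -> intg (fun x => f x ^+ 2).
Proof. by move=> /sqintgP[]. Qed.

Lemma sqintg_dom f g : measurable_fun [set: T] f -> (forall x, `|f x| <= `|g x|) ->
  sqintg g -> sqintg f.
Proof.
move=> mf fg /sqintgP[mg ig]; apply/sqintgP; split => //.
apply: intg_dom ig; first exact: measurable_funX.
by move=> x; rewrite ger0_norm ?sqr_ge0// -[leLHS]real_normK ?num_real// -[leRHS]real_normK ?num_real// ler_pXn2r// nnegrE.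
Qed.

Lemma sqintgM f g : sqintg f -> sqintg g -> intg (fun x => f x * g x).
Proof.
move=> /sqintgP[mf f2] /sqintgP[mg g2].
apply: (intg_dom (g := fun x => f x ^+ 2 + g x ^+ 2)); last exact: intgD.
  exact: measurable_funM.
move=> x; rewrite normrM; have := real_normK (num_real (f x)).
have := real_normK (num_real (g x)) => <- <-.
have := sqr_ge0 (`|f x| - `|g x|); have := sqr_ge0 (`|f x|); have := sqr_ge0 (`|g x|).
nra.
Qed.

Lemma sqintgD f g : sqintg f -> sqintg g -> sqintg (fun x => f x + g x).
Proof.
move=> sf sg; have fg := sqintgM sf sg.
move/sqintgP : sf => [mf f2]; move/sqintgP : sg => [mg g2].
apply/sqintgP; split; first exact: measurable_funD.
apply: eq_intg (intgD f2 (intgD (intgZ 2 fg) g2)) => x /=; ring.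
Qed.

Lemma sqintgZ k f : sqintg f -> sqintg (fun x => k * f x).
Proof.
move=> /sqintgP[mf f2]; apply/sqintgP; split; first exact: measurable_funM.
by apply: eq_intg (intgZ (k ^+ 2) f2) => x /=; ring.
Qed.

Lemma sqintgN f : sqintg f -> sqintg (fun x => - f x).
Proof.
move=> /(sqintgZ (-1)) [m1 m2]; split.
  by apply: eq_measurable_fun m1 => x _; ring.
by move: m2; under eq_integral do rewrite mulN1r.
Qed.

Lemma sqintgB f g : sqintg f -> sqintg g -> sqintg (fun x => f x - g x).
Proof. by move=> f1 g1; apply: sqintgD => //; apply: sqintgN. Qed.

Lemma sqintg0 : sqintg (fun=> 0).
Proof.
apply/sqintgP; split => //; apply: eq_intg intg0 => x; rewrite expr0n//.
Qed.

Lemma sqintg_sum (I : Type) (s : seq I) (F : I -> T -> R) :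
  (forall i, sqintg (F i)) -> sqintg (fun x => \sum_(i <- s) F i x).
Proof.
move=> iF; elim: s => [|i s ih].
  by have -> : (fun x => \sum_(i <- [::]) F i x) = (fun=> 0);
    [apply/funext => x; rewrite big_nil|exact: sqintg0].
have -> : (fun x => \sum_(j <- i :: s) F j x) = (fun x => F i x + \sum_(j <- s) F j x).
  by apply/funext => x; rewrite big_cons.
exact: sqintgD.
Qed.

Lemma sqintg_norm f : sqintg f -> sqintg (fun x => `|f x|).
Proof.
move=> sf; have mf := sqintg_mfun sf; apply: sqintg_dom sf => [|x]; last by rewrite normr_id.
exact: measurableT_comp.
Qed.

Lemma sqintg_mulbnd f h (M : R) : measurable_fun [set: T] h ->
  (forall x, `|h x| <= M) -> sqintg f -> sqintg (fun x => h x * f x).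
Proof.
move=> mh hM sf; apply: (sqintg_dom (g := fun x => M * f x)); last exact: sqintgZ.
  by apply: measurable_funM => //; case: sf.
move=> x; rewrite !normrM ler_wpM2r// (le_trans (hM x))// ler_norm//.
Qed.

Lemma EFin_int f : intg f -> ((\int[mu]_x f x)%:E = \int[mu]_x (f x)%:E)%E.
Proof. by move=> f1; rewrite fineK// integrable_fin_num. Qed.

Lemma int_add f g : intg f -> intg g ->
  \int[mu]_x (f x + g x) = \int[mu]_x f x + \int[mu]_x g x.
Proof. by move=> f1 g1; rewrite RintegralD. Qed.

Lemma int_sub f g : intg f -> intg g ->
  \int[mu]_x (f x - g x) = \int[mu]_x f x - \int[mu]_x g x.
Proof. by move=> f1 g1; rewrite RintegralB. Qed.

Lemma int_scale k f : intg f -> \int[mu]_x (k * f x) = k * \int[mu]_x f x.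
Proof. by move=> f1; rewrite RintegralZl. Qed.

Lemma int_zero : \int[mu]_x (0 : R) = 0.
Proof. by rewrite /Rintegral integral0. Qed.

Lemma int_ge0 f : (forall x, 0 <= f x) -> 0 <= \int[mu]_x f x.
Proof. by move=> f0; apply: Rintegral_ge0. Qed.

Lemma le_int f g : intg f -> intg g -> (forall x, f x <= g x) ->
  \int[mu]_x f x <= \int[mu]_x g x.
Proof. by move=> f1 g1 fg; apply: le_Rintegral. Qed.

Lemma ae_eq_int f g : measurable_fun [set: T] f -> measurable_fun [set: T] g ->
  {ae mu, forall x, f x = g x} -> \int[mu]_x f x = \int[mu]_x g x.
Proof.
move=> mf mg fg; rewrite /Rintegral; congr fine.
apply: ae_eq_integral => //; [exact/measurable_EFinP..|].
by apply: filterS fg => x -> _.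
Qed.

Lemma ae_le_int f g : intg f -> intg g -> {ae mu, forall x, f x <= g x} ->
  \int[mu]_x f x <= \int[mu]_x g x.
Proof.
move=> f1 g1 fg.
have mf := intg_mfun f1; have mg := intg_mfun g1.
have m1 : measurable_fun [set: T] (fun x => Num.min (f x) (g x)) by exact: measurable_minr.
rewrite (@ae_eq_int f (fun x => Num.min (f x) (g x)))//.
  apply: le_int => // [|x]; last by rewrite ge_min lexx orbT.
  apply: (intg_dom (g := fun x => `|f x| + `|g x|)) => //.
    move=> x; rewrite /Num.min; case: ifPn => _; rewrite ?lerDl ?lerDr//.
  by apply: intgD; exact: intg_norm.
by apply: filterS fg => x fgx; rewrite min_l.
Qed.

Lemma ae_intg_dom f g : measurable_fun [set: T] f ->
  {ae mu, forall x, `|f x| <= g x} -> intg g -> intg f.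
Proof.
move=> mf fg ig.
have mg := intg_mfun ig.
apply/integrableP; split; first exact/measurable_EFinP.
apply: le_lt_trans (intg_lty (intg_norm ig)).
apply: ae_ge0_le_integral => //.
- exact/measurableT_comp/measurable_EFinP.
- by apply/measurable_EFinP/measurableT_comp.
- apply: filterS fg => x h _ /=; rewrite lee_fin (le_trans h)// ler_norm//.
Qed.

(** The integral of a nonnegative function is a supremum over the simple functions below it, hence
    monotone even for non-measurable functions. It is meant for the supremum over an uncountable set
    of times in [S2]. *)
Lemma ge0_le_integral_nomeas (f g : T -> \bar R) : (forall x, 0 <= f x)%E ->
  (forall x, f x <= g x)%E -> (\int[mu]_x f x <= \int[mu]_x g x)%E.
Proof.
move=> f0 fg; have g0 x : (0 <= g x)%E by exact: le_trans (f0 x) (fg x).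
rewrite !ge0_integralTE//; apply: le_ereal_sup => _ [h hf <-].
by exists h => // x; exact: le_trans (hf x) (fg x).
Qed.

End integrable_functions.

(** * A convex C^2 substitute for the square of the positive part *)

Section smooth_positive_part.
Variable R : realType.
Implicit Types x y a b m : R.

(* The C^2 function vanishing on x <= 0 with second derivative min(x^+, 1). It
   behaves like x^2 at infinity, and phi1 ^ 2 <= 2 * phi2 * phi lets the second
   order term of a Taylor expansion absorb the z-part of the driver. *)
Definition phi x := (Num.max x 0 ^+ 3 - Num.max (x - 1) 0 ^+ 3) / 6.
Definition phi1 x := (Num.max x 0 ^+ 2 - Num.max (x - 1) 0 ^+ 2) / 2.
Definition phi2 x := Num.max x 0 - Num.max (x - 1) 0.

Lemma phiP x :
  [\/ [/\ x <= 0, phi x = 0, phi1 x = 0 & phi2 x = 0],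
      [/\ 0 < x, x <= 1, phi x = x ^+ 3 / 6, phi1 x = x ^+ 2 / 2 & phi2 x = x] |
      [/\ 1 < x, phi x = x ^+ 2 / 2 - x / 2 + 1 / 6, phi1 x = x - 1 / 2 & phi2 x = 1]].
Proof.
rewrite /phi /phi1 /phi2; have [x0|x0] := leP x 0.
  constructor 1; have ->: Num.max (x - 1) 0 = 0 by apply: max_r; lra.
  by split => //; field.
have [x1|x1] := leP x 1.
  constructor 2; have ->: Num.max (x - 1) 0 = 0 by apply: max_r; lra.
  by split => //; field.
constructor 3; have ->: Num.max (x - 1) 0 = x - 1 by apply: max_l; lra.
by split => //; field.
Qed.

Lemma phi_ge0 x : 0 <= phi x.
Proof.
case: (phiP x) => [[_ -> _ _]//|[x0 _ -> _ _]|[x1 -> _ _]].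
- by rewrite divr_ge0// exprn_ge0// ltW.
- nra.
Qed.

Lemma phi_le_sqr x : phi x <= x ^+ 2.
Proof.
case: (phiP x) => [[_ -> _ _]|[x0 x1 -> _ _]|[x1 -> _ _]]; first exact: sqr_ge0.
- have : 0 <= x ^+ 2 * (1 - x) by rewrite mulr_ge0 ?sqr_ge0//; lra.
  by have := sqr_ge0 x; nra.
- nra.
Qed.

Lemma phi_eq0 x : x <= 0 -> phi x = 0.
Proof. by move=> x0; case: (phiP x) => [[_ -> _ _]//|[]|[]]; lra. Qed.

Lemma phi_le0 x : phi x <= 0 -> x <= 0.
Proof.
case: (phiP x) => [[//]|[x0 x1 -> _ _]|[x1 -> _ _]]; last nra.
have := exprn_gt0 3 x0; lra.
Qed.

Lemma phi1_ge0 x : 0 <= phi1 x.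
Proof.
case: (phiP x) => [[_ _ -> _]//|[x0 _ _ -> _]|[x1 _ -> _]]; last lra.
by rewrite divr_ge0 ?sqr_ge0.
Qed.

Lemma phi1_le x : phi1 x <= `|x|.
Proof.
have := ler_norm x.
case: (phiP x) => [[_ _ -> _]//|[x0 x1 _ -> _]|[x1 _ -> _]]; nra.
Qed.

Lemma phi1_eq0 x : x <= 0 -> phi1 x = 0.
Proof. by move=> x0; case: (phiP x) => [[_ _ -> _]//|[]|[]]; lra. Qed.

Lemma phi2_ge0 x : 0 <= phi2 x.
Proof. by case: (phiP x) => [[_ _ _ ->]//|[x0 _ _ _ ->]|[x1 _ _ ->]]//; lra. Qed.

Lemma phi2_le1 x : phi2 x <= 1.
Proof. by case: (phiP x) => [[_ _ _ ->]//|[x0 x1 _ _ ->]|[x1 _ _ ->]]. Qed.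

(** On ]0, 1] it reads x^4 / 4 <= x^4 / 3, and beyond 1 it reads x^2 - x + 1/4 <= x^2 - x + 1/3. *)
Lemma phi1_sqr_le x : phi1 x ^+ 2 <= 2 * phi2 x * phi x.
Proof.
case: (phiP x) => [[_ -> -> ->]|[x0 x1 -> -> ->]|[x1 -> -> ->]]; [nra| |nra].
have : 0 <= (x ^+ 2) ^+ 2 by exact: sqr_ge0.
by rewrite -exprM; lra.
Qed.

(** For x <= m, [phi1] increases and the diagonal case at m applies; for x > m, the factor m is at
    most x and the diagonal case at x applies. On the diagonal the constant 3 is the degree of the
    cubic piece. The lemma serves the mean-field term, with m the positive part of an independent
    copy of x. *)
Lemma phi1_mul_le x m : 0 <= m -> phi1 x * m <= 3 * (phi x + phi m).
Proof.
have self y : 0 <= y -> phi1 y * y <= 3 * phi y.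
  case: (phiP y) => [[_ -> -> _]|[x0 x1 -> -> _]|[x1 -> -> _]] y0; nra.
have mono y z : y <= z -> phi1 y <= phi1 z.
  case: (phiP y) => [[y0 _ -> _]|[y0 y1 _ -> _]|[y1 _ -> _]];
  case: (phiP z) => [[z0 _ -> _]|[z0 z1 _ -> _]|[z1 _ -> _]] yz; nra.
move=> m0; have [xm|xm] := leP x m.
  have := self m m0; have := mono _ _ xm; have := phi_ge0 x; nra.
have x0 : 0 <= x by lra.
by have := self x x0; have := phi1_ge0 x; have := phi_ge0 m; nra.
Qed.

Lemma phi_tangent x y : phi x + phi1 x * (y - x) <= phi y.
Proof.
case: (phiP x) => [[x0 -> -> _]|[x0 x1 -> -> _]|[x1 -> -> _]].
- by have := phi_ge0 y; lra.
- case: (phiP y) => [[y0 -> _ _]|[y0 y1 -> _ _]|[y1 -> _ _]].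
  + have : 0 <= x ^+ 2 * (x - y) by rewrite mulr_ge0 ?sqr_ge0//; lra.
    have : 0 <= x ^+ 2 * x by rewrite mulr_ge0 ?sqr_ge0//; lra.
    have : 0 <= x ^+ 2 * - y by rewrite mulr_ge0 ?sqr_ge0//; lra.
    rewrite !exprS !expr0; lra.
  + have : 0 <= (y - x) ^+ 2 * (y + 2 * x) by rewrite mulr_ge0 ?sqr_ge0//; lra.
    rewrite !exprS !expr0; lra.
  + have : 0 <= (1 - x) ^+ 2 * (1 + 2 * x) by rewrite mulr_ge0 ?sqr_ge0//; lra.
    have : 0 <= (y - 1) * (1 - x ^+ 2) by rewrite mulr_ge0 ?subr_ge0 ?expr_le1// ; lra.
    by have := sqr_ge0 (y - 1); lra.
- case: (phiP y) => [[y0 -> _ _]|[y0 y1 -> _ _]|[y1 -> _ _]].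
  + nra.
  + have : 0 <= (1 - y) ^+ 2 * (2 + y) by rewrite mulr_ge0 ?sqr_ge0//; lra.
    have := sqr_ge0 (x - 1); have : 0 <= (x - 1) * (1 - y) by rewrite mulr_ge0//; lra.
    rewrite !exprS !expr0; lra.
  + by have := sqr_ge0 (y - x); lra.
Qed.

(** The second derivative is 1-Lipschitz, so the remainder is at most |y - x|^3 / 6; the constant is
    rounded up to 1. *)
Lemma phi_taylor x y :
  phi x + phi1 x * (y - x) + phi2 x * (y - x) ^+ 2 / 2 <= phi y + `|y - x| ^+ 3.
Proof.
case: (phiP x) => [[x0 -> -> ->]|[x0 x1 -> -> ->]|[x1 -> -> ->]].
- by have := phi_ge0 y; have := exprn_ge0 3 (normr_ge0 (y - x)); lra.
- case: (phiP y) => [[y0 -> _ _]|[y0 y1 -> _ _]|[y1 -> _ _]].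
  + rewrite ler0_norm; last lra.
    have : 0 <= (- y) ^+ 3 by rewrite exprn_ge0//; lra.
    have : 0 <= (x - y) ^+ 3 by rewrite exprn_ge0//; lra.
    rewrite !exprS !expr0; lra.
  + have : - (y - x) ^+ 3 <= `|y - x| ^+ 3.
      by rewrite -normrX -normrN ler_norm.
    have := exprn_ge0 3 (normr_ge0 (y - x)).
    rewrite !exprS !expr0; lra.
  + rewrite ger0_norm; last lra.
    have : 0 <= (y - x) ^+ 2 * (y - x) by rewrite mulr_ge0 ?sqr_ge0//; lra.
    have : 0 <= (y - 1) ^+ 2 * (1 - x) by rewrite mulr_ge0 ?sqr_ge0//; lra.
    have : 0 <= (y - 1) * ((1 - x) * (1 - x)) by rewrite !mulr_ge0//; lra.
    have : 0 <= (1 - x) * ((1 - x) * (1 - x)) by rewrite !mulr_ge0//; lra.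
    have : 0 <= (y - 1) * ((y - 1) * (y - 1)) by rewrite !mulr_ge0//; lra.
    rewrite !exprS !expr0; lra.
- case: (phiP y) => [[y0 -> _ _]|[y0 y1 -> _ _]|[y1 -> _ _]].
  + rewrite ler0_norm; last lra.
    have : 0 <= (x - 1) ^+ 2 * (- y) by rewrite mulr_ge0 ?sqr_ge0//; lra.
    have : 0 <= (x - 1) * (- y * - y) by rewrite !mulr_ge0//; lra.
    have : 0 <= (- y) * (- y * - y) by rewrite !mulr_ge0//; lra.
    have : 0 <= (x - 1) * ((x - 1) * (x - 1)) by rewrite !mulr_ge0//; lra.
    rewrite !exprS !expr0; nra.
  + rewrite ler0_norm; last lra.
    have : 0 <= (x - 1) ^+ 2 * (1 - y) by rewrite mulr_ge0 ?sqr_ge0//; lra.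
    have : 0 <= (x - 1) * ((1 - y) * (1 - y)) by rewrite !mulr_ge0//; lra.
    have : 0 <= (1 - y) * ((1 - y) * (1 - y)) by rewrite !mulr_ge0//; lra.
    have : 0 <= (x - 1) * ((x - 1) * (x - 1)) by rewrite !mulr_ge0//; lra.
    rewrite !exprS !expr0; lra.
  + have := exprn_ge0 3 (normr_ge0 (y - x)); rewrite !exprS !expr0; lra.
Qed.

(** Higher powers fall on a alone, and b enters through its square only. If |a| <= |b|, convexity
    suffices, the quadratic term being at most 2 b^2. Otherwise |y - x| <= 2 |a|, and the cubic
    remainder 8 |a|^3 is at most 4 (e a^2 + a^4 / e) by the arithmetic-geometric mean inequality. *)
Lemma phi_taylor_split x y a b (e : R) : 0 < e -> y - x = a + b ->
  phi x + phi1 x * (y - x) + phi2 x * (y - x) ^+ 2 / 2 <=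
  phi y + 2 * b ^+ 2 + 4 * (e * a ^+ 2 + a ^+ 4 / e).
Proof.
move=> e0 yxE.
have rem0 : 0 <= e * a ^+ 2 + a ^+ 4 / e.
  by apply: addr_ge0; [apply: mulr_ge0; [exact: ltW|exact: sqr_ge0]
                      |apply: divr_ge0; [exact: exprn_even_ge0|exact: ltW]].
have a2 : `|a| ^+ 2 = a ^+ 2 by rewrite real_normK ?num_real.
have b2 : `|b| ^+ 2 = b ^+ 2 by rewrite real_normK ?num_real.
have [ab|ba] := leP `|a| `|b|.
  have := phi_tangent x y.
  have : (y - x) ^+ 2 <= 4 * b ^+ 2.
    rewrite -b2 yxE -[leLHS]real_normK ?num_real//.
    have := ler_normD a b; have := normr_ge0 a; have := normr_ge0 (a + b); nra.
  have := phi2_ge0 x; have := phi2_le1 x; have := sqr_ge0 (y - x); nra.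
apply: le_trans (phi_taylor x y) _.
have h1 : `|y - x| <= 2 * `|a| by rewrite yxE; have := ler_normD a b; lra.
have h3 : `|y - x| ^+ 3 <= (2 * `|a|) ^+ 3.
  by rewrite lerXn2r// nnegrE ?normr_ge0// mulr_ge0.
have h4 : 2 * `|a| ^+ 3 <= e * a ^+ 2 + a ^+ 4 / e.
  have -> : a ^+ 4 / e = (`|a| ^+ 2) ^+ 2 / e by rewrite a2 -exprM.
  have -> : e * a ^+ 2 + (`|a| ^+ 2) ^+ 2 / e =
    2 * `|a| ^+ 3 + `|a| ^+ 2 * (e - `|a|) ^+ 2 / e.
    by rewrite -a2; field; rewrite gt_eqF.
  rewrite lerDl; apply: divr_ge0; last exact: ltW.
  by apply: mulr_ge0; exact: sqr_ge0.
have := sqr_ge0 b; move: h3; rewrite exprMn; lra.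
Qed.

Lemma measurable_pos (d : measure_display) (T : measurableType d) (f : T -> R) :
  measurable_fun [set: T] f -> measurable_fun [set: T] (fun w => Num.max (f w) 0).
Proof. by move=> mf; apply: measurable_maxr. Qed.

Lemma measurable_phi : measurable_fun [set: R] phi.
Proof.
apply: measurable_funM => //; apply: measurable_funB; apply: measurable_funX;
  apply: measurable_pos => //; exact: measurable_funB.
Qed.

Lemma measurable_phi1 : measurable_fun [set: R] phi1.
Proof.
apply: measurable_funM => //; apply: measurable_funB; apply: measurable_funX;
  apply: measurable_pos => //; exact: measurable_funB.
Qed.

Lemma measurable_phi2 : measurable_fun [set: R] phi2.
Proof.
apply: measurable_funB; apply: measurable_pos => //; exact: measurable_funB.
Qed.

End smooth_positive_part.

(** * Moments of the centred normal law *)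

Section normal_moments.
Variable R : realType.
Local Notation mu := (@lebesgue_measure R).
Implicit Types s x : R.

Lemma normal_prob_RN s : ae_eq mu [set: R]
  (Radon_Nikodym_SigmaFinite.f (normal_prob 0 s) mu) (fun x => (normal_pdf 0 s x)%:E).
Proof.
apply: integral_ae_eq => //=.
- exact: (Radon_Nikodym_SigmaFinite.f_integrable (normal_prob_dominates 0 s)).
- by apply/measurable_EFinP; exact: measurable_normal_pdf.
- move=> E _ mE; rewrite -Radon_Nikodym_SigmaFinite.f_integral//.
  exact: normal_prob_dominates.
Qed.

Lemma ge0_integral_normal_prob s (f : R -> R) : measurable_fun [set: R] f ->
  (forall x, 0 <= f x) ->
  (\int[normal_prob 0 s]_x (f x)%:E = \int[mu]_x (f x * normal_pdf 0 s x)%:E)%E.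
Proof.
move=> mf f0.
rewrite -(Radon_Nikodym_SigmaFinite.change_of_variables (normal_prob_dominates 0 s))//=.
- apply: ae_eq_integral => //.
  + apply: emeasurable_funM; first exact/measurable_EFinP.
    apply: (measurable_int mu).
    exact: (Radon_Nikodym_SigmaFinite.f_integrable (normal_prob_dominates 0 s)).
  + apply/measurable_EFinP; apply: measurable_funM => //; exact: measurable_normal_pdf.
  + apply: filterS (normal_prob_RN s) => x h _; rewrite EFinM; congr *%E; exact: h.
- exact/measurable_EFinP.
Qed.

Lemma normal_moment4_fin : (\int[normal_prob 0 1]_x ((x ^+ 4)%:E : \bar R) < +oo)%E.
Proof.
rewrite ge0_integral_normal_prob//; last by move=> x; exact: exprn_even_ge0.
have s2 : Num.sqrt 2 != 0 :> R by rewrite gt_eqF// sqrtr_gt0.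
set p1 := @normal_peak R 1; set p2 := normal_peak (Num.sqrt (2 : R)).
have p20 : 0 < p2 by exact: normal_peak_gt0.
have p10 : 0 <= p1 by exact: normal_peak_ge0.
(* The fourth power is absorbed by half of the exponent: with y = x^2, (y / 8)^2 <= exp(y / 8)^2
   gives y^2 exp(- y / 2) <= 64 exp(- y / 4), a multiple of the density of variance 2. *)
apply: (@le_lt_trans _ _ (\int[mu]_x (64 * p1 / p2 * normal_pdf 0 (Num.sqrt 2) x)%:E)%E).
  apply: ge0_le_integral => //.
  - by move=> x _; rewrite lee_fin mulr_ge0 ?exprn_even_ge0 ?normal_pdf_ge0.
  - by apply/measurable_EFinP; apply: measurable_funM => //; exact: measurable_normal_pdf.
  - by apply/measurable_EFinP; apply: measurable_funM => //; exact: measurable_normal_pdf.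
  - move=> x _; rewrite lee_fin !normal_pdfE ?oner_neq0//.
    rewrite -/p1 -/p2 [leRHS](_ : _ = p1 * (64 * normal_fun 0 (Num.sqrt 2) x)); last first.
      by field; rewrite gt_eqF.
    rewrite mulrCA ler_wpM2l// /normal_fun subr0 expr1n sqr_sqrtr//.
    set y := x ^+ 2; have y0 : 0 <= y by exact: sqr_ge0.
    have -> : x ^+ 4 = y ^+ 2 by rewrite -exprM.
    set e := expR (y / 8).
    have e1 : 1 + y / 8 <= e by exact: expR_ge1Dx.
    have e0 : 0 < e by exact: expR_gt0.
    have -> : expR (- y / (1 *+ 2)) = (e ^+ 2)^-1 * expR (- y / (2 *+ 2)).
      have -> : - y / (1 *+ 2) = - (2 * (y / 8)) + - y / (2 *+ 2) :> R.
        by field.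
      by rewrite expRD expRN expRM_natl.
    have h : y ^+ 2 * (e ^+ 2)^-1 <= 64.
      rewrite ler_pdivrMr ?exprn_gt0//.
      have : (y / 8) ^+ 2 <= e ^+ 2 by rewrite lerXn2r ?nnegrE//; lra.
      by rewrite expr_div_n; lra.
    by rewrite mulrA; apply: ler_wpM2r h; exact: expR_ge0.
under eq_integral do rewrite EFinM.
rewrite integralZl//; last exact: integrable_normal_pdf.
by rewrite integral_normal_pdf mule1 ltry.
Qed.

Definition normal_moment (k : nat) : R := \int[normal_prob 0 1]_x (x ^+ k).

Lemma normal_moment_intg k : (k <= 4)%N -> intg (normal_prob 0 1) (fun x : R => x ^+ k).
Proof.
move=> k4; have i4 : intg (normal_prob 0 1) (fun x : R => x ^+ 4).
  apply: ge0_intg => //; last exact: normal_moment4_fin.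
  by move=> x; exact: exprn_even_ge0.
have i1 : intg (normal_prob 0 1) (fun _ : R => 1).
  exact: (finite_measure_integrable_cst _ 1).
refine (@intg_dom _ _ R (normal_prob 0 1) (fun x => x ^+ k) (fun x => 1 + x ^+ 4) _ _ _);
  [exact: exprn_measurable| |exact: intgD].
move=> x; rewrite normrX.
have -> : x ^+ 4 = `|x| ^+ 4 by rewrite -normrX ger0_norm// exprn_even_ge0.
have := normr_ge0 x; move: `|x| => y y0.
have [y1|y1] := leP y 1.
  by have := exprn_ile1 k y0 y1; have := exprn_ge0 4 y0; lra.
have : y ^+ k <= y ^+ 4 by rewrite ler_weXn2l// ltW.
lra.
Qed.

(* The substitution [x |-> x / s] turns the density of N(0, 1) into that of N(0, s^2). *)
Lemma even_normal_moment s k : 0 < s -> (k <= 4)%N -> ~~ odd k ->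
  (\int[normal_prob 0 s]_x (x ^+ k)%:E = (s ^+ k * normal_moment k)%:E)%E.
Proof.
move=> s0 k4 kE; rewrite EFinM EFin_int; last exact: normal_moment_intg.
rewrite !ge0_integral_normal_prob//; [|by move=> x; exact: exprn_even_ge0..].
pose F (x : R^o) : R^o := x / s.
have dF x : is_derive x (1:R) F s^-1.
  have -> : F = (fun x => s^-1 *: x) by apply/funext => y; rewrite /F mulrC.
  by apply: is_derive_eq; rewrite scaler1.
have F'E : F^`()%classic = cst s^-1.
  by apply/funext => x; rewrite derive1E derive_val.
have Fmu x : F x = s^-1 * x by rewrite /F mulrC.
have cn : continuous (fun x : R => x ^+ k * normal_pdf 0 1 x).
  move=> x; apply: cvgM; first exact: exprn_continuous.
  by apply: continuous_normal_pdf; exact: oner_neq0.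
rewrite (increasing_ge0_integration_by_substitutionT (F := F) _ _ _ _ _ _ _ cn).
- rewrite -ge0_integralZl//=; last 3 first.
  + apply/measurable_EFinP; rewrite F'E; apply: measurable_funM => //.
    apply: (measurableT_comp (continuous_measurable_fun cn)).
    by apply: measurable_funM.
  + move=> x _; rewrite lee_fin F'E mulr_ge0 ?invr_ge0 ?(ltW s0)//.
    by rewrite mulr_ge0 ?exprn_even_ge0 ?normal_pdf_ge0.
  + by rewrite lee_fin exprn_ge0// ltW.
  apply: eq_integral => x _; rewrite -EFinM F'E; congr EFin => /=.
  rewrite !fctE !normal_pdfE ?oner_neq0 ?gt_eqF// /F /normal_fun /normal_peak.
  rewrite !subr0 !expr1n mul1r -(mulr_natr (s ^+ 2 * pi)) -mulrA sqrtrM ?sqr_ge0//.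
  rewrite sqrtr_sqr gtr0_norm// expr_div_n mulr_natr.
  have -> : - (x / s) ^+ 2 / (1 *+ 2) = - x ^+ 2 / (s ^+ 2 *+ 2).
    by field; rewrite gt_eqF.
  have sk : s ^+ k != 0 by rewrite expf_eq0 gt_eqF ?andbF.
  have p0 : Num.sqrt (pi *+ 2) != 0 :> R.
    by rewrite gt_eqF// sqrtr_gt0 mulrn_wgt0// pi_gt0.
  by field; rewrite sk p0 gt_eqF.
- by move=> x y xy; rewrite /F ltr_pM2r// invr_gt0.
- by rewrite F'E => ?; exact: cvg_cst.
- by rewrite F'E; exact: is_cvg_cst.
- by rewrite F'E; exact: is_cvg_cst.
- by move=> x; case: (dF x).
- by apply: gt0_cvgMlNy; rewrite ?invr_gt0//; exact: cvg_id.
- by apply: gt0_cvgMly; rewrite ?invr_gt0//; exact: cvg_id.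
- by move=> x; rewrite mulr_ge0 ?exprn_even_ge0 ?normal_pdf_ge0.
Qed.

(** If the moment vanished, x^2 would be almost everywhere 0, so the law would be carried by the
    point 0, to which a law with a density gives no mass. *)
Lemma normal_moment2_gt0 : 0 < normal_moment 2.
Proof.
rewrite lt_neqAle int_ge0 ?andbT; last by move=> x; exact: sqr_ge0.
apply/negP => /eqP m0.
have : (\int[normal_prob 0 1]_x `|(x ^+ 2)%:E| = 0 :> \bar R)%E.
  under eq_integral do rewrite gee0_abs ?lee_fin ?sqr_ge0//.
  by rewrite -EFin_int -?[LHS]/((normal_moment 2)%:E) -?m0//; exact: normal_moment_intg.
move/ae_eq_integral_abs => /(_ measurableT) h.
have /h : measurable_fun [set: R] (fun x : R => (x ^+ 2)%:E).
  by apply/measurable_EFinP; exact: exprn_measurable.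
move=> {}h.
have : normal_prob 0 1 [set~ (0 : R)] = 0.
  apply/eqP; rewrite eq_le measure_ge0 andbT.
  have [A [mA A0 sA]] := h.
  rewrite -A0 le_measure ?inE//; first exact: measurableC.
  move=> x /= x0; apply: sA => /= /(_ I) [] /eqP.
  by rewrite sqrf_eq0 => /eqP.
have -> : [set~ (0 : R)] = ~` [set 0] by [].
have n0 : normal_prob 0 1 [set (0 : R)] = 0%E by rewrite /normal_prob integral_set1.
move=> {}h; have e : (1 - normal_prob 0%R 1%R [set (0%R : R)] = 0)%E.
  exact: etrans (esym (probability_setC (normal_prob 0 1) (measurable_set1 0))) h.
by move: e; rewrite n0 sube0 => /eqP; rewrite onee_eq0.
Qed.

Lemma ge0_integral_lebesgueN (h : R -> R) : measurable_fun [set: R] h ->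
  (forall x, 0 <= h x) -> (\int[mu]_x (h (- x))%:E = \int[mu]_x (h x)%:E)%E.
Proof.
move=> mh h0.
have mN : measurable_fun [set: measurableTypeR R] (-%R : measurableTypeR R -> measurableTypeR R).
  exact: oppr_measurable.
have := @ge0_integral_pushforward _ _ (measurableTypeR R) (measurableTypeR R) R _ mN mu
  [set: R] (EFin \o h).
rewrite preimage_setT => <-//; last 2 first.
- exact/measurable_EFinP.
- by move=> y _; rewrite lee_fin.
by apply: eq_measure_integral => A mA _; exact: lebesgue_measureN.
Qed.

(** The positive and negative parts of x have the same integral, since the reflection x -> - x
    preserves Lebesgue measure and the density. *)
Lemma normal_mean0 s : 0 < s ->
  intg (normal_prob 0 s) (fun x : R => x) /\ \int[normal_prob 0 s]_x x = 0.
Proof.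
move=> s0.
have mid : measurable_fun [set: R] (fun x : R => x) by exact: measurable_id.
have mp : measurable_fun [set: R] (fun x : R => Num.max x 0) by exact: measurable_maxr.
have mn : measurable_fun [set: R] (fun x : R => Num.max (- x) 0).
  by apply: measurable_maxr => //; exact: oppr_measurable.
have i1 : intg (normal_prob 0 s) (fun _ : R => 1).
  exact: (finite_measure_integrable_cst _ 1).
have i2 : intg (normal_prob 0 s) (fun x : R => x ^+ 2).
  apply: ge0_intg => [|x|]; [exact: exprn_measurable|exact: sqr_ge0|].
  by rewrite even_normal_moment// ltry.
have dom (f : R -> R) : measurable_fun [set: R] f -> (forall x, `|f x| <= `|x|) ->
    intg (normal_prob 0 s) f.
  move=> mf fx.
  refine (@intg_dom _ _ R (normal_prob 0 s) f (fun x => 1 + x ^+ 2) _ _ _) => //.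
  - move=> x; apply: le_trans (fx x) _; have := sqr_ge0 (`|x| - 1).
    have := real_normK (num_real x); have := normr_ge0 x; nra.
  - exact: intgD.
have ip : intg (normal_prob 0 s) (fun x : R => Num.max x 0).
  by apply: dom => // x; rewrite ger0_norm ?le_max ?lexx ?orbT// ge_max ler_norm normr_ge0.
have im : intg (normal_prob 0 s) (fun x : R => Num.max (- x) 0).
  apply: dom => // x; rewrite ger0_norm ?le_max ?lexx ?orbT// ge_max.
  by rewrite -normrN ler_norm normr_ge0.
split; first exact: dom.
transitivity (\int[normal_prob 0 s]_x (Num.max x 0 - Num.max (- x) 0)).
  apply: eq_Rintegral => x _; case: (leP x 0) => x0.
    by rewrite max_l; lra.
  by rewrite max_r; lra.
rewrite int_sub// /Rintegral.
rewrite [X in _ - X](_ : _ = fine (\int[normal_prob 0 s]_x (Num.max x 0)%:E)) ?subrr//.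
congr fine; rewrite !ge0_integral_normal_prob//; last 2 first.
- by move=> x; rewrite le_max lexx orbT.
- by move=> x; rewrite le_max lexx orbT.
rewrite -[RHS]ge0_integral_lebesgueN.
- apply: eq_integral => x _; congr (_ * _)%:E.
  by rewrite !normal_pdfE ?gt_eqF// /normal_fun !subr0 sqrrN.
- by apply: measurable_funM => //; exact: measurable_normal_pdf.
- by move=> x; rewrite mulr_ge0 ?normal_pdf_ge0// le_max lexx orbT.
Qed.

End normal_moments.

(** * Expectation of a product of independent variables *)

Section independent_product.
Context (d : measure_display) (Om : measurableType d) (R : realType).
Variable P : probability Om R.
Implicit Types X Y : Om -> R.

(** Independence says that the law of (X, Y) agrees with the product of the two laws on rectangles,
    hence everywhere, and Fubini's theorem applies under the product law. *)
Lemma expectation_indep X Y :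
  (forall A C : set R, measurable A -> measurable C ->
    P (X @^-1` A `&` Y @^-1` C) = (P (X @^-1` A) * P (Y @^-1` C))%E) ->
  intg P X -> intg P Y ->
  intg P (fun w => X w * Y w) /\
  \int[P]_w (X w * Y w) = \int[P]_w X w * \int[P]_w Y w.
Proof.
move=> indep iX iY; have mX := intg_mfun iX; have mY := intg_mfun iY.
pose X' : {RV P >-> R} := HB.pack X (isMeasurableFun.Build _ _ _ _ X mX).
pose Y' : {RV P >-> R} := HB.pack Y (isMeasurableFun.Build _ _ _ _ Y mY).
have mXY : measurable_fun [set: Om] (fun w => (X w, Y w)) by exact: measurable_fun_pair.
pose XY : {RV P >-> (R * R)%type} :=
  HB.pack (fun w => (X w, Y w)) (isMeasurableFun.Build _ _ _ _ (fun w => (X w, Y w)) mXY).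
pose PX := distribution P X'; pose PY := distribution P Y'.
have prodE C : measurable C -> (PX \x PY)%E C = distribution P XY C.
  by apply: product_measure_unique => A D mA mD; exact: indep.
have mfst : measurable_fun [set: R * R] (fst : R * R -> R) by exact: measurable_fst.
have msnd : measurable_fun [set: R * R] (snd : R * R -> R) by exact: measurable_snd.
have mM : measurable_fun [set: R * R] (fun z : R * R => z.1 * z.2).
  exact: measurable_funM.
have mN : measurable_fun [set: R * R] (fun z : R * R => (`|z.1 * z.2|)%:E).
  by apply/measurable_EFinP; exact: measurableT_comp.
have mabs : measurable_fun [set: R] (fun z : R => (`|z|)%:E).
  by apply/measurable_EFinP; exact: normr_measurable.
(* The same computation with absolute values, by Tonelli, comes first: it yields the integrability
   of X Y that Fubini's theorem requires. *)
have absE : (\int[P]_w (`|X w * Y w|)%:E = \int[P]_w (`|X w|)%:E * \int[P]_w (`|Y w|)%:E)%E.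
  have -> : (\int[P]_w (`|X w * Y w|)%:E = \int[distribution P XY]_z (`|z.1 * z.2|)%:E)%E.
    by rewrite ge0_integral_distribution.
  have -> : (\int[P]_w (`|X w|)%:E = \int[PX]_z (`|z|)%:E)%E.
    by rewrite ge0_integral_distribution.
  have -> : (\int[P]_w (`|Y w|)%:E = \int[PY]_z (`|z|)%:E)%E.
    by rewrite ge0_integral_distribution.
  have -> : (\int[distribution P XY]_z (`|z.1 * z.2|)%:E =
             \int[(PX \x PY)%E]_z (`|z.1 * z.2|)%:E)%E.
    by apply: eq_measure_integral => A mA _; apply/esym/prodE.
  rewrite fubini_tonelli1// /fubini_F -ge0_integralZr//; last exact: integral_ge0.
  apply: eq_integral => x _; rewrite -ge0_integralZl//.
  by apply: eq_integral => y _; rewrite normrM EFinM.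
have iXY : intg P (fun w => X w * Y w).
  apply/integrableP; split; first by apply/measurable_EFinP; exact: measurable_funM.
  rewrite (_ : (\int[P]_x _ = \int[P]_w (`|X w * Y w|)%:E)%E)// absE.
  by rewrite lte_mul_pinfty ?integral_ge0 ?ge0_fin_numE ?integral_ge0//;
    exact: intg_lty (intg_norm _).
split => //; apply: EFin_inj; rewrite EFin_int// EFinM !EFin_int//.
have mM' : measurable_fun [set: R * R] (fun z : R * R => (z.1 * z.2)%:E).
  exact/measurable_EFinP.
have mid : measurable_fun [set: R] (EFin : R -> \bar R) by exact: EFin_measurable.
have jXY : (PX \x PY)%E.-integrable [set: R * R] (fun z : R * R => (z.1 * z.2)%:E).
  apply/integrableP; split => //.
  rewrite (eq_measure_integral (distribution P XY)); last by move=> A mA _; apply: prodE.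
  have -> : (\int[distribution P XY]_z `|(z.1 * z.2)%:E| = \int[P]_w (`|X w * Y w|)%:E)%E.
    by rewrite ge0_integral_distribution.
  exact: intg_lty (intg_norm iXY).
have -> : (\int[P]_w (X w * Y w)%:E = \int[distribution P XY]_z (z.1 * z.2)%:E)%E.
  by rewrite integral_distribution.
have -> : (\int[P]_w (X w)%:E = \int[PX]_z z%:E)%E by rewrite integral_distribution.
have eY : (\int[P]_w (Y w)%:E = \int[PY]_z z%:E)%E by rewrite integral_distribution.
have jX : PX.-integrable [set: R] (EFin : R -> \bar R).
  by apply: integrable_pushforward => //; rewrite preimage_setT.
have jY : PY.-integrable [set: R] (EFin : R -> \bar R).
  by apply: integrable_pushforward => //; rewrite preimage_setT.
have -> : (\int[distribution P XY]_z (z.1 * z.2)%:E =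
             \int[(PX \x PY)%E]_z (z.1 * z.2)%:E)%E.
  by apply: eq_measure_integral => A mA _; apply/esym/prodE.
pose c : R := \int[PY]_z z.
have cE : (\int[PY]_z z%:E = c%:E)%E by rewrite EFin_int.
rewrite -integral12_prod_meas1// /fubini_F eY cE -integralZr//.
apply: eq_integral => x _; rewrite -cE -integralZl//.
Qed.

End independent_product.

(** * The augmented Brownian filtration and its independence of future increments *)

Section augmented_filtration.
Context (R : realType) (d : measure_display) (Om : measurableType d).
Context (P : probability Om R) (P_complete : measure_is_complete P).
Context (n : nat) (B : R -> Om -> 'rV[R]_n).
Hypothesis B_bm : brownian_motion P B.
Implicit Types (s t a b : R) (f K W : Om -> R).

Notation F := (aug_filtration P B).

Definition adapted_at t f :=
  measurable_fun [set: g_sigma_algebraType (F t)] (f : g_sigma_algebraType (F t) -> R).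

Lemma measurable_brownian t i : 0 <= t -> measurable_fun [set: Om] (fun w => B t w ord0 i).
Proof. by move=> t0; case: B_bm => + _ _ _ _; apply. Qed.

Lemma past_events_measurable t : past_events B t `<=` measurable.
Proof.
move=> _ [s [/andP[s0 _] [i [U [mU ->]]]]].
by rewrite -[X in measurable X]setTI; exact: measurable_brownian.
Qed.

Lemma sigma_past_measurable t : <<s past_events B t >> `<=` measurable.
Proof. by apply: smallest_sub; [exact: sigma_algebra_measurable|exact: past_events_measurable]. Qed.

(** Completeness of P makes the adjoined null sets measurable. *)
Lemma aug_filtration_measurable t : F t `<=` measurable.
Proof.
apply: smallest_sub; first exact: sigma_algebra_measurable.
by move=> A [/past_events_measurable//|]; exact: P_complete.
Qed.

Lemma aug_filtration_sigma t : <<s F t >> = F t.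
Proof. exact: sigma_algebra_id (smallest_sigma_algebra _ _). Qed.

Lemma aug_filtration_mono s t : s <= t -> F s `<=` F t.
Proof.
move=> st; apply: sub_sigma_algebra2 => A [[u [/andP[u0 us] uA]]|NA]; last by right.
by left; exists u; rewrite u0 (le_trans us st).
Qed.

Lemma negligible_aug_filtration t N : P.-negligible N -> F t N.
Proof. by move=> PN; apply: sub_sigma_algebra; right. Qed.

Lemma adapted_atP t f : adapted_at t f <->
  forall U : set R, measurable U -> F t (f @^-1` U).
Proof.
split=> [mf U mU|h _ U mU]; last first.
  by rewrite setTI /measurable/= aug_filtration_sigma; exact: h.
by have := mf measurableT U mU; rewrite setTI /measurable/= aug_filtration_sigma.
Qed.

Lemma adapted_at_measurable t f : adapted_at t f -> measurable_fun [set: Om] f.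
Proof.
move=> /adapted_atP h _ U mU; rewrite setTI.
by apply: (@aug_filtration_measurable t); exact: h.
Qed.

Lemma adapted_at_mono s t f : s <= t -> adapted_at s f -> adapted_at t f.
Proof.
by move=> st /adapted_atP h; apply/adapted_atP => U /h; exact: aug_filtration_mono.
Qed.

Lemma adapted_at_brownian s t i : 0 <= s <= t -> adapted_at t (fun w => B s w ord0 i).
Proof.
move=> st; apply/adapted_atP => U mU; apply: sub_sigma_algebra; left.
by exists s; split => //; exists i, U.
Qed.

(** The preimages under f and g differ inside N, and every subset of N is negligible, hence in the
    filtration. *)
Lemma adapted_at_modif t f g (N : set Om) : P.-negligible N ->
  (forall w, ~ N w -> f w = g w) -> adapted_at t f -> adapted_at t g.
Proof.
move=> PN fg /adapted_atP mf; apply/adapted_atP => U mU.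
have -> : g @^-1` U = (f @^-1` U `\` N) `|` (g @^-1` U `&` N).
  apply/seteqP; split => w /=.
    by have [Nw|Nw] := pselect (N w) => gU; [right|left; rewrite fg].
  by case=> [[+ Nw]|[]//]; rewrite fg.
rewrite -[F t]aug_filtration_sigma.
have mN : (F t).-sigma.-measurable N.
  by rewrite /measurable/= aug_filtration_sigma; exact: negligible_aug_filtration.
apply: (@measurableU _ (g_sigma_algebraType (F t))).
  apply: measurableD => //.
  by rewrite /measurable/= aug_filtration_sigma; exact: mf.
rewrite /measurable/= aug_filtration_sigma; apply: negligible_aug_filtration.
by apply: negligibleS PN; exact: subIsetr.
Qed.

(* Every event of the augmented filtration differs by a null set from one of the
   raw filtration, so null sets do not spoil the independence of increments. *)
Lemma aug_filtration_approx t E : F t E ->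
  exists2 E0, <<s past_events B t >> E0 & P.-negligible ((E `\` E0) `|` (E0 `\` E)).
Proof.
pose C := [set E | exists2 E0, <<s past_events B t >> E0 &
  P.-negligible ((E `\` E0) `|` (E0 `\` E))].
suff: F t `<=` C by apply.
have sa := smallest_sigma_algebra [set: Om] (past_events B t).
apply: smallest_sub; last first.
  move=> A [pA|nA].
    exists A; first exact: sub_sigma_algebra.
    by rewrite setDv setU0; exact: negligible_set0.
  exists set0; first by case: sa.
  by rewrite setD0 set0D setU0.
split.
- by exists set0; [case: sa|rewrite setD0 setU0; exact: negligible_set0].
- move=> A [A0 sA0 nA]; exists (setT `\` A0); first by case: sa => _ + _; apply.
  apply: negligibleS nA => w /=.
  by case=> -[[_ h1] h2]; [right|left]; split => //; apply: contrapT => h3; apply: h2.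
- move=> A hA.
  have /choice[A0 hA0] : forall k, exists E0, <<s past_events B t >> E0 /\
      P.-negligible ((A k `\` E0) `|` (E0 `\` A k)).
    by move=> k; have [E0 ? ?] := hA k; exists E0.
  exists (\bigcup_k A0 k).
    by case: sa => _ _; apply => k; have [] := hA0 k.
  apply: (@negligibleS _ _ _ _ (\bigcup_k ((A k `\` A0 k) `|` (A0 k `\` A k)))).
    move=> w [[[k _ Ak] nA]|[[k _ Ak] nA]]; exists k => //; [left|right]; split => //.
      by move=> A0k; apply: nA; exists k.
    by move=> A0k; apply: nA; exists k.
  by apply: negligible_bigcup => k; by have [] := hA0 k.
Qed.

Lemma aug_filtration_indep s t E D : 0 <= s -> s < t -> F s E ->
  <<s coord_events (fun w => B t w - B s w) >> D -> P (E `&` D) = (P E * P D)%E.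
Proof.
move=> s0 st FE sD.
have [E0 sE0 nE] := aug_filtration_approx FE.
have mE := aug_filtration_measurable FE.
have mE0 := sigma_past_measurable sE0.
have mD : measurable D.
  move: D sD; apply: smallest_sub; first exact: sigma_algebra_measurable.
  move=> _ [i [U [mU ->]]]; rewrite -[X in measurable X]setTI.
  suff : measurable_fun [set: Om] (fun w => (B t w - B s w) ord0 i) by apply.
  have -> : (fun w => (B t w - B s w) ord0 i) = (fun w => B t w ord0 i - B s w ord0 i).
    by apply/funext => w; rewrite !mxE.
  by apply: measurable_funB; apply: measurable_brownian => //; lra.
have eqP0 (A A0 : set Om) : measurable A -> measurable A0 ->
    P.-negligible ((A `\` A0) `|` (A0 `\` A)) -> P A = P A0.
  move=> mA mA0 nA.
  have h (U V : set Om) : measurable U -> measurable V -> P.-negligible (U `\` V) ->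
      P U = P (U `&` V).
    move=> mU mV nUV; rewrite [LHS](measureDI P mU mV) [X in (X + _)%E](_ : _ = 0%E) ?add0e//.
    by apply: measure_negligible => //; exact: measurableD.
  rewrite (h A A0)// ?(h A0 A)// 1?setIC//.
    by apply: negligibleS nA; exact: subsetUr.
  by apply: negligibleS nA; exact: subsetUl.
rewrite (eqP0 _ _ mE mE0 nE) -(_ : P (E0 `&` D) = (P E0 * P D)%E); last first.
  have [_ _ _ _ h] := B_bm; exact: (h s t s0 st E0 D).
apply: eqP0; [exact: measurableI..|apply: negligibleS nE].
by move=> w [[[Ew Dw] h]|[[Ew Dw] h]]; [left|right]; split => // ?; apply: h.
Qed.

End augmented_filtration.

(** * Moments of Brownian increments, weighted by variables known at their start *)

Section brownian_increments.
Context (R : realType) (d : measure_display) (Om : measurableType d).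
Context (P : probability Om R) (P_complete : measure_is_complete P).
Context (n : nat) (B : R -> Om -> 'rV[R]_n).
Hypothesis B_bm : brownian_motion P B.
Implicit Types (s t a b : R) (K W : Om -> R) (i j : 'I_n).

Definition increment a b i : Om -> R := fun w => B b w ord0 i - B a w ord0 i.

Lemma increment_self a i w : increment a a i w = 0.
Proof. by rewrite /increment subrr. Qed.

Lemma increment_split b a c i w :
  increment a c i w = increment a b i w + increment b c i w.
Proof. by rewrite /increment; ring. Qed.

Lemma measurable_increment a b i : 0 <= a -> 0 <= b ->
  measurable_fun [set: Om] (increment a b i).
Proof.
by move=> a0 b0; apply: measurable_funB; exact: (measurable_brownian B_bm).
Qed.

Lemma adapted_at_increment a b t i : 0 <= a <= t -> 0 <= b <= t ->
  adapted_at P B t (increment a b i).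
Proof.
by move=> at_ bt; apply: measurable_funB; exact: adapted_at_brownian.
Qed.

Lemma increment_law a b i (A : set R) : 0 <= a -> a < b -> measurable A ->
  P (increment a b i @^-1` A) = normal_prob 0 (Num.sqrt (b - a)) A.
Proof.
move=> a0 ab mA; have [_ _ _ law _] := B_bm.
pose AA (j : 'I_n) : set R := if j == i then A else setT.
have := law a b a0 ab AA; rewrite (bigD1 i)//= big1 ?mule1; last first.
  by move=> j /negbTE ji; rewrite /AA ji probability_setT.
rewrite /AA eqxx => <-; last by move=> j; case: ifP.
congr (P _); apply/seteqP; split => w /=.
  by move=> Aw j; case: eqP => // ->; rewrite !mxE.
by move=> /(_ i); rewrite eqxx !mxE.
Qed.

Lemma increment_law2 a b i j (A C : set R) : 0 <= a -> a < b -> i != j ->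
  measurable A -> measurable C ->
  P (increment a b i @^-1` A `&` increment a b j @^-1` C) =
  (P (increment a b i @^-1` A) * P (increment a b j @^-1` C))%E.
Proof.
move=> a0 ab ij mA mC; rewrite !increment_law//; have [_ _ _ law _] := B_bm.
pose AA (k : 'I_n) : set R := if k == i then A else if k == j then C else setT.
have := law a b a0 ab AA.
rewrite (bigD1 i)//= (bigD1 j) 1?eq_sym//= big1 ?mule1; last first.
  by move=> k /andP[/negbTE ki /negbTE kj]; rewrite /AA ki kj probability_setT.
rewrite /AA eqxx (eq_sym j) (negbTE ij) eqxx => <-; last first.
  by move=> k; case: ifP => // _; case: ifP.
congr (P _); apply/seteqP; split => w /=.
  by move=> [Aw Cw] k; case: eqP => [->|_]; [|case: eqP => // ->]; rewrite !mxE.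
by move=> h; have := h i; have := h j; rewrite !eqxx (eq_sym j) (negbTE ij) !mxE.
Qed.

Lemma increment_integral a b i (f : R -> R) : 0 <= a -> a < b ->
  measurable_fun [set: R] f ->
  intg (normal_prob 0 (Num.sqrt (b - a))) f ->
  intg P (f \o increment a b i) /\
  \int[P]_w f (increment a b i w) = \int[normal_prob 0 (Num.sqrt (b - a))]_x f x.
Proof.
move=> a0 ab mf fi.
have mX := measurable_increment i a0 (ltW (le_lt_trans a0 ab)).
pose X : {RV P >-> measurableTypeR R} := HB.pack (increment a b i : Om -> measurableTypeR R)
  (isMeasurableFun.Build _ _ Om (measurableTypeR R) (increment a b i) mX).
have E (h : R -> \bar R) : (\int[distribution P X]_x h x =
    \int[normal_prob 0 (Num.sqrt (b - a))]_x h x)%E.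
  refine (@eq_measure_integral _ _ R setT (normal_prob 0 (Num.sqrt (b - a)))
    (distribution P X) h _) => A mA _; exact: increment_law.
have iP : intg P (f \o increment a b i).
  apply/integrableP; split.
    by apply/measurable_EFinP; exact: measurableT_comp.
  move: fi => /integrableP[_]; rewrite -E ge0_integral_distribution//.
  by apply: measurableT_comp => //; exact/measurable_EFinP.
split => //; rewrite /Rintegral -E integral_distribution//.
exact/measurable_EFinP.
Qed.

Lemma increment_mean a b i : 0 <= a -> a < b ->
  intg P (increment a b i) /\ \int[P]_w increment a b i w = 0.
Proof.
move=> a0 ab; have ba : 0 < Num.sqrt (b - a) by rewrite sqrtr_gt0 subr_gt0.
have [i1 e1] := normal_mean0 ba.
by have := increment_integral i a0 ab (@measurable_id _ _ _) i1; rewrite e1.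
Qed.

Lemma increment_even_moment a b i k : 0 <= a -> a < b -> (k <= 4)%N -> ~~ odd k ->
  intg P (fun w => increment a b i w ^+ k) /\
  \int[P]_w (increment a b i w ^+ k) = Num.sqrt (b - a) ^+ k * normal_moment R k.
Proof.
move=> a0 ab k4 kE; have ba : 0 < Num.sqrt (b - a) by rewrite sqrtr_gt0 subr_gt0.
have m := even_normal_moment ba k4 kE.
have ik : intg (normal_prob 0 (Num.sqrt (b - a))) (fun x : R => x ^+ k).
  apply: ge0_intg; [exact: exprn_measurable|by move=> x; exact: exprn_even_ge0|].
  by rewrite m ltry.
have := increment_integral i a0 ab (exprn_measurable k) ik.
by rewrite [X in _ = X]/Rintegral m.
Qed.

Lemma increment_moment2 a b i : 0 <= a -> a <= b ->
  intg P (fun w => increment a b i w ^+ 2) /\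
  \int[P]_w (increment a b i w ^+ 2) = (b - a) * normal_moment R 2.
Proof.
move=> a0; rewrite le_eqVlt => /predU1P[<-|ab].
  under eq_Rintegral do rewrite increment_self expr0n/=.
  rewrite int_zero subrr mul0r; split => //.
  by apply: eq_intg (intg0 P) => w; rewrite increment_self expr0n.
have [i1 ->] := @increment_even_moment a b i 2 a0 ab isT isT.
by rewrite sqr_sqrtr// subr_ge0 ltW.
Qed.

Lemma increment_moment4 a b i : 0 <= a -> a <= b ->
  intg P (fun w => increment a b i w ^+ 4) /\
  \int[P]_w (increment a b i w ^+ 4) = (b - a) ^+ 2 * normal_moment R 4.
Proof.
move=> a0; rewrite le_eqVlt => /predU1P[<-|ab].
  under eq_Rintegral do rewrite increment_self expr0n/=.
  rewrite int_zero subrr expr0n mul0r; split => //.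
  by apply: eq_intg (intg0 P) => w; rewrite increment_self expr0n.
have [i1 ->] := @increment_even_moment a b i 4 a0 ab isT isT.
by rewrite (exprM _ 2 2) sqr_sqrtr// subr_ge0 ltW.
Qed.

Lemma increment_sqintg a b i : 0 <= a -> a <= b -> sqintg P (increment a b i).
Proof.
move=> a0 ab; apply/sqintgP; split; last by have [] := increment_moment2 i a0 ab.
by apply: measurable_increment => //; exact: le_trans ab.
Qed.

Lemma increment_cross a b i j : 0 <= a -> a <= b ->
  \int[P]_w (increment a b i w * increment a b j w) =
  (i == j)%:R * ((b - a) * normal_moment R 2).
Proof.
move=> a0 ab; have [<-|ij] := eqVneq i j.
  by rewrite mul1r; have [_ <-] := increment_moment2 i a0 ab.
rewrite mul0r; move: ab; rewrite le_eqVlt => /predU1P[<-|ab].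
  by under eq_Rintegral do rewrite increment_self mul0r; exact: int_zero.
have [ii ei] := increment_mean i a0 ab; have [ij' ej] := increment_mean j a0 ab.
have [_ ->] := expectation_indep (fun A C => @increment_law2 a b i j A C a0 ab ij) ii ij'.
by rewrite ei mul0r.
Qed.

Lemma coord_events_increment a b i (A : set R) : measurable A ->
  coord_events (fun w => B b w - B a w) (increment a b i @^-1` A).
Proof.
move=> mA; exists i, A; split => //; apply/seteqP; split => w /=; by rewrite !mxE.
Qed.

(** Measurability for the sigma-algebra of the whole vector B_b - B_a. Products of two of its
    coordinates qualify, so the same independence argument serves for first and second moments. *)
Definition increment_measurable a b W :=
  measurable_fun [set: g_sigma_algebraType (coord_events (fun w => B b w - B a w))]
    (W : g_sigma_algebraType (coord_events (fun w => B b w - B a w)) -> R).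

Lemma increment_measurable_increment a b i : increment_measurable a b (increment a b i).
Proof.
move=> _ A mA; rewrite setTI; apply: sub_sigma_algebra.
exact: coord_events_increment.
Qed.

Lemma expectation_increment a b K W : 0 <= a -> a < b ->
  adapted_at P B a K -> increment_measurable a b W -> intg P K -> intg P W ->
  intg P (fun w => K w * W w) /\
  \int[P]_w (K w * W w) = \int[P]_w K w * \int[P]_w W w.
Proof.
move=> a0 ab aK mW iK iW; apply: expectation_indep => // A C mA mC.
apply: (aug_filtration_indep P_complete B_bm a0 ab).
  by have /adapted_atP := aK; apply.
by have := mW measurableT C mC; rewrite setTI.
Qed.

(** The martingale property of B, tested against a variable known at time a. *)
Lemma expectation_increment1 a b i K : 0 <= a -> a <= b ->
  adapted_at P B a K -> intg P K ->
  intg P (fun w => K w * increment a b i w) /\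
  \int[P]_w (K w * increment a b i w) = 0.
Proof.
move=> a0; rewrite le_eqVlt => /predU1P[<-|ab] aK iK.
  under eq_Rintegral do rewrite increment_self mulr0.
  rewrite int_zero; split => //.
  by apply: eq_intg (intg0 P) => w; rewrite increment_self mulr0.
have [ii ei] := increment_mean i a0 ab.
have := expectation_increment a0 ab aK (@increment_measurable_increment a b i) iK ii.
by rewrite ei mulr0.
Qed.

Lemma expectation_increment2 a b i j K : 0 <= a -> a <= b ->
  adapted_at P B a K -> intg P K ->
  intg P (fun w => K w * (increment a b i w * increment a b j w)) /\
  \int[P]_w (K w * (increment a b i w * increment a b j w)) =
    (i == j)%:R * ((b - a) * normal_moment R 2) * \int[P]_w K w.
Proof.
move=> a0; rewrite le_eqVlt => /predU1P[<-|ab] aK iK.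
  under eq_Rintegral do rewrite increment_self mul0r mulr0.
  rewrite int_zero subrr mul0r mulr0 mul0r; split => //.
  by apply: eq_intg (intg0 P) => w; rewrite increment_self mul0r mulr0.
have iW : intg P (fun w => increment a b i w * increment a b j w).
  by apply: sqintgM; exact/increment_sqintg/ltW.
have mW : increment_measurable a b (fun w => increment a b i w * increment a b j w).
  by apply: measurable_funM; exact: increment_measurable_increment.
have [h ->] := expectation_increment a0 ab aK mW iK iW.
by split => //; rewrite increment_cross// 1?ltW// mulrC.
Qed.

End brownian_increments.

(** * Integrals of tensor products over time and probability space *)

Section product_integral.
Context (d : measure_display) (Om : measurableType d) (R : realType).
Variable P : probability Om R.
Local Notation mu := (@lebesgue_measure R).
Local Notation nu := (mu \x P)%E.

Lemma measurable_fun1 (f : R -> R) : measurable_fun [set: R] f ->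
  measurable_fun [set: measurableTypeR R * Om] (fun z => f z.1).
Proof. by move=> mf; apply: (measurableT_comp mf); exact: measurable_fst. Qed.

Lemma measurable_fun2 (g : Om -> R) : measurable_fun [set: Om] g ->
  measurable_fun [set: measurableTypeR R * Om] (fun z => g z.2).
Proof. by move=> mg; apply: (measurableT_comp mg); exact: measurable_snd. Qed.

Lemma product_int (f : R -> R) (g : Om -> R) : intg mu f -> intg P g ->
  intg nu (fun z => f z.1 * g z.2) /\
  \int[nu]_z (f z.1 * g z.2) = \int[mu]_x f x * \int[P]_w g w.
Proof.
move=> i_f ig; have mf := intg_mfun i_f; have mg := intg_mfun ig.
have mfg : measurable_fun [set: measurableTypeR R * Om] (fun z => f z.1 * g z.2).
  by apply: measurable_funM; [exact: measurable_fun1|exact: measurable_fun2].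
have ifg : intg nu (fun z => f z.1 * g z.2).
  apply/(integrable12ltyP _); first exact/measurable_EFinP.
  under eq_integral => x _.
    under eq_integral => w _ do rewrite /= normrM EFinM.
    rewrite ge0_integralZl//; last by apply/measurable_EFinP; exact: measurableT_comp.
    rewrite -EFin_int; last exact: intg_norm.
    over.
  rewrite /= ge0_integralZr//.
  - by rewrite lte_mul_pinfty ?integral_ge0 ?lee_fin ?int_ge0 ?ltry// ge0_fin_numE ?integral_ge0//;
      exact: intg_lty (intg_norm i_f).
  - by apply/measurable_EFinP; exact: measurableT_comp.
  - by rewrite lee_fin int_ge0.
split => //; apply: EFin_inj; rewrite EFin_int// EFinM !EFin_int//.
pose c := \int[P]_w g w.
have cE : (\int[P]_w (g w)%:E = c%:E)%E by rewrite EFin_int.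
rewrite -integral12_prod_meas1// /fubini_F cE -integralZr//.
by apply: eq_integral => x _ /=; rewrite -cE -integralZl.
Qed.

End product_integral.

(** * Stochastic integrals of elementary integrands *)

Section elementary_integrals.
Context (R : realType) (d : measure_display) (Om : measurableType d).
Context (P : probability Om R) (P_complete : measure_is_complete P).
Context (n : nat) (B : R -> Om -> 'rV[R]_n).
Hypothesis B_bm : brownian_motion P B.
Local Notation mu := (@lebesgue_measure R).
Local Notation nu := (mu \x P)%E.
Implicit Types (s t a b : R) (K H : Om -> R).

(* The elementary integrand [wt 1_(lo, hi]] in the coordinate [dir]. *)
Record elem := Elem { lo : R; hi : R; dir : 'I_n; wt : Om -> R }.

Definition elem_ok s t (e : elem) : Prop :=
  [/\ s <= lo e, lo e <= hi e, hi e <= t, adapted_at P B (lo e) (wt e)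
    & exists M, forall w, `|wt e w| <= M].

(** The elements of the list may overlap and carry any directions. Differences of integrands are
    then concatenations, restrictions in time are maps, and second moments reduce to pairs of
    elements. *)
Definition elem_int (l : seq elem) (w : Om) : R :=
  \sum_(e <- l) wt e w * increment B (lo e) (hi e) (dir e) w.

Definition elem_val (l : seq elem) (i : 'I_n) (z : R * Om) : R :=
  \sum_(e <- l) (dir e == i)%:R * (lo e < z.1 <= hi e)%R%:R * wt e z.2.

Definition overlap (e e' : elem) : R :=
  Num.max 0 (Num.min (hi e) (hi e') - Num.max (lo e) (lo e')).

Lemma bounded_adapted_intg t K M : adapted_at P B t K -> (forall w, `|K w| <= M) -> intg P K.
Proof.
move=> aK KM; apply: (intg_dom (g := fun=> M)) => //.
  exact: (adapted_at_measurable P_complete B_bm aK).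
exact: finite_measure_integrable_cst.
Qed.

(** By symmetry b <= c. The longer increment is cut at b: its tail is centred given what is known at
    b, and the two increments over [a, b] remain. *)
Lemma increment_pair a b c i j K : 0 <= a -> a <= b -> a <= c ->
  adapted_at P B a K -> intg P K ->
  intg P (fun w => K w * (increment B a b i w * increment B a c j w)) /\
  \int[P]_w (K w * (increment B a b i w * increment B a c j w)) =
    (i == j)%:R * ((Num.min b c - a) * normal_moment R 2) * \int[P]_w K w.
Proof.
wlog bc : b c i j / b <= c => [hw|].
  move=> a0 ab ac aK iK; have [bc|/ltW cb] := leP b c; first by have := hw b c i j bc a0 ab ac aK iK; rewrite min_l.
  have := hw c b j i cb a0 ac ab aK iK; rewrite (min_l cb) (eq_sym i).
  have E w : K w * (increment B a c j w * increment B a b i w) =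
             K w * (increment B a b i w * increment B a c j w) by ring.
  by move=> [h1 <-]; split; [exact: eq_intg h1|apply: eq_Rintegral => w _].
move=> a0 ab ac aK iK; rewrite min_l//.
have [i1 e1] := expectation_increment1 P_complete B_bm i a0 ab aK iK.
have [i2 e2] := expectation_increment2 P_complete B_bm i j a0 ab aK iK.
have b0 : 0 <= b by lra.
have aKb : adapted_at P B b (fun w => K w * increment B a b i w).
  apply: measurable_funM; first exact: adapted_at_mono ab aK.
  by apply: adapted_at_increment; rewrite ?a0 ?ab ?b0 ?lexx.
have [i3 e3] := expectation_increment1 P_complete B_bm j b0 bc aKb i1.
have E w : K w * (increment B a b i w * increment B a c j w) =
    K w * (increment B a b i w * increment B a b j w) +
    K w * increment B a b i w * increment B b c j w.
  by rewrite (increment_split B b a c); ring.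
split; first by apply: eq_intg (intgD i2 i3) => w; rewrite E.
under eq_Rintegral do rewrite E.
by rewrite int_add// e2 e3 addr0.
Qed.

(** By symmetry e starts first, at a, and e' at a'. The part of e before a' is known at a', hence
    orthogonal to the increment of e'; what is left starts at a' and falls under
    [increment_pair]. *)
Lemma elem_pair s t H (e e' : elem) M : 0 <= s ->
  elem_ok s t e -> elem_ok s t e' ->
  adapted_at P B s H -> (forall w, `|H w| <= M) ->
  intg P (fun w => H w * ((wt e w * increment B (lo e) (hi e) (dir e) w) *
                          (wt e' w * increment B (lo e') (hi e') (dir e') w))) /\
  \int[P]_w (H w * ((wt e w * increment B (lo e) (hi e) (dir e) w) *
                    (wt e' w * increment B (lo e') (hi e') (dir e') w))) =
    normal_moment R 2 * ((dir e == dir e')%:R * overlap e e' * \int[P]_w (H w * (wt e w * wt e' w))).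
Proof.
wlog ll : e e' / lo e <= lo e' => [hw|].
  move=> s0 oe oe' aH HM; have [ll|/ltW ll] := leP (lo e) (lo e'); first exact: hw.
  have [h1 h2] := hw e' e ll s0 oe' oe aH HM.
  have E w : H w * (wt e' w * increment B (lo e') (hi e') (dir e') w *
                    (wt e w * increment B (lo e) (hi e) (dir e) w)) =
    H w * (wt e w * increment B (lo e) (hi e) (dir e) w *
                    (wt e' w * increment B (lo e') (hi e') (dir e') w)) by ring.
  split; first exact: eq_intg h1.
  transitivity (\int[P]_w (H w * (wt e' w * increment B (lo e') (hi e') (dir e') w *
                    (wt e w * increment B (lo e) (hi e) (dir e) w)))).
    by apply: eq_Rintegral => w _.
  rewrite h2 (eq_sym (dir e)) /overlap (minC (hi e)) (maxC (lo e)); congr (_ * (_ * _)).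
  by apply: eq_Rintegral => w _; congr (_ * _); rewrite mulrC.
move=> s0 [sl lh ht aw [Me We]] [sl' lh' ht' aw' [Me' We']] aH HM.
set a := lo e in sl lh aw ll *; set b := hi e in lh ht *; set i := dir e.
set a' := lo e' in sl' lh' aw' ll *; set b' := hi e' in lh' ht' *; set j := dir e'.
set K := fun w => H w * (wt e w * wt e' w).
have aK : adapted_at P B a' K.
  apply: measurable_funM; first exact: adapted_at_mono sl' aH.
  by apply: measurable_funM => //; exact: adapted_at_mono ll aw.
have KM w : `|K w| <= M * (Me * Me').
  by rewrite /K !normrM ler_pM// ?mulr_ge0// ler_pM.
have iK := bounded_adapted_intg aK KM.
(* The cutting point: if e ends before a', the second piece is the empty increment from b to b and
   the overlap vanishes. *)
pose m := Num.min b a'.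
have am : a <= m by rewrite /m le_min lh ll.
have mb : m <= b by rewrite /m ge_min lexx.
have ma : m <= a' by rewrite /m ge_min lexx orbT.
have a0 : 0 <= a by lra.
have a'0 : 0 <= a' by lra.
have m0 : 0 <= m by lra.
have aK1 : adapted_at P B a' (fun w => K w * increment B a m i w).
  apply: measurable_funM => //; apply: adapted_at_increment; first by rewrite a0 ll.
  by rewrite m0 ma.
have iK1 : intg P (fun w => K w * increment B a m i w).
  apply: sqintgM.
    apply: (sqintg_dom (g := fun=> M * (Me * Me'))).
    - exact: (adapted_at_measurable P_complete B_bm aK).
    - by move=> w; apply: le_trans (KM w) (ler_norm _).
    - apply/sqintgP; split => //; exact: (finite_measure_integrable_cst _ ((M * (Me * Me')) ^+ 2)).
  exact: (increment_sqintg B_bm).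
have [i1 e1] := expectation_increment1 P_complete B_bm j a'0 lh' aK1 iK1.
have [i2 e2] : intg P (fun w => K w * (increment B m b i w * increment B a' b' j w)) /\
  \int[P]_w (K w * (increment B m b i w * increment B a' b' j w)) =
    normal_moment R 2 * ((i == j)%:R * overlap e e' * \int[P]_w K w).
  rewrite /overlap -/a -/b -/a' -/b' (max_r ll).
  have [ba|ab] := leP b a'.
    have bm : m = b by rewrite /m min_l.
    have -> : Num.max 0 (Num.min b b' - a') = 0.
      by apply: max_l; rewrite subr_le0 ge_min ba.
    rewrite mulr0 mul0r mulr0.
    under eq_Rintegral do rewrite bm increment_self mul0r mulr0.
    split; last exact: int_zero.
    by apply: eq_intg (intg0 P) => w; rewrite bm increment_self mul0r mulr0.
  have -> : m = a' by rewrite /m min_r// ltW.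
  have [h1 h2] := increment_pair i j a'0 (ltW ab) lh' aK iK.
  split => //; rewrite h2 max_r; first by ring.
  by rewrite subr_ge0 le_min lh' ltW.
have E w : H w * (wt e w * increment B a b i w * (wt e' w * increment B a' b' j w)) =
    K w * increment B a m i w * increment B a' b' j w +
    K w * (increment B m b i w * increment B a' b' j w).
  by rewrite (increment_split B m a b) /K; ring.
split; first by apply: eq_intg (intgD i1 i2) => w; rewrite E.
under eq_Rintegral do rewrite E.
by rewrite int_add// e1 e2 add0r.
Qed.

Lemma elem_mean s t K (l : seq elem) : 0 <= s ->
  (forall e, List.In e l -> elem_ok s t e) -> adapted_at P B s K -> sqintg P K ->
  intg P (fun w => K w * elem_int l w) /\ \int[P]_w (K w * elem_int l w) = 0.
Proof.
move=> s0 + aK sK; elim: l => [|e l ih] ok.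
  rewrite /elem_int; under eq_Rintegral do rewrite big_nil mulr0.
  split; last exact: int_zero.
  by apply: eq_intg (intg0 P) => w; rewrite big_nil mulr0.
have [|h1 h2] := ih; first by move=> e' he'; apply: ok; right.
have [sl lh ht aw [M WM]] := ok e (or_introl erefl).
have aK1 : adapted_at P B (lo e) (fun w => wt e w * K w).
  by apply: measurable_funM => //; exact: adapted_at_mono sl aK.
have iK1 : intg P (fun w => wt e w * K w).
  apply: intg_mulbnd WM _; first exact: (adapted_at_measurable P_complete B_bm aw).
  have s1 : sqintg P (fun=> 1).
    by apply/sqintgP; split => //; exact: (finite_measure_integrable_cst _ (1 ^+ 2)).
  by apply: eq_intg (sqintgM sK s1) => w; rewrite mulr1.
have [h3 h4] := expectation_increment1 P_complete B_bm (dir e) (le_trans s0 sl) lh aK1 iK1.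
have E w : K w * elem_int (e :: l) w =
    wt e w * K w * increment B (lo e) (hi e) (dir e) w + K w * elem_int l w.
  by rewrite /elem_int big_cons; ring.
split; first by apply: eq_intg (intgD h3 h1) => w; rewrite E.
by under eq_Rintegral do rewrite E; rewrite int_add// h2 h4 addr0.
Qed.

End elementary_integrals.

(** * Integrability bundled with the value of the integral *)

Section integral_of_sums.
Context (d : measure_display) (T : measurableType d) (R : realType).
Variable mu : {measure set T -> \bar R}.

(** The Bochner-like predicate lets long linear combinations be integrated by composing [hasintD]
    and [hasintZ], integrability and value being propagated together. *)
Definition hasint (f : T -> R) (v : R) := intg mu f /\ \int[mu]_x f x = v.

Lemma eq_hasint f g v : f =1 g -> hasint f v -> hasint g v.
Proof. by move=> /funext ->. Qed.

Lemma hasintD f g u v : hasint f u -> hasint g v -> hasint (fun x => f x + g x) (u + v).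
Proof. by move=> [f1 <-] [g1 <-]; split; [exact: intgD|rewrite int_add]. Qed.

Lemma hasintZ k f v : hasint f v -> hasint (fun x => k * f x) (k * v).
Proof. by move=> [f1 <-]; split; [exact: intgZ|rewrite int_scale]. Qed.

Lemma hasint_sum (I : Type) (l : seq I) (F : I -> T -> R) (v : I -> R) :
  (forall e, List.In e l -> hasint (F e) (v e)) ->
  hasint (fun x => \sum_(e <- l) F e x) (\sum_(e <- l) v e).
Proof.
elim: l => [_|e l ih h].
  rewrite big_nil; split; first by apply: eq_intg (intg0 mu) => x; rewrite big_nil.
  by under eq_Rintegral do rewrite big_nil; exact: int_zero.
rewrite big_cons; apply: (@eq_hasint (fun x => F e x + \sum_(e <- l) F e x)).
  by move=> x; rewrite big_cons.
by apply: hasintD; [apply: h; left|apply: ih => e' le'; apply: h; right].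
Qed.

End integral_of_sums.

(** * The weighted Ito isometry and a fourth moment bound for simple integrands *)

Section isometry.
Context (R : realType) (d : measure_display) (Om : measurableType d).
Context (P : probability Om R) (P_complete : measure_is_complete P).
Context (n : nat) (B : R -> Om -> 'rV[R]_n).
Hypothesis B_bm : brownian_motion P B.
Local Notation mu := (@lebesgue_measure R).
Local Notation nu := (mu \x P)%E.
Local Notation elem := (elem R Om n).
Implicit Types (s t a b : R) (K H : Om -> R).

Lemma overlap_integral (e e' : elem) :
  hasint mu (fun r : R => (lo e < r <= hi e)%R%:R * (lo e' < r <= hi e')%R%:R)
    (overlap e e').
Proof.
pose I := `](Num.max (lo e) (lo e')), (Num.min (hi e) (hi e'))]%classic : set R.
have E r : (lo e < r <= hi e)%R%:R * (lo e' < r <= hi e')%R%:R = \1_I r :> R.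
  rewrite indicE /I mem_setE in_itv/= gt_max le_min.
  by case: (lo e < r); case: (r <= hi e); case: (lo e' < r); case: (r <= hi e');
    rewrite /= ?mulr0 ?mulr1.
have iI : intg mu (\1_I : R -> R) by exact: integrable_indic_itv.
have mI : lebesgue_measure I = (overlap e e')%:E.
  rewrite /I lebesgue_measure_itv/= lte_fin /overlap.
  move: (Num.max (lo e) _) (Num.min (hi e) _) => u v; case: (ltP u v) => uv /=.
    by rewrite max_r// subr_ge0 ltW.
  by rewrite max_l// subr_le0.
split; first by apply: eq_intg iI => r; rewrite E.
under eq_Rintegral do rewrite E.
transitivity (fine (lebesgue_measure I)); last by rewrite mI.
rewrite /Rintegral integral_indic//; last exact: measurable_itv.
by have -> : I `&` [set: R] = I by exact: setIT.
Qed.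

Definition sqval (l : seq elem) (z : R * Om) : R := \sum_(i < n) elem_val l i z ^+ 2.

(** Both integrals expand into one double sum over pairs of elements, by [elem_pair] on the one hand
    and by the overlap of the intervals on the other; v is that sum. The weight H is there to
    receive [phi2] of X at the left end of a step. *)
Lemma elem_isometry s t H M (l : seq elem) : 0 <= s ->
  (forall e, List.In e l -> elem_ok P B s t e) ->
  adapted_at P B s H -> (forall w, `|H w| <= M) ->
  exists v, hasint P (fun w => H w * elem_int B l w ^+ 2) (normal_moment R 2 * v) /\
            hasint nu (fun z => H z.2 * sqval l z) v.
Proof.
move=> s0 ok aH HM.
pose S := \sum_(e <- l) \sum_(e' <- l)
  (dir e == dir e')%:R * overlap e e' * \int[P]_w (H w * (wt e w * wt e' w)).
exists S; split.
  rewrite /S mulr_sumr.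
  apply: (@eq_hasint _ _ _ _ (fun w => \sum_(e <- l) \sum_(e' <- l)
     (H w * ((wt e w * increment B (lo e) (hi e) (dir e) w) *
                    (wt e' w * increment B (lo e') (hi e') (dir e') w))))).
    move=> w; rewrite expr2 /elem_int mulr_suml mulr_sumr; apply: eq_bigr => e _.
    by rewrite !mulr_sumr.
  apply: hasint_sum => e le; rewrite mulr_sumr; apply: hasint_sum => e' le'.
  exact: (elem_pair P_complete B_bm s0 (ok _ le) (ok _ le') aH HM).
apply: (@eq_hasint _ _ R nu (fun z : measurableTypeR R * Om => \sum_(e <- l) \sum_(e' <- l)
   (dir e == dir e')%:R * (((lo e < z.1 <= hi e)%R%:R * (lo e' < z.1 <= hi e')%R%:R) *
      (H z.2 * (wt e z.2 * wt e' z.2))))).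
  move=> z; rewrite /sqval.
  under [X in _ = _ * X]eq_bigr => i _.
    rewrite expr2 /elem_val mulr_suml.
    under eq_bigr do rewrite mulr_sumr.
    over.
  rewrite /= [in RHS]exchange_big mulr_sumr; apply: eq_bigr => e _.
  rewrite [in RHS]exchange_big mulr_sumr; apply: eq_bigr => e' _ /=.
  rewrite (bigD1 (dir e))//= big1 ?addr0; last first.
    by move=> i; rewrite eq_sym => /negbTE ->; rewrite !mul0r.
  rewrite eqxx (eq_sym (dir e')) [true%:R]/(1 : R) mul1r.
  by move: (_ == _)%:R (_ && _)%:R (_ && _)%:R => x y y'; ring.
apply: hasint_sum => e le; apply: hasint_sum => e' le'.
rewrite -mulrA; apply: hasintZ.
have [i1 e1] := overlap_integral e e'.
have [sl lh ht aw [Me We]] := ok _ le; have [sl' lh' ht' aw' [Me' We']] := ok _ le'.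
have iK : intg P (fun w => H w * (wt e w * wt e' w)).
  pose u := Num.max (lo e) (lo e').
  apply: (@bounded_adapted_intg _ _ _ _ P_complete _ _ B_bm u _ (M * (Me * Me'))).
    apply: measurable_funM; first by apply: adapted_at_mono aH; rewrite le_max sl.
    by apply: measurable_funM; [apply: adapted_at_mono aw|apply: adapted_at_mono aw'];
      rewrite le_max lexx ?orbT.
  by move=> w; rewrite !normrM ler_pM// ?mulr_ge0// ler_pM.
have [h1 h2] := product_int i1 iK.
by split => //; rewrite h2 e1.
Qed.

Lemma elem_int_sqintg s t (l : seq elem) : 0 <= s ->
  (forall e, List.In e l -> elem_ok P B s t e) -> sqintg P (elem_int B l).
Proof.
move=> s0; elim: l => [_|e l ih ok].
  have -> : elem_int B [::] = (fun=> 0) by apply/funext => w; rewrite /elem_int big_nil.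
  exact: sqintg0.
have -> : elem_int B (e :: l) =
    (fun w => wt e w * increment B (lo e) (hi e) (dir e) w + elem_int B l w).
  by apply/funext => w; rewrite /elem_int big_cons.
have [sl lh ht aw [M WM]] := ok e (or_introl erefl).
apply: sqintgD; last by apply: ih => e' le'; apply: ok; right.
apply: sqintg_mulbnd WM _; first exact: (adapted_at_measurable P_complete B_bm aw).
by apply: (increment_sqintg B_bm) => //; exact: le_trans sl.
Qed.

(** Restriction to ]s, t]. An element starting after t becomes an empty interval at t, where its
    weight is not yet known; the zero weight keeps it adapted. *)
Definition clamp s t (e : elem) : elem :=
  Elem (Num.max s (Num.min (lo e) t)) (Num.max s (Num.min (hi e) t)) (dir e)
    (if lo e <= t then wt e else fun=> 0).

Definition elem_upto (l : seq elem) t (w : Om) : R :=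
  \sum_(e <- l) wt e w *
    (B (Num.min (hi e) t) w ord0 (dir e) - B (Num.min (lo e) t) w ord0 (dir e)).

Lemma clamp_ok s t u v (e : elem) : s <= t -> elem_ok P B u v e ->
  elem_ok P B s t (clamp s t e).
Proof.
move=> st [_ lh _ aw [M WM]]; split => /=.
- by rewrite le_max lexx.
- rewrite ge_max !le_max lexx /=; apply/orP; right.
  by rewrite le_min !ge_min lh lexx !orbT.
- by rewrite ge_max st ge_min lexx orbT.
- case: (leP (lo e) t) => lt.
    by apply: adapted_at_mono aw; rewrite le_max lexx orbT.
  exact: measurable_cst.
- by case: ifP => _; [exists M|exists 0 => w; rewrite normr0].
Qed.

Lemma clamp_all_ok s t u v (l : seq elem) : s <= t ->
  (forall e, List.In e l -> elem_ok P B u v e) ->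
  forall e, List.In e (map (clamp s t) l) -> elem_ok P B s t e.
Proof.
move=> st; elim: l => [_ e []|e l ih ok e' /= [<-|le']].
  by apply: (@clamp_ok _ _ u v) => //; apply: ok; left.
by apply: ih le' => e0 le0; apply: ok; right.
Qed.

Lemma elem_int_clamp s t u v (l : seq elem) w : s <= t ->
  (forall e, List.In e l -> elem_ok P B u v e) ->
  elem_int B (map (clamp s t) l) w = elem_upto l t w - elem_upto l s w.
Proof.
move=> st; elim: l => [_|e l ih ok].
  by rewrite /elem_int /elem_upto !big_nil subr0.
have := ih (fun e' le' => ok e' (or_intror le')).
rewrite /elem_int /elem_upto /= !big_cons => -> /=.
have [_ lh _ _ _] := ok e (or_introl erefl); rewrite /increment /=.
set i := dir e; have [lt|tl] := leP (lo e) t; last first.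
  have th : t <= hi e by lra.
  have sl : s <= lo e by lra.
  have sh : s <= hi e by lra.
  by rewrite (min_r th) (min_r sl) (min_r sh); ring.
have [th|ht] := leP (hi e) t; have [hs|hs] := leP (hi e) s; have [ls|ls] := leP (lo e) s;
  rewrite ?(max_l hs) ?(max_l ls) ?(max_r (ltW hs)) ?(max_r (ltW ls)) ?(max_r st);
  try (by ring); exfalso; lra.
Qed.

Lemma elem_val_clamp s t (l : seq elem) i z :
  elem_val (map (clamp s t) l) i z = (s < z.1 <= t)%R%:R * elem_val l i z.
Proof.
elim: l => [|e l ih]; rewrite /elem_val /= ?big_nil ?mulr0// !big_cons mulrDr.
move: ih; rewrite /elem_val => ->; congr (_ + _); rewrite /clamp /=.
have [lt|tl] := leP (lo e) t; last first.
  rewrite mulr0; have [/andP[sz zt]|_] := boolP (s < z.1 <= t); last by rewrite mul0r.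
  have -> : (lo e < z.1) = false by apply/negbTE; rewrite -leNgt; lra.
  by rewrite /= mulr0 mul0r mulr0.
rewrite gt_max le_max le_min.
have [sz|zs] := ltP s z.1; last by rewrite /= mulr0 !mul0r.
have [zt|tz] := leP z.1 t; last by rewrite andbF /= andbF mulr0 !mul0r.
by rewrite !andbT mul1r.
Qed.

Lemma sqval_clamp s t (l : seq elem) z :
  sqval (map (clamp s t) l) z = (s < z.1 <= t)%R%:R * sqval l z.
Proof.
rewrite /sqval mulr_sumr; apply: eq_bigr => i _; rewrite elem_val_clamp.
by case: (_ && _); rewrite /= ?mul1r ?mul0r ?expr0n.
Qed.

(** Induction on the list with (x + y)^4 <= 8 x^4 + 8 y^4, each element having a bounded weight and
    a Gaussian increment. What matters is that L does not depend on s and t: once multiplied by (t -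
    s)^2 and summed over a partition, even a huge L is beaten by the mesh. *)
Lemma elem_moment4 u v (l : seq elem) : (forall e, List.In e l -> elem_ok P B u v e) ->
  exists2 L, 0 <= L & forall s t, 0 <= s -> s <= t ->
    intg P (fun w => elem_int B (map (clamp s t) l) w ^+ 4) /\
    \int[P]_w (elem_int B (map (clamp s t) l) w ^+ 4) <= L * (t - s) ^+ 2.
Proof.
elim: l => [_|e l ih ok].
  exists 0 => // s t _ _; rewrite /elem_int.
  split; first by apply: eq_intg (intg0 P) => w; rewrite big_nil expr0n.
  by under eq_Rintegral do rewrite big_nil expr0n; rewrite int_zero mul0r.
have [e' le'|L L0 hL] := ih; first by apply: ok; right.
have oe := ok e (or_introl erefl).
have [_ _ _ aw [M WM]] := oe.
have M4 : 0 <= M ^+ 4 by exact: exprn_even_ge0.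
have c4 : 0 <= normal_moment R 4.
  by apply: Rintegral_ge0 => x _; exact: exprn_even_ge0.
exists (8 * (M ^+ 4 * normal_moment R 4) + 8 * L).
  by apply: addr_ge0; apply: mulr_ge0 => //; apply: mulr_ge0.
move=> s t s0 st; have [i1 e1] := hL s t s0 st.
have [h1 h2 h3 aw' _] := clamp_ok st oe.
set e' := clamp s t e in h1 h2 h3 aw'.
have [i2 e2] := increment_moment4 B_bm (dir e) (le_trans s0 h1) h2.
have WM' w : `|wt e' w| <= `|M|.
  by rewrite /e' /=; case: ifP => _; rewrite ?normr0// (le_trans (WM w))// ler_norm.
set D := fun w => increment B (lo e') (hi e') (dir e) w.
have W4 w : `|wt e' w ^+ 4| <= M ^+ 4.
  have -> : M ^+ 4 = `|M| ^+ 4 by rewrite -normrX ger0_norm.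
  by rewrite normrX lerXn2r ?nnegrE.
have mw := adapted_at_measurable P_complete B_bm aw'.
have i3 : intg P (fun w => wt e' w ^+ 4 * D w ^+ 4).
  by apply: intg_mulbnd W4 i2; exact: measurable_funX.
have E w : elem_int B (map (clamp s t) (e :: l)) w =
   wt e' w * D w + elem_int B (map (clamp s t) l) w by rewrite /elem_int /= big_cons.
have E4 w : elem_int B (map (clamp s t) (e :: l)) w ^+ 4 <=
   8 * (wt e' w ^+ 4 * D w ^+ 4) + 8 * elem_int B (map (clamp s t) l) w ^+ 4.
  rewrite E -exprMn; set x := _ * _; set y := elem_int _ _ _.
  have h : (x + y) ^+ 2 <= 2 * (x ^+ 2 + y ^+ 2) by have := sqr_ge0 (x - y); lra.
  have -> : (x + y) ^+ 4 = ((x + y) ^+ 2) ^+ 2 by rewrite -exprM.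
  have -> : x ^+ 4 = (x ^+ 2) ^+ 2 by rewrite -exprM.
  have -> : y ^+ 4 = (y ^+ 2) ^+ 2 by rewrite -exprM.
  have := sqr_ge0 (x + y); have := sqr_ge0 x; have := sqr_ge0 y; have := sqr_ge0 (x ^+ 2 - y ^+ 2).
  move: ((x + y) ^+ 2) (x ^+ 2) (y ^+ 2) h => a b c; nra.
have i4 := intgD (intgZ 8 i3) (intgZ 8 i1).
have m4 : measurable_fun [set: Om] (fun w => elem_int B (map (clamp s t) (e :: l)) w ^+ 4).
  apply: measurable_funX; apply: sqintg_mfun.
  by apply: (@elem_int_sqintg s t) => //; exact: clamp_all_ok ok.
have i5 : intg P (fun w => elem_int B (map (clamp s t) (e :: l)) w ^+ 4).
  apply: (intg_dom m4) i4 => w; rewrite ger0_norm//; exact: exprn_even_ge0.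
split => //; apply: le_trans (le_int i5 i4 E4) _.
rewrite int_add ?int_scale//; [|exact: intgZ..].
have e3 : \int[P]_w (wt e' w ^+ 4 * D w ^+ 4) <= M ^+ 4 * normal_moment R 4 * (t - s) ^+ 2.
  apply: (@le_trans _ _ (\int[P]_w (M ^+ 4 * D w ^+ 4))).
    apply: le_int => //; first exact: intgZ.
    move=> w; apply: ler_wpM2r; first exact: exprn_even_ge0.
    exact: le_trans (ler_norm _) (W4 w).
  rewrite int_scale// e2 -mulrA ler_wpM2l// mulrC ler_wpM2l//.
  by rewrite lerXn2r ?nnegrE; lra.
lra.
Qed.

End isometry.

Lemma le_eps (R : realType) (K a b : R) : 0 <= K ->
  (forall e, 0 < e -> a <= b + K * e) -> a <= b.
Proof.
move=> K0 h; apply/ler_addgt0Pr => e e0.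
have K1 : 0 < K + 1 by lra.
apply: le_trans (h (e / (K + 1)) (divr_gt0 e0 K1)) _; rewrite lerD2l.
by rewrite mulrCA ler_piMr ?(ltW e0)// ler_pdivrMr// mul1r; lra.
Qed.

(** * Passing from simple integrands to the Ito integral *)

Section ito_approximation.
Context (R : realType) (d : measure_display) (Om : measurableType d).
Context (P : probability Om R) (P_complete : measure_is_complete P).
Context (n : nat) (B : R -> Om -> 'rV[R]_n).
Hypothesis B_bm : brownian_motion P B.
Local Notation mu := (@lebesgue_measure R).
Local Notation nu := (mu \x P)%E.
Local Notation elem := (elem R Om n).
Implicit Types (s t a b : R) (K H : Om -> R) (T : R).
Implicit Types (I : R -> Om -> R) (zeta : 'I_n -> R * Om -> R).

Definition win s t (z : R * Om) : R := (s < z.1 <= t)%R%:R.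

Definition sqn zeta (z : R * Om) : R := \sum_(i < n) zeta i z ^+ 2.

Lemma win_ge0 s t z : 0 <= win s t z.
Proof. exact: ler0n. Qed.

Lemma win_le1 s t z : `|win s t z| <= 1.
Proof. by rewrite ger0_norm ?win_ge0// /win; case: (_ && _); rewrite ?lexx ?ler01. Qed.

Lemma measurable_win s t : measurable_fun [set: measurableTypeR R * Om] (win s t).
Proof.
have -> : win s t = (fun z : measurableTypeR R * Om => \1_(`]s, t]%classic : set R) z.1).
  by apply/funext => z; rewrite /win indicE mem_setE in_itv.
by apply: measurable_fun1; apply: measurable_indic; exact: measurable_itv.
Qed.

Lemma sqn_ge0 zeta z : 0 <= sqn zeta z.
Proof. by apply: sumr_ge0 => i _; exact: sqr_ge0. Qed.

Lemma sqn_intg zeta : (forall i, sqintg nu (zeta i)) -> intg nu (sqn zeta).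
Proof. by move=> h; apply: intg_sum => i; exact: sqintg_sqr. Qed.

Lemma win_intg s t f : intg nu f -> intg nu (fun z => win s t z * f z).
Proof. exact: intg_mulbnd (measurable_win s t) (win_le1 s t). Qed.

Lemma sqn_subl zeta xi z : sqn zeta z <= 2 * sqn xi z + 2 * sqn (fun i => xi i \- zeta i) z.
Proof.
rewrite /sqn !mulr_sumr -big_split/=; apply: ler_sum => i _ /=.
by have := sqr_ge0 (2 * xi i z - zeta i z); lra.
Qed.

Lemma sqn_subr zeta xi z : sqn xi z <= 2 * sqn zeta z + 2 * sqn (fun i => xi i \- zeta i) z.
Proof.
rewrite /sqn !mulr_sumr -big_split/=; apply: ler_sum => i _ /=.
by have := sqr_ge0 (2 * zeta i z - xi i z); lra.
Qed.

Lemma measurable_elem_val (l : seq elem) s t i : (forall e, List.In e l -> elem_ok P B s t e) ->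
  measurable_fun [set: measurableTypeR R * Om] (elem_val l i).
Proof.
elim: l => [_|e l ih ok].
  have -> : elem_val ([::] : seq elem) i = (fun=> 0) by apply/funext => z; rewrite /elem_val big_nil.
  exact: measurable_cst.
have -> : elem_val (e :: l) i = (fun z => (dir e == i)%:R * win (lo e) (hi e) z * wt e z.2 +
    elem_val l i z) by apply/funext => z; rewrite /elem_val big_cons.
apply: measurable_funD; last by apply: ih => e' le'; apply: ok; right.
apply: measurable_funM.
  by apply: measurable_funM => //; exact: measurable_win.
apply: measurable_fun2; have [_ _ _ aw _] := ok e (or_introl erefl).
exact: (adapted_at_measurable P_complete B_bm aw).
Qed.

Lemma sqintg1 : sqintg P (fun=> 1).
Proof. by apply/sqintgP; split => //; exact: (finite_measure_integrable_cst _ (1 ^+ 2)). Qed.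

Lemma elem_val_sqintg (l : seq elem) s t i : 0 <= s ->
  (forall e, List.In e l -> elem_ok P B s t e) -> sqintg nu (elem_val l i).
Proof.
move=> s0 ok; have mv := measurable_elem_val i ok.
have a1 : adapted_at P B s (fun=> 1) by exact: measurable_cst.
have [|v [_ [i1 _]]] := elem_isometry P_complete B_bm s0 ok a1 (M := 1).
  by move=> w; rewrite normr1.
apply/sqintgP; split => //; apply: intg_dom i1; first exact: measurable_funX.
move=> z; rewrite mul1r ger0_norm ?sqr_ge0// /sqval (bigD1 i)//= lerDl.
by apply: sumr_ge0 => j _; exact: sqr_ge0.
Qed.

(** The part of [is_ito_integral] that the estimates consume. A single list approximates the
    integrand globally and the integral at two prescribed times, which is what one increment
    requires, and the property passes to differences. *)
Definition ito_approx T I zeta : Prop :=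
  [/\ forall i, sqintg nu (zeta i),
      forall t, 0 <= t <= T -> sqintg P (I t)
    & forall s t e, 0 <= s <= T -> 0 <= t <= T -> 0 < e ->
      exists l : seq elem,
      [/\ forall x, List.In x l -> elem_ok P B 0 T x,
          \int[nu]_z sqn (fun i => elem_val l i \- zeta i) z <= e,
          \int[P]_w (elem_upto B l s w - I s w) ^+ 2 <= e
        & \int[P]_w (elem_upto B l t w - I t w) ^+ 2 <= e]].

Definition elem_opp (e : elem) : elem := Elem (lo e) (hi e) (dir e) (fun w => - wt e w).

Lemma elem_opp_ok s t (l : seq elem) : (forall x, List.In x l -> elem_ok P B s t x) ->
  forall x, List.In x (map elem_opp l) -> elem_ok P B s t x.
Proof.
elim: l => [_ e []|e l ih ok e' /= [<-|le']]; last first.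
  by apply: ih le' => e0 le0; apply: ok; right.
have [h1 h2 h3 h4 [M hM]] := ok e (or_introl erefl).
split => //; last by exists M => w /=; rewrite normrN.
exact: measurable_funN.
Qed.

Lemma elem_upto_sub (l1 l2 : seq elem) t w :
  elem_upto B (l1 ++ map elem_opp l2) t w = elem_upto B l1 t w - elem_upto B l2 t w.
Proof.
rewrite /elem_upto big_cat big_map -sumrN; congr (_ + _).
by apply: eq_bigr => e _ /=; rewrite mulNr.
Qed.

Lemma elem_val_sub (l1 l2 : seq elem) i z :
  elem_val (l1 ++ map elem_opp l2) i z = elem_val l1 i z - elem_val l2 i z.
Proof.
rewrite /elem_val big_cat big_map -sumrN; congr (_ + _).
by apply: eq_bigr => e _ /=; rewrite mulrN.
Qed.

Lemma elem_upto_sqintg T (l : seq elem) t : 0 <= t ->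
  (forall x, List.In x l -> elem_ok P B 0 T x) -> sqintg P (elem_upto B l t).
Proof.
move=> t0; elim: l => [_|e l ih ok].
  have -> : elem_upto B [::] t = (fun=> 0) by apply/funext => w; rewrite /elem_upto big_nil.
  exact: sqintg0.
have -> : elem_upto B (e :: l) t = (fun w => wt e w *
    increment B (Num.min (lo e) t) (Num.min (hi e) t) (dir e) w + elem_upto B l t w).
  by apply/funext => w; rewrite /elem_upto big_cons.
apply: sqintgD; last by apply: ih => x lx; apply: ok; right.
have [l0 lh hT aw [M WM]] := ok e (or_introl erefl).
apply: sqintg_mulbnd WM _; first exact: (adapted_at_measurable P_complete B_bm aw).
apply: (increment_sqintg B_bm); first by rewrite le_min l0.
by rewrite le_min !ge_min lh lexx !orbT.
Qed.

Lemma int_sqr_sub (f g : Om -> R) e1 e2 : sqintg P f -> sqintg P g ->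
  \int[P]_w f w ^+ 2 <= e1 -> \int[P]_w g w ^+ 2 <= e2 ->
  \int[P]_w (f w - g w) ^+ 2 <= 2 * e1 + 2 * e2.
Proof.
move=> sf sg f1 g2.
have i1 := sqintg_sqr sf; have i2 := sqintg_sqr sg.
apply: (@le_trans _ _ (\int[P]_w (2 * f w ^+ 2 + 2 * g w ^+ 2))).
  apply: le_int; first exact/sqintg_sqr/sqintgB.
    by apply: intgD; exact: intgZ.
  by move=> w; have := sqr_ge0 (f w + g w); lra.
rewrite int_add ?int_scale//; [lra|exact: intgZ..].
Qed.

Lemma ito_approxB T I1 I2 z1 z2 : ito_approx T I1 z1 -> ito_approx T I2 z2 ->
  ito_approx T (fun t w => I1 t w - I2 t w) (fun i => z1 i \- z2 i).
Proof.
move=> [sz1 sI1 h1] [sz2 sI2 h2]; split.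
- by move=> i; exact: sqintgB.
- by move=> t tT; apply: sqintgB; [exact: sI1|exact: sI2].
move=> s t e sT tT e0.
have e4 : 0 < e / 4 by lra.
have [l1 [ok1 a1 b1 c1]] := h1 s t _ sT tT e4.
have [l2 [ok2 a2 b2 c2]] := h2 s t _ sT tT e4.
exists (l1 ++ map elem_opp l2).
have sv i (l : seq elem) : (forall x, List.In x l -> elem_ok P B 0 T x) -> sqintg nu (elem_val l i).
  by move=> ok; apply: elem_val_sqintg ok.
have up (u : R) I l : 0 <= u <= T -> (forall t, 0 <= t <= T -> sqintg P (I t)) ->
    (forall x, List.In x l -> elem_ok P B 0 T x) ->
    sqintg P (fun w => elem_upto B l u w - I u w).
  move=> uT sI ok; apply: sqintgB; last exact: sI.
  by apply: elem_upto_sqintg ok; case/andP: uT.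
have fin (u : R) : 0 <= u <= T ->
    \int[P]_w (elem_upto B l1 u w - I1 u w) ^+ 2 <= e / 4 ->
    \int[P]_w (elem_upto B l2 u w - I2 u w) ^+ 2 <= e / 4 ->
    \int[P]_w (elem_upto B (l1 ++ map elem_opp l2) u w - (I1 u w - I2 u w)) ^+ 2 <= e.
  move=> uT f1 f2.
  have := int_sqr_sub (up u _ _ uT sI1 ok1) (up u _ _ uT sI2 ok2) f1 f2.
  have -> : 2 * (e / 4) + 2 * (e / 4) = e by lra.
  apply: le_trans; rewrite le_eqVlt; apply/orP; left; apply/eqP.
  by apply: eq_Rintegral => w _; rewrite elem_upto_sub; congr (_ ^+ 2); ring.
split; last exact: fin; last exact: fin.
- by move=> x /List.in_app_iff[/ok1//|]; exact: elem_opp_ok.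
- have j1 : intg nu (sqn (fun i => elem_val l1 i \- z1 i)).
    by apply: sqn_intg => i; apply: sqintgB => //; exact: sv.
  have j2 : intg nu (sqn (fun i => elem_val l2 i \- z2 i)).
    by apply: sqn_intg => i; apply: sqintgB => //; exact: sv.
  apply: (@le_trans _ _ (\int[nu]_z (2 * sqn (fun i => elem_val l1 i \- z1 i) z +
      2 * sqn (fun i => elem_val l2 i \- z2 i) z))).
    apply: le_int.
    + apply: sqn_intg => i; apply: sqintgB; last exact: sqintgB.
      apply: (@elem_val_sqintg _ 0 T) => // x /List.in_app_iff[/ok1//|].
      exact: elem_opp_ok.
    + by apply: intgD; exact: intgZ.
    + move=> z; rewrite /sqn !mulr_sumr -big_split/=; apply: ler_sum => i _ /=.
      rewrite elem_val_sub.
      by have := sqr_ge0 ((elem_val l1 i z - z1 i z) + (elem_val l2 i z - z2 i z)); lra.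
  rewrite int_add ?int_scale//; [lra|exact: intgZ..].
Qed.

Lemma elem_ito_approx T (l : seq elem) : (forall x, List.In x l -> elem_ok P B 0 T x) ->
  ito_approx T (elem_upto B l) (elem_val l).
Proof.
move=> ok; split.
- by move=> i; apply: elem_val_sqintg ok.
- by move=> t /andP[t0 _]; exact: elem_upto_sqintg ok.
move=> s t e _ _ e0; exists l; split => //.
- rewrite (_ : \int[nu]_z _ = 0) ?ltW//.
  transitivity (\int[nu]_z (0 : R)); last exact: int_zero.
  by apply: eq_Rintegral => z _; apply: big1 => i _ /=; rewrite subrr expr0n.
- rewrite (_ : \int[P]_w _ = 0) ?ltW//.
  transitivity (\int[P]_w (0 : R)); last exact: int_zero.
  by apply: eq_Rintegral => z _; rewrite subrr expr0n.
- rewrite (_ : \int[P]_w _ = 0) ?ltW//.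
  transitivity (\int[P]_w (0 : R)); last exact: int_zero.
  by apply: eq_Rintegral => z _; rewrite subrr expr0n.
Qed.

Section increments_of_ito.
Variables (T : R) (I : R -> Om -> R) (zeta : 'I_n -> R * Om -> R).
Hypothesis IZ : ito_approx T I zeta.
Variables (s t : R).
Hypotheses (s0 : 0 <= s) (st : s <= t) (tT : t <= T).

Let c := normal_moment R 2.
Let c0 : 0 < c. Proof. exact: normal_moment2_gt0. Qed.
Let M w := I t w - I s w.
Let sIT : 0 <= s <= T. Proof. by rewrite s0 (le_trans st). Qed.
Let tIT : 0 <= t <= T. Proof. by rewrite tT (le_trans s0). Qed.

Lemma ito_increment_sqintg : sqintg P M.
Proof. by case: IZ => _ h _; apply: sqintgB; exact: h. Qed.

Let elem_increment (e : R) : 0 < e -> exists l : seq elem,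
  let M' := elem_int B (map (clamp s t) l) in
  [/\ forall x, List.In x (map (clamp s t) l) -> elem_ok P B s t x,
      sqintg P (fun w => M' w - M w), \int[P]_w (M' w - M w) ^+ 2 <= 4 * e,
      intg nu (sqn (fun i => elem_val l i \- zeta i)) &
      \int[nu]_z sqn (fun i => elem_val l i \- zeta i) z <= e].
Proof.
move=> e0; have [sz sI h] := IZ; have [l [ok a b b']] := h s t e sIT tIT e0.
exists l => M'.
have ok' := clamp_all_ok st ok.
have sM' : sqintg P M' by exact: (elem_int_sqintg P_complete B_bm s0 ok').
split => //.
- by apply: sqintgB => //; exact: ito_increment_sqintg.
- have s1 : sqintg P (fun w => elem_upto B l t w - I t w).
    by apply: sqintgB; [apply: elem_upto_sqintg ok; case/andP: tIT|exact: sI].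
  have s2 : sqintg P (fun w => elem_upto B l s w - I s w).
    by apply: sqintgB; [apply: elem_upto_sqintg ok|exact: sI].
  have := int_sqr_sub s1 s2 b' b.
  have -> : 2 * e + 2 * e = 4 * e by lra.
  apply: le_trans; rewrite le_eqVlt; apply/orP; left; apply/eqP.
  apply: eq_Rintegral => w _; rewrite /M' (elem_int_clamp _ st ok); congr (_ ^+ 2).
  by rewrite /M; ring.
- by apply: sqn_intg => i; apply: sqintgB => //; exact: elem_val_sqintg ok.
Qed.

(** The simple increments satisfy it exactly by [elem_mean], and the error is passed to the limit
    with the Young inequality. *)
Lemma ito_increment_mean G : adapted_at P B s G -> sqintg P G ->
  \int[P]_w (G w * M w) = 0.
Proof.
move=> aG sG; have iGM := sqintgM sG ito_increment_sqintg.
have iG := sqintg_sqr sG.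
pose K := \int[P]_w (G w ^+ 2) + 4.
have K0 : 0 <= K by rewrite addr_ge0// int_ge0// => w; exact: sqr_ge0.
suff h e : 0 < e -> `|\int[P]_w (G w * M w)| <= 0 + K * e.
  by apply/eqP; rewrite -normr_le0; exact: le_eps K0 h.
(* The approximation is taken at level e^2: |G D| <= e G^2 + D^2 / e, and the mean of D^2 is at most
   4 e^2, so both terms are of order e. This is the origin of the 4 in K. *)
move=> e0; have [l [ok sD D _ _]] := elem_increment (exprn_gt0 2 e0).
set M' := elem_int B _ in ok sD D.
have [i0 E0] := elem_mean P_complete B_bm s0 ok aG sG.
have iGD := sqintgM sG sD; have iD := sqintg_sqr sD.
have -> : \int[P]_w (G w * M w) = - \int[P]_w (G w * (M' w - M w)).
  rewrite -sub0r -E0 -int_sub//.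
  by apply: eq_Rintegral => w _; rewrite /M'; move: (elem_int _ _ _) (M w) => x y; ring.
rewrite normrN; apply: le_trans (le_normr_Rintegral _ iGD) _ => //.
apply: (@le_trans _ _ (\int[P]_w (e * G w ^+ 2 + e^-1 * (M' w - M w) ^+ 2))).
  apply: le_int; [exact: intg_norm|by apply: intgD; exact: intgZ|].
  move=> w; rewrite normrM -[X in e * X]real_normK ?num_real//.
  rewrite -[X in _^-1 * X]real_normK ?num_real//.
  set x := `|_|; set y := `|_|; have x0 : 0 <= x by exact: normr_ge0.
  have y0 : 0 <= y by exact: normr_ge0.
  have -> : e * x ^+ 2 + e^-1 * y ^+ 2 = x * y + (x * y + (e * x - y) ^+ 2 / e).
    by field; rewrite gt_eqF.
  rewrite lerDl; apply: addr_ge0; first exact: mulr_ge0.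
  by apply: divr_ge0; [exact: sqr_ge0|exact: ltW].
rewrite int_add ?int_scale//; [|exact: intgZ..].
rewrite add0r /K mulrDl [X in X + _ <= _]mulrC lerD2l.
rewrite mulrC ler_pdivrMr//; move: D; rewrite -mulrA; exact.
Qed.

(** The isometry holds for the simple increment; the factor 4 comes from using a^2 <= 2 b^2 + 2 (a -
    b)^2 twice, for the increments and for the integrands. *)
Lemma ito_increment_sqr_le :
  \int[P]_w (M w ^+ 2) <= 4 * c * \int[nu]_z (win s t z * sqn zeta z).
Proof.
have [sz _ _] := IZ; have iz := sqn_intg sz.
apply: (@le_eps _ (4 * c + 8)) => [|e e0]; first by have := c0; lra.
have [l [ok sD D iV V]] := elem_increment e0.
set M' := elem_int B _ in ok sD D.
have sM' := elem_int_sqintg P_complete B_bm s0 ok.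
have a1 : adapted_at P B s (fun=> 1) by exact: measurable_cst.
have [|v [[_ E] [i1 Ev]]] := elem_isometry P_complete B_bm s0 ok a1 (M := 1).
  by move=> w; rewrite normr1.
have {E}E : \int[P]_w (M' w ^+ 2) = c * v.
  by rewrite -E; apply: eq_Rintegral => w _; rewrite mul1r.
have hv : v <= 2 * \int[nu]_z (win s t z * sqn zeta z) + 2 * e.
  apply: (@le_trans _ _ (\int[nu]_z (2 * (win s t z * sqn zeta z) +
     2 * sqn (fun i => elem_val l i \- zeta i) z))).
    rewrite -Ev; apply: le_int => //.
      by apply: intgD; apply: intgZ => //; exact: win_intg.
    move=> z; rewrite mul1r sqval_clamp -/(win s t z) -[sqval l z]/(sqn (elem_val l) z).
    have := sqn_subr zeta (elem_val l) z; have := sqn_ge0 zeta z.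
    have := sqn_ge0 (fun i => elem_val l i \- zeta i) z.
    by rewrite /win; case: (_ && _); rewrite ?mul0r ?mul1r; lra.
  rewrite int_add ?int_scale//; [lra|exact: win_intg|exact/intgZ/win_intg|exact: intgZ].
have := int_sqr_sub sM' sD (lexx _) D; rewrite E.
have -> : \int[P]_w (M' w - (M' w - M w)) ^+ 2 = \int[P]_w (M w ^+ 2).
  by apply: eq_Rintegral => w _; congr (_ ^+ 2); ring.
move=> h; apply: le_trans h _.
have := ler_wpM2l (ltW c0) hv; lra.
Qed.

(** The same two comparisons in the opposite direction, hence the loss of a factor 4. This energy is
    what absorbs the z-part of the driver. *)
Lemma ito_increment_sqr_ge H (h : R) : adapted_at P B s H -> (forall w, 0 <= H w <= h) ->
  c / 4 * \int[nu]_z (H z.2 * (win s t z * sqn zeta z)) <= \int[P]_w (H w * M w ^+ 2).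
Proof.
move=> aH H0h; have [sz _ _] := IZ; have iz := sqn_intg sz.
have Hh w : `|H w| <= h by case/andP: (H0h w) => ? ?; rewrite ger0_norm.
have mH := adapted_at_measurable P_complete B_bm aH.
have mH2 : measurable_fun [set: measurableTypeR R * Om] (fun z => H z.2) by exact: measurable_fun2.
have h0 : 0 <= h by case/andP: (H0h point) => ? ?; lra.
have sM := ito_increment_sqintg.
apply: (@le_eps _ (c / 2 * h + 4 * h)) => [|e e0].
  by rewrite addr_ge0// !mulr_ge0// ?invr_ge0 ltW.
have [l [ok sD D iV V]] := elem_increment e0.
set M' := elem_int B _ in ok sD D.
have sM' := elem_int_sqintg P_complete B_bm s0 ok.
have [v [[iE E] [i1 Ev]]] := elem_isometry P_complete B_bm s0 ok aH Hh.
rewrite -/c in E.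
have iHz : intg nu (fun z => H z.2 * (win s t z * sqn zeta z)).
  by apply: (intg_mulbnd mH2 (M := h)) => [z //|]; exact: win_intg.
have hv : \int[nu]_z (H z.2 * (win s t z * sqn zeta z)) <= 2 * v + 2 * h * e.
  apply: (@le_trans _ _ (\int[nu]_z (2 * (H z.2 * sqval (map (clamp s t) l) z) +
     2 * h * sqn (fun i => elem_val l i \- zeta i) z))).
    apply: le_int => //; first by apply: intgD; exact: intgZ.
    move=> z; rewrite sqval_clamp -/(win s t z) -[sqval l z]/(sqn (elem_val l) z).
    have := sqn_subl zeta (elem_val l) z; case/andP: (H0h z.2).
    have := sqn_ge0 (fun i => elem_val l i \- zeta i) z.
    move: (sqn _ z) (sqn _ z) (sqn _ z) (H z.2) => D1 Z V1 H1 D0 H10 H1h ZV.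
    rewrite /win; case: (_ && _); rewrite ?mul0r ?mulr0 ?mul1r ?add0r.
      have := ler_wpM2l H10 ZV; have := ler_wpM2r D0 H1h; lra.
    by rewrite !mulr_ge0.
  rewrite int_add ?int_scale//; [|exact: intgZ..].
  rewrite Ev; have := ler_wpM2l h0 V; lra.
have iHM : intg P (fun w => H w * M w ^+ 2) by apply: intg_mulbnd Hh _ => //; exact: sqintg_sqr.
have iD := sqintg_sqr sD.
have : \int[P]_w (H w * M' w ^+ 2) <= 2 * \int[P]_w (H w * M w ^+ 2) + 2 * h * (4 * e).
  apply: (@le_trans _ _ (\int[P]_w (2 * (H w * M w ^+ 2) + 2 * h * (M' w - M w) ^+ 2))).
    apply: le_int => //; first by apply: intgD; exact: intgZ.
    move=> w; case/andP: (H0h w) => H10 H1h.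
    have : M' w ^+ 2 <= 2 * M w ^+ 2 + 2 * (M' w - M w) ^+ 2.
      by have := sqr_ge0 (2 * M w - M' w); lra.
    move: (M' w ^+ 2) (M w ^+ 2) ((M' w - M w) ^+ 2) (sqr_ge0 (M' w - M w)) => x y z z0 hx.
    have := ler_wpM2l H10 hx; have := ler_wpM2r z0 H1h; lra.
  rewrite int_add ?int_scale//; [|exact: intgZ..].
  by have := ler_wpM2l h0 D; lra.
rewrite E => hE; have := ler_wpM2l (ltW c0) hv; lra.
Qed.

End increments_of_ito.

End ito_approximation.

(** * A discrete backward Gronwall argument *)

Section backward_gronwall.
Context (R : realType) (u : R -> R) (K t0 T : R).
Hypotheses (u_ge0 : forall t, 0 <= u t) (uT : u T = 0) (K0 : 0 <= K) (t0T : t0 < T).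

Let step_bound (W V : R -> R) (N : nat) : (0 < N)%N ->
  (forall s t, t0 <= s -> s <= t -> t <= T -> W s <= W t) ->
  (forall s t, t0 <= s -> s <= t -> t <= T -> V s <= V t) ->
  (forall s t, t0 <= s -> s <= t -> t <= T ->
     u s <= u t + K * (t - s) * u s + (W t - W s) + (t - s) * (V t - V s)) ->
  K * ((T - t0) / N%:R) <= 1 / 2 ->
  u t0 <= expR (2 * K * (T - t0)) * ((W T - W t0) + (T - t0) / N%:R * (V T - V t0)).
Proof.
move=> N0 Wm Vm step Kh; set h := (T - t0) / N%:R in Kh *.
have N1 : 0 < N%:R :> R by rewrite ltr0n.
have h0 : 0 <= h by apply: divr_ge0; rewrite ?ler0n// subr_ge0 ltW.
have Nh : N%:R * h = T - t0 by rewrite /h mulrC divfK// gt_eqF.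
(* The growth term of a step bears on the unknown u s itself. As K h <= 1/2, 1 <= q (1 - K h), and u
   s can be isolated at the price of the factor q. *)
pose q := 1 + 2 * (K * h).
have Kh0 : 0 <= K * h by exact: mulr_ge0.
have q1 : 1 <= q by rewrite /q; lra.
have main k : (k <= N)%N -> u (T - k%:R * h) <=
    q ^+ k * ((W T - W (T - k%:R * h)) + h * (V T - V (T - k%:R * h))).
  elim: k => [_|k ih kN].
    by rewrite mul0r subr0 uT !subrr mulr0 addr0 mulr0.
  have {ih} := ih (ltnW kN).
  have kNh : k.+1%:R * h <= T - t0 by rewrite -Nh ler_wpM2r// ler_nat.
  have kh : k.+1%:R * h = k%:R * h + h by rewrite -natr1; ring.
  have kh0 : 0 <= k%:R * h by rewrite mulr_ge0.
  set t := T - k%:R * h; set s := T - k.+1%:R * h => ut.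
  have ts : t - s = h by rewrite /t /s kh; ring.
  have st : s <= t by lra.
  have tT : t <= T by rewrite /t; lra.
  have s0 : t0 <= s by rewrite /s; lra.
  have := step s t s0 st tT; rewrite ts.
  have := Wm s t s0 st tT; have := Vm s t s0 st tT.
  have := Wm t T (le_trans s0 st) tT (lexx _); have := Vm t T (le_trans s0 st) tT (lexx _).
  have qk1 : 1 <= q ^+ k by exact: exprn_ege1.
  move: ut (u_ge0 s) (u_ge0 t).
  move: (u s) (u t) (W s) (W t) (W T) (V s) (V t) (V T) => us ut Ws Wt WT Vs Vt VT.
  move=> h1 us0 ut0 h2 h3 h4 h5 h6.
  have dV : 0 <= h * (Vt - Vs) by rewrite mulr_ge0// subr_ge0.
  have h7 : us <= q * (ut + (Wt - Ws) + h * (Vt - Vs)).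
    have e0 : 0 <= ut + (Wt - Ws) + h * (Vt - Vs) by lra.
    have h8 : us * (1 - K * h) <= ut + (Wt - Ws) + h * (Vt - Vs) by lra.
    have h9 : 1 <= q * (1 - K * h) by rewrite /q; nra.
    apply: (@le_trans _ _ (us * (q * (1 - K * h)))); first by rewrite ler_peMr.
    by rewrite mulrCA ler_wpM2l//; lra.
  apply: (le_trans h7); rewrite exprS -mulrA ler_wpM2l//; first lra.
  have : (Wt - Ws) + h * (Vt - Vs) <= q ^+ k * ((Wt - Ws) + h * (Vt - Vs)).
    by rewrite ler_peMl//; lra.
  lra.
have := main N (leqnn N); rewrite Nh; have -> : T - (T - t0) = t0 by ring.
move=> h1; apply: (le_trans h1); apply: ler_wpM2r.
  rewrite addr_ge0//; first by rewrite subr_ge0; apply: Wm => //; exact: ltW.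
  by rewrite mulr_ge0// subr_ge0; apply: Vm => //; exact: ltW.
have -> : 2 * K * (T - t0) = N%:R * (2 * (K * h)) by rewrite -Nh; ring.
rewrite expRM_natl lerXn2r ?nnegrE ?expR_ge0 ?expR_ge1Dx//.
lra.
Qed.

(** The increments of W telescope to at most e whatever the partition; those of V may be large but
    carry the length of the step, so they vanish with the mesh. W and V may depend on e, since the
    mesh is chosen after them. *)
Lemma backward_gronwall :
  (forall e, 0 < e -> exists W V : R -> R,
    [/\ forall s t, t0 <= s -> s <= t -> t <= T -> W s <= W t,
        forall s t, t0 <= s -> s <= t -> t <= T -> V s <= V t,
        W T - W t0 <= e &
        forall s t, t0 <= s -> s <= t -> t <= T ->
          u s <= u t + K * (t - s) * u s + (W t - W s) + (t - s) * (V t - V s)]) ->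
  u t0 = 0.
Proof.
move=> h; apply/eqP; rewrite eq_le u_ge0 andbT.
apply: (@le_eps _ (2 * expR (2 * K * (T - t0)))); first by rewrite mulr_ge0// expR_ge0.
move=> e e0; have [W [V [Wm Vm We step]]] := h e e0.
pose D := V T - V t0.
have D0 : 0 <= D by rewrite /D subr_ge0; apply: Vm => //; exact: ltW.
(* With N > x steps of length h, the first bound gives K h <= 1/2 and the second gives h D <= e. *)
pose x := Num.max (2 * K * (T - t0)) ((T - t0) * D / e).
have x0 : 0 <= x.
  have tt : 0 <= T - t0 by rewrite subr_ge0 ltW.
  have h2 : 0 <= 2 * K * (T - t0) by rewrite !mulr_ge0.
  by rewrite le_max h2.
have [N xN] : exists N : nat, x < N%:R by exists (Num.bound x); exact: archi_boundP.
have N1 : 0 < N%:R :> R by exact: le_lt_trans xN.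
have N0 : (0 < N)%N by rewrite -(ltr0n R).
move: xN; rewrite gt_max => /andP[x1 x2].
have Kh : K * ((T - t0) / N%:R) <= 1 / 2 by rewrite mulrA ler_pdivrMr//; lra.
have := step_bound N0 Wm Vm step Kh.
have hD : (T - t0) / N%:R * D <= e.
  by rewrite mulrAC ler_pdivrMr// (mulrC e) -ler_pdivrMr// ltW.
move=> hu; apply: (le_trans hu).
rewrite add0r [leRHS]mulrAC [leRHS]mulrC; apply: ler_wpM2l; first exact: expR_ge0.
by rewrite -/D; lra.
Qed.

End backward_gronwall.

(** * Fubini's theorem for real-valued integrals *)

Section real_fubini.
Context (d1 d2 : measure_display) (T1 : measurableType d1) (T2 : measurableType d2).
Context (R : realType).
Variables (m1 : {sigma_finite_measure set T1 -> \bar R}).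
Variables (m2 : {sigma_finite_measure set T2 -> \bar R}).

(** Inner integrals are finite almost everywhere only; truncating their exceptional infinite values
    to 0 changes no outer integral. *)
Lemma fine_ae_hasint d (T : measurableType d) (m : {measure set T -> \bar R})
    (F : T -> \bar R) v : m.-integrable [set: T] F -> (\int[m]_x F x = v%:E)%E ->
  hasint m (fun x => fine (F x)) v.
Proof.
move=> iF Fv; have mF := measurable_int _ iF.
have mf : measurable_fun [set: T] (fun x => fine (F x)) by apply: measurableT_comp mF; exact: fine_measurable.
have Ff : ae_eq m [set: T] F (fun x => (fine (F x))%:E).
  by apply: filterS (integrable_ae measurableT iF) => x h xT; rewrite fineK// h.
have mf' : measurable_fun [set: T] (fun x => (fine (F x))%:E) by exact/measurable_EFinP.
split.
  apply/integrableP; split => //.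
  move/integrableP : iF => [_]; congr (_ < +oo)%E; apply: ge0_ae_eq_integral => //.
  - exact: measurableT_comp.
  - exact: measurableT_comp.
  - by apply: filterS Ff => x h xT; exact: (congr1 abse (h xT)).
have e : (\int[m]_x F x = \int[m]_x (fine (F x))%:E)%E by apply: ae_eq_integral.
by rewrite /Rintegral -e Fv.
Qed.

Lemma real_fubini1 (f : T1 * T2 -> R) : intg (m1 \x m2)%E f ->
  {ae m1, forall x, intg m2 (fun y => f (x, y))} /\
  hasint m1 (fun x => \int[m2]_y f (x, y)) (\int[(m1 \x m2)%E]_z f z).
Proof.
move=> i_f; split; first exact: (ae_integrable1 i_f).
apply: fine_ae_hasint; first exact: (integrable_fubini_F i_f).
by rewrite EFin_int// -(integral12_prod_meas1 i_f).
Qed.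

Lemma real_fubini2 (f : T1 * T2 -> R) : intg (m1 \x m2)%E f ->
  {ae m2, forall y, intg m1 (fun x => f (x, y))} /\
  hasint m2 (fun y => \int[m1]_x f (x, y)) (\int[(m1 \x m2)%E]_z f z).
Proof.
move=> i_f; split; first exact: (ae_integrable2 i_f).
apply: fine_ae_hasint; last first.
  by rewrite EFin_int// -(integral21_prod_meas1 i_f).
have mf := measurable_int _ i_f.
have mG := measurable_fubini_G i_f.
have mabs : measurable_fun [set: T1 * T2] (fun z => `|(f z)%:E|)%E by exact: measurableT_comp.
apply/integrableP; split => //.
have := intg_lty (intg_norm i_f).
have -> : (\int[(m1 \x m2)%E]_z (`|f z|)%:E = \int[(m1 \x m2)%E]_z `|(f z)%:E|)%E by [].
rewrite fubini_tonelli2//; apply: le_lt_trans; apply: ge0_le_integral => //.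
- exact: measurableT_comp.
- exact: measurable_fun_fubini_tonelli_G.
- move=> y _; apply: le_abse_integral => //.
  exact: measurable_fun_pair1 mf.
Qed.

End real_fubini.

Section hasint_order.
Context (d : measure_display) (T : measurableType d) (R : realType).
Variable mu : {measure set T -> \bar R}.
Implicit Types f g : T -> R.

Lemma hasint_int f : intg mu f -> hasint mu f (\int[mu]_x f x).
Proof. by []. Qed.

Lemma hasint_ae_le f g u v : hasint mu f u -> hasint mu g v ->
  {ae mu, forall x, f x <= g x} -> u <= v.
Proof. by move=> [i1 <-] [i2 <-]; exact: ae_le_int. Qed.

Lemma hasint_le f g u v : hasint mu f u -> hasint mu g v ->
  (forall x, f x <= g x) -> u <= v.
Proof. by move=> [i1 <-] [i2 <-]; exact: le_int. Qed.

End hasint_order.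

Lemma win_mu (R : realType) (s t : R) : s <= t ->
  hasint (@lebesgue_measure R) (fun r : R => (s < r <= t)%R%:R) (t - s).
Proof.
move=> st; pose e := Elem s t (ord0 : 'I_1) (fun _ : measurableTypeR R => 0).
have := overlap_integral e e.
rewrite /overlap /= minxx maxxx max_r ?subr_ge0//; apply: eq_hasint => r.
by case: (_ && _); rewrite /= ?mulr1 ?mulr0.
Qed.

(** * The drift over a time window *)

Section drift.
Context (R : realType) (d : measure_display) (Om : measurableType d).
Context (P : probability Om R).
Local Notation mu := (@lebesgue_measure R).
Local Notation nu := (mu \x P)%E.
Implicit Types (s t : R) (g : R * Om -> R) (G : Om -> R).

Lemma win_prod s t G : s <= t -> intg P G ->
  hasint nu (fun z => win s t z * G z.2) ((t - s) * \int[P]_w G w).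
Proof.
move=> st iG; have [i1 e1] := win_mu st.
by have [i2 e2] := product_int i1 iG; split => //; rewrite e2 e1.
Qed.

Lemma win_sqr s t (z : R * Om) : win s t z ^+ 2 = win s t z.
Proof. by rewrite /win; case: (_ && _); rewrite ?expr1n ?expr0n. Qed.

Lemma win_mulG_sqintg s t G : s <= t -> sqintg P G ->
  sqintg nu (fun z => win s t z * G z.2).
Proof.
move=> st sG; apply/sqintgP; split.
  apply: measurable_funM; first exact: measurable_win.
  by apply: measurable_fun2; exact: sqintg_mfun sG.
have [h _] := win_prod st (sqintg_sqr sG).
by apply: eq_intg h => z; rewrite exprMn win_sqr.
Qed.

Definition drift g s t (w : Om) : R := \int[mu]_r (win s t (r, w) * g (r, w)).

(** The Cauchy-Schwarz inequality in time for almost every w, then Fubini. Pathwise it comes from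
    the nonnegativity, for all c, of the integral of (g - c)^2 over the window. *)
Lemma drift_sqintg g s t : s <= t -> sqintg nu g ->
  sqintg P (drift g s t) /\
  \int[P]_w (drift g s t w ^+ 2) <= (t - s) * \int[nu]_z (win s t z * g z ^+ 2).
Proof.
move=> st sg.
have sw : sqintg nu (win s t).
  have := win_mulG_sqintg st (sqintg1 P); congr sqintg.
  by apply/funext => z; rewrite mulr1.
have iwg : intg nu (fun z => win s t z * g z) by exact: sqintgM.
have iwg2 : intg nu (fun z => win s t z * g z ^+ 2) by apply: win_intg; exact: sqintg_sqr.
have [a1 [i1 _]] := real_fubini2 iwg.
have [a2 h2] := real_fubini2 iwg2.
have [iw ew] := win_mu st.
have mD : measurable_fun [set: Om] (drift g s t) by exact: intg_mfun i1.
have le2 : {ae P, forall w, drift g s t w ^+ 2 <=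
     (t - s) * \int[mu]_r (win s t (r, w) * g (r, w) ^+ 2)}.
  apply: filterS2 a1 a2 => w j1 j2.
  rewrite /drift; set A := \int[mu]_r _; set Q := \int[mu]_r _.
  have sub c : 0 <= Q - 2 * c * A + c ^+ 2 * (t - s).
    have : hasint mu (fun r => win s t (r, w) * (g (r, w) - c) ^+ 2)
        (Q + (- (2 * c)) * A + c ^+ 2 * (t - s)).
      apply: (@eq_hasint _ _ R mu (fun r : measurableTypeR R => win s t (r, w) * g (r, w) ^+ 2 +
        (- (2 * c)) * (win s t (r, w) * g (r, w)) + c ^+ 2 * win s t (r, w))).
        by move=> r; ring.
      apply: hasintD; last by apply: hasintZ; exact: (win_mu st).
      by apply: hasintD => //; exact: hasintZ.
    have -> : Q - 2 * c * A + c ^+ 2 * (t - s) = Q + (- (2 * c)) * A + c ^+ 2 * (t - s) by ring.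
    move=> [_ <-]; apply: int_ge0 => r; apply: mulr_ge0; [exact: win_ge0|exact: sqr_ge0].
  (* For an empty window the quadratic in c degenerates to an affine function, whose nonnegativity
     for all c forces A = 0. Otherwise its minimiser is c = A / (t - s). *)
  have [ts|ts] := eqVneq (t - s) 0.
    have h1 := sub (A + 1); have h2' := sub (A - 1).
    have Q0 : 0 <= Q by have := sub 0; rewrite ts; lra.
    rewrite ts mul0r; have [->|A0] := eqVneq A 0; first by rewrite expr0n.
    have := sub ((Q + 1) / A); rewrite ts mulr0 addr0.
    have -> : 2 * ((Q + 1) / A) * A = 2 * (Q + 1) by field.
    lra.
  have ts0 : 0 < t - s by rewrite lt_neqAle eq_sym ts subr_ge0.
  have := sub (A / (t - s)).
  have -> : Q - 2 * (A / (t - s)) * A + (A / (t - s)) ^+ 2 * (t - s) =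
    ((t - s) * Q - A ^+ 2) / (t - s) by field.
  by rewrite pmulr_lge0 ?invr_gt0// subr_ge0.
have sD : sqintg P (drift g s t).
  apply/sqintgP; split => //; apply: ae_intg_dom (intgZ (t - s) h2.1).
    exact: measurable_funX.
  by apply: filterS le2 => w; rewrite ger0_norm// sqr_ge0.
split => //.
exact: hasint_ae_le (hasint_int (sqintg_sqr sD)) (hasintZ (t - s) h2) le2.
Qed.

Lemma drift_mul g s t G : s <= t -> sqintg nu g -> sqintg P G ->
  hasint nu (fun z => win s t z * G z.2 * g z) (\int[P]_w (G w * drift g s t w)).
Proof.
move=> st sg sG.
have i0 : intg nu (fun z => win s t z * G z.2 * g z).
  by apply: sqintgM => //; exact: win_mulG_sqintg.
split => //; have [a [i1 <-]] := real_fubini2 i0.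
have [sD _] := drift_sqintg st sg.
have sw : sqintg nu (win s t).
  have := win_mulG_sqintg st (sqintg1 P); congr sqintg.
  by apply/funext => z; rewrite mulr1.
have [a1 _] := real_fubini2 (sqintgM sw sg).
apply: ae_eq_int; [exact: intg_mfun i1|exact: intg_mfun (sqintgM sG sD)|].
apply: filterS a1 => w j; rewrite /drift -int_scale//.
by apply: eq_Rintegral => r _ /=; ring.
Qed.

End drift.

Lemma hasint_cst (R : realType) (d : measure_display) (Om : measurableType d)
  (P : probability Om R) (k : R) : hasint P (fun=> k) k.
Proof.
split; first exact: (finite_measure_integrable_cst _ k).
have -> : \int[P]_w k = k * fine (P [set: Om]) by exact: Rintegral_cst.
have -> : P [set: Om] = 1%E by exact: probability_setT.
by rewrite mulr1.
Qed.

(** Here x and y stand for X at the left end s and at a later time r, z for |zeta| at r, ms for the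
    mean of the positive part of X at s, and rv for a bound on its change until r. The bound on g
    holds at time r whereas [phi1] is frozen at s; the Young inequality with parameter e pays for
    that difference. *)
Lemma drift_pointwise (R : realType) (C e kap x y z ms rv g : R) :
  0 <= C -> 0 < e -> 0 < kap -> 0 <= z -> 0 <= rv ->
  g <= C * (ms + rv + `|y| + z) ->
  phi1 x * g <= C * ms * phi1 x + (C * e * phi1 x ^+ 2 + (C * rv ^+ 2 / (2 * e) +
     C / (2 * e) * (y - x) ^+ 2)) +
   ((6 * C + C ^+ 2 / (2 * kap)) * phi x + kap * (phi2 x * z ^+ 2)).
Proof.
move=> C0 e0 k0 z0 rv0 hC.
have p0 := phi1_ge0 x; set p := phi1 x in p0 *.
have hp : p * g <= C * (p * ms + p * rv + p * `|y| + p * z).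
  by have := ler_wpM2l p0 hC; lra.
have px : p * `|x| <= 6 * phi x.
  have [x0|x0] := leP x 0; first by rewrite /p phi1_eq0// mul0r mulr_ge0// phi_ge0.
  by rewrite gtr0_norm//; have := phi1_mul_le x (ltW x0); rewrite -/p; lra.
have py : p * `|y| <= 6 * phi x + p * `|y - x|.
  have : `|y| <= `|x| + `|y - x| by rewrite -[in leLHS](subrKC x y) ler_normD.
  by move=> /(ler_wpM2l p0); lra.
have young a : 0 <= a -> p * a <= e / 2 * p ^+ 2 + a ^+ 2 / (2 * e).
  move=> _; rewrite -subr_ge0.
  have -> : e / 2 * p ^+ 2 + a ^+ 2 / (2 * e) - p * a = (e * p - a) ^+ 2 / (2 * e).
    by field; rewrite gt_eqF.
  by apply: divr_ge0; [exact: sqr_ge0|rewrite mulr_ge0// ltW].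
have y1 := young _ rv0; have y2 := young _ (normr_ge0 (y - x)).
rewrite real_normK ?num_real// in y2.
(* With A and D the two terms on the right, [phi1_sqr_le] gives (C p z)^2 <= 4 A D <= (A + D)^2;
   this dictates the coefficient C^2 / (2 kap). *)
have pz : C * (p * z) <= kap * (phi2 x * z ^+ 2) + C ^+ 2 / (2 * kap) * phi x.
  have hq := phi1_sqr_le x; rewrite -/p in hq.
  have q0 := phi2_ge0 x; have f0 := phi_ge0 x.
  set A := kap * (phi2 x * z ^+ 2); set D := C ^+ 2 / (2 * kap) * phi x.
  have A0 : 0 <= A by rewrite !mulr_ge0 ?sqr_ge0// ltW.
  have D0 : 0 <= D.
    by apply: mulr_ge0 => //; apply: divr_ge0; [exact: sqr_ge0|rewrite mulr_ge0// ltW].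
  have AD : (C * (p * z)) ^+ 2 <= 4 * (A * D).
    have -> : 4 * (A * D) = C ^+ 2 * z ^+ 2 * (2 * phi2 x * phi x).
      by rewrite /A /D; field; rewrite gt_eqF.
    have -> : (C * (p * z)) ^+ 2 = C ^+ 2 * z ^+ 2 * p ^+ 2 by ring.
    by rewrite ler_wpM2l// mulr_ge0 ?sqr_ge0.
  have AD2 : (C * (p * z)) ^+ 2 <= (A + D) ^+ 2 by have := sqr_ge0 (A - D); lra.
  have l0 : 0 <= C * (p * z) by apply: mulr_ge0 => //; exact: mulr_ge0.
  have r0 : 0 <= A + D by exact: addr_ge0.
  by move: AD2; rewrite ler_sqr.
have := ler_wpM2l C0 y1; have := ler_wpM2l C0 y2; have := ler_wpM2l C0 py.
have -> : C * rv ^+ 2 / (2 * e) = C * (rv ^+ 2 / (2 * e)) by rewrite mulrA.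
have -> : C / (2 * e) * (y - x) ^+ 2 = C * ((y - x) ^+ 2 / (2 * e)) by ring.
move: (rv ^+ 2 / (2 * e)) ((y - x) ^+ 2 / (2 * e)) (C ^+ 2 / (2 * kap)) hp pz => A1 A2 A3 hp pz.
lra.
Qed.

(** [phi_taylor_split] with a = M' and b = M - M' - A. From (M - A)^2 >= M^2 / 2 - A^2, half of the
    second order term is kept, hence 1/4; the other constants collect the squares of A, M - M' and
    M. *)
Lemma step_pointwise (R : realType) (x y A M M' e : R) : 0 < e -> e <= 1 ->
  y - x = M - A ->
  phi x <= phi y + phi1 x * A + - 1 * (phi1 x * M) + - (1 / 4) * (phi2 x * M ^+ 2) +
    5 * A ^+ 2 + 12 * (M - M') ^+ 2 + 8 * e * M ^+ 2 + 4 / e * M' ^+ 4.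
Proof.
move=> e0 e1 yx; have yx' : y - x = M' + (M - M' - A) by rewrite yx; ring.
have := phi_taylor_split e0 yx'; rewrite yx.
have -> : 4 * (e * M' ^+ 2 + M' ^+ 4 / e) = 4 * (e * M' ^+ 2) + 4 / e * M' ^+ 4 by ring.
have := phi2_ge0 x; have := phi2_le1 x.
move: (phi2 x) (phi1 x) (phi x) (phi y) (4 / e * M' ^+ 4) => q p fx fy Z q1 q0.
have A2 := sqr_ge0 A; have M2 := sqr_ge0 M; have b2 := sqr_ge0 (M - M').
have h1 : (M - M' - A) ^+ 2 <= 2 * (M - M') ^+ 2 + 2 * A ^+ 2.
  by have := sqr_ge0 (M - M' + A); lra.
have h2 : e * M' ^+ 2 <= 2 * e * M ^+ 2 + 2 * (M - M') ^+ 2.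
  have h3 : M' ^+ 2 <= 2 * M ^+ 2 + 2 * (M - M') ^+ 2 by have := sqr_ge0 (2 * M - M'); lra.
  have := ler_wpM2l (ltW e0) h3; have := ler_wpM2r b2 e1; lra.
have h4 : q * (M ^+ 2 / 2 - A ^+ 2) <= q * (M - A) ^+ 2.
  by apply: ler_wpM2l => //; have := sqr_ge0 (M / 2 - A); have := sqr_ge0 (M - 2 * A); lra.
have h5 : q * A ^+ 2 <= A ^+ 2 by rewrite ler_piMl.
lra.
Qed.

(** * The estimate over one step of the partition, and its summation *)

Section one_step.
Context (R : realType) (d : measure_display) (Om : measurableType d).
Context (P : probability Om R) (P_complete : measure_is_complete P).
Context (n : nat) (B : R -> Om -> 'rV[R]_n).
Hypothesis B_bm : brownian_motion P B.
Local Notation mu := (@lebesgue_measure R).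
Local Notation nu := (mu \x P)%E.
Variables (T : R) (X g : R * Om -> R) (I : R -> Om -> R) (zeta : 'I_n -> R * Om -> R).
Variables (S C : R).
Hypotheses (S0 : 0 <= S) (C0 : 0 <= C).
Hypothesis mX : measurable_fun [set: measurableTypeR R * Om] X.
Hypothesis aX : forall t, 0 <= t <= T -> adapted_at P B t (fun w => X (t, w)).
Hypothesis sX : forall t, 0 <= t <= T ->
  sqintg P (fun w => X (t, w)) /\ \int[P]_w (X (t, w) ^+ 2) <= S.
Hypothesis IZ : ito_approx P B T I zeta.
Hypothesis sg : sqintg nu g.
Hypothesis dyn : forall s t, 0 <= s -> s <= t -> t <= T ->
  {ae P, forall w, X (t, w) - X (s, w) = (I t w - I s w) - drift g s t w}.
Hypothesis bound : {ae nu, forall z : R * Om, 0 <= z.1 <= T ->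
  g z <= C * (\int[P]_w Num.max (X (z.1, w)) 0 + `|X z| + Num.sqrt (sqn zeta z))}.

Let c := normal_moment R 2.
Let c0 : 0 < c. Proof. exact: normal_moment2_gt0. Qed.
Let u t := \int[P]_w phi (X (t, w)).
Let Qg s t := \int[nu]_z (win s t z * g z ^+ 2).
Let Qz s t := \int[nu]_z (win s t z * sqn zeta z).
(** The product of the 1/4 of [step_pointwise] and the c / 4 of [ito_increment_sqr_ge]: the second
    order term then cancels the z-part of the drift exactly. *)
Let kap := c / 16.

Let sz : forall i, sqintg nu (zeta i). Proof. by case: IZ. Qed.
Let iz : intg nu (sqn zeta). Proof. exact: sqn_intg. Qed.

Section step.
Variables (s t : R).
Hypotheses (s0 : 0 <= s) (st : s <= t) (tT : t <= T).

Let sIT : 0 <= s <= T. Proof. by rewrite s0 (le_trans st). Qed.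
Let tIT : 0 <= t <= T. Proof. by rewrite tT (le_trans s0). Qed.
Let mXt r : 0 <= r <= T -> measurable_fun [set: Om] (fun w => X (r, w)).
Proof. by move=> /sX[/sqintg_mfun]. Qed.

Lemma phi_intg r : 0 <= r <= T -> intg P (fun w => phi (X (r, w))).
Proof.
move=> rT; have [sr _] := sX rT; apply: intg_dom (sqintg_sqr sr).
  by apply: (measurableT_comp (@measurable_phi R)); exact: mXt.
by move=> w; rewrite ger0_norm ?phi_ge0// phi_le_sqr.
Qed.

Lemma phi1_sqintg r : 0 <= r <= T -> sqintg P (fun w => phi1 (X (r, w))).
Proof.
move=> rT; have [sr _] := sX rT; apply: sqintg_dom sr.
  by apply: (measurableT_comp (@measurable_phi1 R)); exact: mXt.
by move=> w; rewrite ger0_norm ?phi1_ge0// phi1_le.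
Qed.

Let Sphi1 : \int[P]_w (phi1 (X (s, w)) ^+ 2) <= S.
Proof.
have [sr h] := sX sIT; apply: le_trans h; apply: le_int.
- exact/sqintg_sqr/phi1_sqintg.
- exact: sqintg_sqr.
- move=> w; rewrite -[leRHS]real_normK ?num_real// lerXn2r ?nnegrE ?phi1_ge0//.
  exact: phi1_le.
Qed.

Let m r := \int[P]_w Num.max (X (r, w)) 0.

Let pos_sqintg r : 0 <= r <= T -> sqintg P (fun w => Num.max (X (r, w)) 0).
Proof.
move=> rT; have [sr _] := sX rT; apply: sqintg_dom sr.
  by apply: measurable_pos; exact: mXt.
move=> w; rewrite ger0_norm ?le_max ?lexx ?orbT// ge_max normr_ge0 andbT; exact: ler_norm.
Qed.

Let sqintg_intg f : sqintg P f -> intg P f.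
Proof.
by move=> sf; apply: eq_intg (sqintgM sf (sqintg1 P)) => w; rewrite mulr1.
Qed.

(* Integrate the pointwise bound [phi1 x * y^+ <= 3 (phi x + phi y)] over two
   independent copies. *)
Let phi1_mean : \int[P]_w phi1 (X (s, w)) * m s <= 6 * u s.
Proof.
have ip := phi_intg sIT; have i1 := sqintg_intg (phi1_sqintg sIT).
have im := sqintg_intg (pos_sqintg sIT).
have h x : phi1 x * m s <= 3 * phi x + 3 * u s.
  have h2 : hasint P (fun w => 3 * phi x + 3 * phi (X (s, w))) (3 * phi x + 3 * u s).
    by apply: hasintD; [exact: hasint_cst|apply: hasintZ].
  apply: (hasint_le (hasintZ (phi1 x) (hasint_int im)) h2) => w.
  apply: le_trans (phi1_mul_le x _) _; first by rewrite le_max lexx orbT.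
  rewrite mulrDr lerD2l ler_wpM2l//; case: (leP (X (s, w)) 0) => // x0.
  by rewrite phi_eq0// phi_ge0.
rewrite mulrC; have -> : 6 * u s = 3 * u s + 3 * u s by ring.
apply: (hasint_le (hasintZ (m s) (hasint_int i1))
   (hasintD (hasintZ 3 (hasint_int ip)) (hasint_cst P (3 * u s)))) => w.
by rewrite mulrC; exact: h.
Qed.

(* Bounds the second moment of X_r - X_s for r in [s, t]. *)
Let v := 2 * (t - s) * Qg s t + 8 * c * Qz s t.

Let Qz_ge0 a b : 0 <= Qz a b.
Proof. by apply: int_ge0 => z; rewrite mulr_ge0 ?win_ge0 ?sqn_ge0. Qed.

Let Qg_ge0 a b : 0 <= Qg a b.
Proof. by apply: int_ge0 => z; rewrite mulr_ge0 ?win_ge0 ?sqr_ge0. Qed.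

Let v0 : 0 <= v.
Proof.
rewrite /v addr_ge0// ?mulr_ge0//; [by rewrite subr_ge0|exact: ltW].
Qed.

Let win_mono (a r b : R) (z : R * Om) : r <= b -> win a r z <= win a b z.
Proof.
move=> rb; rewrite /win; have [/andP[-> h]|_] := boolP (a < z.1 <= r); last exact: ler0n.
by rewrite (le_trans h rb).
Qed.

Let X_increment (r : R) : s <= r -> r <= t ->
  sqintg P (fun w => X (r, w) - X (s, w)) /\
  \int[P]_w (X (r, w) - X (s, w)) ^+ 2 <= v.
Proof.
move=> sr rt; have rT : r <= T := le_trans rt tT.
have rIT : 0 <= r <= T by rewrite rT (le_trans s0).
have sD : sqintg P (fun w => X (r, w) - X (s, w)).
  by apply: sqintgB; [case: (sX rIT)|case: (sX sIT)].
split => //.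
have [sd hd] := drift_sqintg sr sg.
have sM := ito_increment_sqintg IZ s0 sr rT.
have hM := ito_increment_sqr_le P_complete B_bm IZ s0 sr rT.
have hle : \int[P]_w (X (r, w) - X (s, w)) ^+ 2 <=
    2 * \int[P]_w (I r w - I s w) ^+ 2 + 2 * \int[P]_w drift g s r w ^+ 2.
  apply: (hasint_ae_le (hasint_int (sqintg_sqr sD)) (hasintD
    (hasintZ 2 (hasint_int (sqintg_sqr sM))) (hasintZ 2 (hasint_int (sqintg_sqr sd))))).
  apply: filterS (dyn s0 sr rT) => w ->.
  by have := sqr_ge0 ((I r w - I s w) + drift g s r w); lra.
apply: (le_trans hle).
have ig := sqintg_sqr sg.
have h1 : Qg s r <= Qg s t.
  apply: le_int; [exact: win_intg|exact: win_intg|move=> z].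
  by rewrite ler_wpM2r ?sqr_ge0// win_mono.
have h2 : Qz s r <= Qz s t.
  apply: le_int; [exact: win_intg|exact: win_intg|move=> z].
  by rewrite ler_wpM2r ?sqn_ge0// win_mono.
have h3 : (r - s) * Qg s r <= (t - s) * Qg s t.
  by apply: ler_pM => //; rewrite ?subr_ge0// lerD2r.
have := ler_wpM2l (ltW c0) h2; rewrite /v; move: hM hd; rewrite -/(Qz s r) -/(Qg s r) -/c; lra.
Qed.

(** The positive part is 1-Lipschitz, and the mean of |X_r - X_s| is at most the root of its second
    moment because its variance is nonnegative. *)
Let m_increment (r : R) : s <= r -> r <= t -> m r <= m s + Num.sqrt v.
Proof.
move=> sr rt; have rT : r <= T := le_trans rt tT.
have rIT : 0 <= r <= T by rewrite rT (le_trans s0).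
have [sD hD] := X_increment sr rt.
have i1 := sqintg_intg (pos_sqintg rIT); have i2 := sqintg_intg (pos_sqintg sIT).
have sA := sqintg_norm sD; have iA := sqintg_intg sA.
set a := \int[P]_w `|X (r, w) - X (s, w)|.
have a0 : 0 <= a by exact: int_ge0.
have ha : m r <= m s + a.
  apply: (hasint_le (hasint_int i1) (hasintD (hasint_int i2) (hasint_int iA))) => w.
  have := ler_norm (X (r, w) - X (s, w)); have := normr_ge0 (X (r, w) - X (s, w)).
  by case: (leP (X (r, w)) 0); case: (leP (X (s, w)) 0); lra.
apply: (le_trans ha); rewrite lerD2l -(ger0_norm a0) -sqrtr_sqr ler_wsqrtr//.
apply: le_trans hD.
have : 0 <= \int[P]_w (X (r, w) - X (s, w)) ^+ 2 + (- (2 * a)) * a + a ^+ 2.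
  have := hasintD (hasintD (hasint_int (sqintg_sqr sD))
    (hasintZ (- (2 * a)) (hasint_int iA))) (hasint_cst P (a ^+ 2)).
  move=> [_ <-]; apply: int_ge0 => w; rewrite -[X in X + _ + _]real_normK ?num_real//.
  by have := sqr_ge0 (`|X (r, w) - X (s, w)| - a); lra.
lra.
Qed.

Let win_X_increment :
  intg nu (fun z => win s t z * (X z - X (s, z.2)) ^+ 2) /\
  \int[nu]_z (win s t z * (X z - X (s, z.2)) ^+ 2) <= (t - s) * v.
Proof.
have mf : measurable_fun [set: measurableTypeR R * Om]
    (fun z => win s t z * (X z - X (s, z.2)) ^+ 2).
  apply: measurable_funM; first exact: measurable_win.
  apply: measurable_funX; apply: measurable_funB => //.
  by apply: (measurable_fun2 (mXt sIT)).
have inner r : hasint P (fun w => win s t (r, w) * (X (r, w) - X (s, w)) ^+ 2)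
     (\int[P]_w (win s t (r, w) * (X (r, w) - X (s, w)) ^+ 2)) /\
   \int[P]_w (win s t (r, w) * (X (r, w) - X (s, w)) ^+ 2) <= (s < r <= t)%R%:R * v.
  rewrite /win/=; have [/andP[sr rt]|_] := boolP (s < r <= t).
    have [sD hD] := X_increment (ltW sr) rt; rewrite mul1r.
    under [X in hasint P X]eq_fun do rewrite mul1r.
    by under eq_Rintegral do rewrite mul1r; split => //; split => //; exact: sqintg_sqr.
  rewrite mul0r; under [X in hasint P X]eq_fun do rewrite mul0r.
  by under eq_Rintegral do rewrite mul0r; split; [split => //; exact: intg0|rewrite int_zero].
have i0 : intg nu (fun z => win s t z * (X z - X (s, z.2)) ^+ 2).
  apply/(integrable12ltyP _); first exact/measurable_EFinP.
  apply: (@le_lt_trans _ _ (\int[mu]_r ((v * (s < r <= t)%R%:R)%:E))%E); last first.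
    exact: (intg_lty (hasintZ v (win_mu st)).1).
  apply: ge0_le_integral => //.
  - by move=> r _; exact: integral_ge0.
  - have mE : measurable_fun [set: measurableTypeR R * Om]
        (fun z => `|(win s t z * (X z - X (s, z.2)) ^+ 2)%:E|)%E.
      by apply: measurableT_comp => //; exact/measurable_EFinP.
    exact: (measurable_fun_fubini_tonelli_F _ mE (fun=> abse_ge0 _)).
  - by apply/measurable_EFinP; exact: (intg_mfun (hasintZ v (win_mu st)).1).
  - move=> r _; have [[i1 _] h] := inner r.
    have -> : (\int[P]_w `|(win s t (r, w) * (X (r, w) - X (s, w)) ^+ 2)%:E| =
        \int[P]_w (win s t (r, w) * (X (r, w) - X (s, w)) ^+ 2)%:E)%E.
      apply: eq_integral => w _; rewrite gee0_abs// lee_fin.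
      by apply: mulr_ge0; [exact: win_ge0|exact: sqr_ge0].
    by rewrite -EFin_int// lee_fin mulrC.
split => //; rewrite [leRHS]mulrC.
apply: (hasint_le (real_fubini1 i0).2 (hasintZ v (win_mu st))) => r.
by have [_ h] := inner r; rewrite mulrC.
Qed.

(** Of the 12 C, one half comes from the |X| term in [drift_pointwise] and the other from the
    mean-field term through [phi1_mean]. *)
Let K := 12 * C + C ^+ 2 / (2 * kap).
Let H w := phi2 (X (s, w)).

(** [drift_pointwise] integrated over ]s, t] and Om, with the hypothesis on g used at each time r of
    the step and [m_increment] bringing the mean back to time s. *)
Lemma drift_term (e : R) : 0 < e ->
  \int[P]_w (phi1 (X (s, w)) * drift g s t w) <=
  K * (t - s) * u s + (C * e * (t - s) * S + C / e * (t - s) * v) +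
  kap * \int[nu]_z (H z.2 * (win s t z * sqn zeta z)).
Proof.
move=> e0; have h0 : 0 <= t - s by rewrite subr_ge0.
have s1 := phi1_sqintg sIT.
have mH : measurable_fun [set: Om] H.
  by apply: (measurableT_comp (@measurable_phi2 R)); exact: mXt.
have iH : intg nu (fun z => H z.2 * (win s t z * sqn zeta z)).
  apply: (intg_mulbnd (M := 1)); [exact: measurable_fun2| |exact: win_intg].
  by move=> z; rewrite ger0_norm ?phi2_ge0// phi2_le1.
have [iX hX] := win_X_increment.
have k0 : 0 < kap by rewrite /kap divr_gt0.
pose mv := m s + Num.sqrt v.
have L := drift_mul st sg s1.
have ip := phi_intg sIT; have i1 := sqintg_intg s1; have i2 := sqintg_sqr s1.
have J := hasintD (hasintD (hasintZ (C * m s) (win_prod st i1))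
  (hasintD (hasintZ (C * e) (win_prod st i2)) (hasintD
    (hasintZ (C * v / (2 * e)) (win_prod st (hasint_cst P 1).1))
    (hasintZ (C / (2 * e)) (hasint_int iX)))))
  (hasintD (hasintZ (6 * C + C ^+ 2 / (2 * kap)) (win_prod st ip)) (hasintZ kap (hasint_int iH))).
apply: le_trans (hasint_ae_le L J _) _; last first.
  have e1 : C / (2 * e) * \int[nu]_z (win s t z * (X z - X (s, z.2)) ^+ 2) <=
      C / (2 * e) * ((t - s) * v).
    by rewrite ler_wpM2l// divr_ge0// mulr_ge0// ltW.
  have e2 : C * e * ((t - s) * \int[P]_w phi1 (X (s, w)) ^+ 2) <= C * e * ((t - s) * S).
    by rewrite ler_wpM2l ?mulr_ge0 ?(ltW e0)// ler_wpM2l.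
  have e3 : C * m s * ((t - s) * \int[P]_w phi1 (X (s, w))) <= 6 * C * (t - s) * u s.
    have := ler_wpM2l (mulr_ge0 C0 h0) phi1_mean; lra.
  have -> : \int[P]_w (1 : R) = 1 by case: (hasint_cst P (1 : R)).
  have -> : C / e * (t - s) * v = C / (2 * e) * ((t - s) * v) + C * v / (2 * e) * ((t - s) * 1).
    by field; rewrite gt_eqF.
  rewrite -/(u s) /K; move: (C ^+ 2 / (2 * kap)) => k; lra.
have nuF : Filter (almost_everywhere nu) by exact: ae_filter_ringOfSetsType.
apply: (@filterS _ _ nuF) bound => -[r w] /= hb.
rewrite /win /=; have [/andP[sr rt]|_] := boolP (s < r <= t); last first.
  by rewrite ?(mul0r, mulr0, addr0, add0r).
have rT : 0 <= r <= T by rewrite (le_trans s0 (ltW sr)) (le_trans rt tT).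
have {hb} := hb rT; rewrite !mul1r.
have hm := m_increment (ltW sr) rt.
rewrite -/(m r) -/(u s) /H.
set x := X (s, w); set y := X (r, w); set z := Num.sqrt _.
have zE : sqn zeta (r, w) = z ^+ 2 by rewrite sqr_sqrtr// sqn_ge0.
set rv := Num.sqrt v in hm; have rvE : v = rv ^+ 2 by rewrite sqr_sqrtr.
rewrite zE rvE => hg.
have := @drift_pointwise R C e kap x y z (m s) rv (g (r, w)) C0 e0 k0 (sqrtr_ge0 _) (sqrtr_ge0 _).
rewrite !mulr1; move=> hd; apply: le_trans (hd _) _.
  by apply: le_trans hg _; rewrite ler_wpM2l// !lerD2r.
by rewrite !addrA.
Qed.

(** [step_pointwise] in expectation: the first order term in M vanishes by [ito_increment_mean], and
    the energy of zeta in [drift_term] cancels against the second order term. Since v is itself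
    controlled by [Qg] and [Qz], each remaining error is either small with e or with the
    approximation of zeta, or proportional to t - s times an additive quantity. *)
Lemma step_estimate (e L : R) (l : seq (elem R Om n)) : 0 < e -> e <= 1 ->
  (forall x, List.In x l -> elem_ok P B 0 T x) ->
  intg P (fun w => elem_int B (map (clamp s t) l) w ^+ 4) ->
  \int[P]_w (elem_int B (map (clamp s t) l) w ^+ 4) <= L * (t - s) ^+ 2 ->
  u s <= u t + K * (t - s) * u s + (C * e * (t - s) * S + C / e * (t - s) * v) +
    5 * ((t - s) * Qg s t) +
    48 * c * \int[nu]_z (win s t z * sqn (fun i => zeta i \- elem_val l i) z) +
    32 * c * e * Qz s t + 4 / e * (L * (t - s) ^+ 2).
Proof.
move=> e0 e1 ok i4 h4.
have ips := phi_intg sIT; have ipt := phi_intg tIT.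
have s1 := phi1_sqintg sIT.
have [sA hA] := drift_sqintg st sg.
have sM := ito_increment_sqintg IZ s0 st tT.
have hM := ito_increment_sqr_le P_complete B_bm IZ s0 st tT.
have ap1 : adapted_at P B s (fun w => phi1 (X (s, w))).
  exact: (measurableT_comp (@measurable_phi1 R) (aX sIT)).
have ap2 : adapted_at P B s (fun w => phi2 (X (s, w))).
  exact: (measurableT_comp (@measurable_phi2 R) (aX sIT)).
have hmean := ito_increment_mean P_complete B_bm IZ s0 st tT ap1 s1.
have H01 w : 0 <= phi2 (X (s, w)) <= 1 by rewrite phi2_ge0 phi2_le1.
have hlow := ito_increment_sqr_ge P_complete B_bm IZ s0 st tT ap2 H01.
have IZl := ito_approxB P_complete B_bm IZ (elem_ito_approx P_complete B_bm ok).
have sMl := ito_increment_sqintg IZl s0 st tT.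
have hMl := ito_increment_sqr_le P_complete B_bm IZl s0 st tT.
pose A w := drift g s t w; pose M w := I t w - I s w.
pose M' w := elem_int B (map (clamp s t) l) w.
have MM' w : (I t w - elem_upto B l t w) - (I s w - elem_upto B l s w) = M w - M' w.
  by rewrite /M' (elem_int_clamp _ st ok) /M; ring.
have sMM : sqintg P (fun w => M w - M' w).
  by move: sMl; congr sqintg; apply/funext => w; rewrite MM'.
have iH : intg P (fun w => phi2 (X (s, w)) * M w ^+ 2).
  apply: (intg_mulbnd (M := 1)); last exact: sqintg_sqr.
    by apply: (measurableT_comp (@measurable_phi2 R)); exact: mXt.
  by move=> w; rewrite ger0_norm ?phi2_ge0// phi2_le1.
have J := hasintD (hasintD (hasintD (hasintD (hasintD (hasintD (hasintD
  (hasint_int ipt) (hasint_int (sqintgM s1 sA)))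
  (hasintZ (-1) (hasint_int (sqintgM s1 sM))))
  (hasintZ (- (1 / 4)) (hasint_int iH)))
  (hasintZ 5 (hasint_int (sqintg_sqr sA))))
  (hasintZ 12 (hasint_int (sqintg_sqr sMM))))
  (hasintZ (8 * e) (hasint_int (sqintg_sqr sM))))
  (hasintZ (4 / e) (hasint_int i4)).
apply: le_trans (hasint_ae_le (hasint_int ips) J _) _.
  by apply: filterS (dyn s0 st tT) => w hw; exact: step_pointwise.
rewrite hmean mulr0.
have h1 := drift_term e0.
have h2 : \int[P]_w (M w - M' w) ^+ 2 <=
    4 * c * \int[nu]_z (win s t z * sqn (fun i => zeta i \- elem_val l i) z).
  apply: le_trans hMl; rewrite le_eqVlt; apply/orP; left; apply/eqP.
  by apply: eq_Rintegral => w _; rewrite MM'.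
have h3 : 4 / e * \int[P]_w (elem_int B (map (clamp s t) l) w ^+ 4) <=
    4 / e * (L * (t - s) ^+ 2).
  by apply: ler_wpM2l h4; apply: divr_ge0 => //; exact: ltW.
have h5 := ler_wpM2l (ltW e0) hM.
move: h1 h2 h3 hA h5 hlow.
rewrite -/(u s) -/(u t) -/(Qg s t) -/c -/(Qz s t) /kap.
move: (\int[P]_w (phi1 (X (s, w)) * drift g s t w)) => x1.
move: (\int[nu]_z (H z.2 * (win s t z * sqn zeta z))) => x2.
move: (\int[P]_w (M w - M' w) ^+ 2) => x3.
move: (\int[nu]_z (win s t z * sqn (fun i => zeta i \- elem_val l i) z)) => x4.
move: (4 / e * \int[P]_w (elem_int B (map (clamp s t) l) w ^+ 4)) => x5.
move: (4 / e * (L * (t - s) ^+ 2)) => x6.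
move: (\int[P]_w (drift g s t w ^+ 2)) => x7.
move: (\int[P]_w ((I t w - I s w) ^+ 2)) => x8.
move: (\int[P]_w (phi2 (X (s, w)) * (I t w - I s w) ^+ 2)) => x9.
move: (C / e * (t - s) * v) (C * e * (t - s) * S) (K * (t - s) * u s) => y1 y2 y3.
move: (u s) (u t) ((t - s) * Qg s t) (Qz s t) => u1 u2 y4 y5.
lra.
Qed.

End step.

Let Q_add (f : R * Om -> R) a b : intg nu f -> 0 <= a -> a <= b ->
  \int[nu]_z (win a b z * f z) =
  \int[nu]_z (win 0 b z * f z) - \int[nu]_z (win 0 a z * f z).
Proof.
move=> i_f a0 ab; rewrite -int_sub; [|exact: win_intg..].
apply: eq_Rintegral => z _; rewrite -mulrBl; congr (_ * _); rewrite /win.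
have [z0|z0] := ltP 0 z.1; have [za|za] := leP z.1 a; have [zb|zb] := leP z.1 b;
  rewrite /= ?subr0 ?subrr//; exfalso; lra.
Qed.

Let Q_mono (f : R * Om -> R) a b : intg nu f -> (forall z, 0 <= f z) -> 0 <= a -> a <= b ->
  \int[nu]_z (win 0 a z * f z) <= \int[nu]_z (win 0 b z * f z).
Proof.
move=> i_f f0 a0 ab; rewrite -subr_ge0 -Q_add//.
by apply: int_ge0 => z; rewrite mulr_ge0// win_ge0.
Qed.

Let Q_total (f : R * Om -> R) a b : intg nu f -> (forall z, 0 <= f z) ->
  0 <= \int[nu]_z (win a b z * f z) <= \int[nu]_z f z.
Proof.
move=> i_f f0; apply/andP; split.
  by apply: int_ge0 => z; rewrite mulr_ge0// win_ge0.
apply: le_int => //; first exact: win_intg.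
by move=> z; rewrite ler_piMl// /win; case: (_ && _); rewrite ?lexx ?ler01.
Qed.

(** Sorts the errors of [step_estimate] into the monotone functions W and V of
    [backward_gronwall]. *)
Lemma comparison_at t0 : 0 <= t0 -> t0 < T ->
  {ae P, forall w, X (T, w) <= 0} -> u t0 = 0.
Proof.
move=> t00 t0T XT.
have T0 : 0 <= T := le_trans t00 (ltW t0T).
have TT : 0 <= T <= T by rewrite T0 lexx.
have uT : u T = 0.
  have iT := phi_intg TT.
  rewrite /u -[RHS](int_zero P); apply: ae_eq_int => //; first exact: intg_mfun iT.
  by apply: filterS XT => w; exact: phi_eq0.
have k0 : 0 < kap by rewrite /kap divr_gt0.
pose K := 12 * C + C ^+ 2 / (2 * kap).
have K0 : 0 <= K.
  by apply: addr_ge0; [exact: mulr_ge0|apply: divr_ge0; [exact: sqr_ge0|apply: mulr_ge0 => //; exact: ltW]].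
have u0 t : 0 <= u t by apply: int_ge0 => w; exact: phi_ge0.
apply: (backward_gronwall u0 uT K0 t0T) => e1 e10.
pose Z := \int[nu]_z sqn zeta z.
have Z0 : 0 <= Z by apply: int_ge0 => z; exact: sqn_ge0.
have cc := ltW c0.
(* An upper bound for the total growth of W divided by e; e is then chosen so that e D <= e1, with D
   + 1 guarding the division against D = 0. *)
pose D := C * S * T + 32 * c * Z + 48 * c.
have D0 : 0 <= D by rewrite !addr_ge0 ?mulr_ge0.
pose e := Num.min 1 (e1 / (D + 1)).
have e0 : 0 < e by rewrite lt_min ltr01 divr_gt0//; lra.
have ele1 : e <= 1 by rewrite ge_min lexx.
have eD : e * D <= e1.
  apply: (@le_trans _ _ (e1 / (D + 1) * D)).
    by apply: ler_wpM2r => //; rewrite ge_min lexx orbT.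
  rewrite mulrAC ler_pdivrMr; last by lra.
  by apply: ler_wpM2l; lra.
have zT : (0 : R) <= 0 <= T by rewrite lexx T0.
(* Only the approximation of the integrand is kept, so both times are set to 0. The list, and thus
   L, depends on e but is common to all steps. *)
have [_ _ hap] := IZ; have [l [ok hl _ _]] := hap 0 0 e zT zT e0.
have [L L0 hL] := elem_moment4 P_complete B_bm ok.
pose dl := fun i => zeta i \- elem_val l i.
have idl : intg nu (sqn dl).
  by apply: sqn_intg => i; apply: sqintgB => //; apply: (elem_val_sqintg P_complete B_bm _ _ ok).
have hdl : \int[nu]_z sqn dl z <= e.
  apply: le_trans hl; rewrite le_eqVlt; apply/orP; left; apply/eqP.
  by apply: eq_Rintegral => z _; apply: eq_bigr => i _; rewrite /dl /= -sqrrN opprB.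
have ig : intg nu (fun z => g z ^+ 2) by exact: sqintg_sqr.
have g0 (z : R * Om) : 0 <= g z ^+ 2 by exact: sqr_ge0.
pose W t := C * e * S * t + 48 * c * \int[nu]_z (win 0 t z * sqn dl z) + 32 * c * e * Qz 0 t.
pose V t := C / e * (2 * T * Qg 0 t + 8 * c * Qz 0 t) + 5 * Qg 0 t + 4 / e * L * t.
have Ce : 0 <= C / e by apply: divr_ge0 => //; exact: ltW.
have CeS : 0 <= C * e * S by rewrite !mulr_ge0// ltW.
have e4 : 0 <= 4 / e * L by apply: mulr_ge0 => //; apply: divr_ge0 => //; exact: ltW.
have ce : 0 <= 32 * c * e by rewrite !mulr_ge0// ltW.
exists W, V; split.
- move=> s t ts st tT; have s0 := le_trans t00 ts.
  rewrite /W; apply: lerD; first apply: lerD.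
  + exact: ler_wpM2l.
  + by apply: ler_wpM2l; [exact: mulr_ge0|apply: Q_mono => //; exact: sqn_ge0].
  + by apply: ler_wpM2l => //; apply: Q_mono => //; exact: sqn_ge0.
- move=> s t ts st tT; have s0 := le_trans t00 ts.
  have hg : Qg 0 s <= Qg 0 t by exact: Q_mono.
  have hz : Qz 0 s <= Qz 0 t by apply: Q_mono => //; exact: sqn_ge0.
  rewrite /V; apply: lerD; first apply: lerD.
  + apply: ler_wpM2l => //; apply: lerD; apply: ler_wpM2l => //; exact: mulr_ge0.
  + exact: ler_wpM2l.
  + exact: ler_wpM2l.
- apply: le_trans eD; rewrite /W.
  have hs : C * e * S * T - C * e * S * t0 <= C * e * S * T.
    by have := mulr_ge0 CeS t00; lra.
  have /andP[_ h1] := Q_total 0 T idl (@sqn_ge0 _ _ _ _ dl).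
  have /andP[h2 _] := Q_total 0 t0 idl (@sqn_ge0 _ _ _ _ dl).
  have /andP[_ h3] := Q_total 0 T iz (@sqn_ge0 _ _ _ _ zeta).
  have /andP[h4 _] := Q_total 0 t0 iz (@sqn_ge0 _ _ _ _ zeta).
  have h5 := ler_wpM2l ce h3; have h6 := mulr_ge0 ce h4.
  have h7 := ler_wpM2l (mulr_ge0 (ler0n _ 48) cc) (le_trans h1 hdl).
  have h8 := mulr_ge0 (mulr_ge0 (ler0n _ 48) cc) h2.
  rewrite /D -/Z in h5 *; rewrite /Qz; lra.
- move=> s t ts st tT; have s0 := le_trans t00 ts.
  have [i4 h4] := hL s t s0 st.
  have := step_estimate s0 st tT e0 ele1 ok i4 h4.
  have QgE : Qg s t = Qg 0 t - Qg 0 s by exact: Q_add.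
  have QzE : Qz s t = Qz 0 t - Qz 0 s by exact: Q_add.
  rewrite -/dl (Q_add idl s0 st) -/K.
  have /andP[qg0 _] := Q_total s t ig g0.
  (* One of the two factors t - s is enlarged to T, which leaves the increment of V with the single
     factor t - s. *)
  have h9 : C / e * (t - s) * (2 * (t - s) * Qg s t + 8 * c * Qz s t) <=
      C / e * (t - s) * (2 * T * Qg s t + 8 * c * Qz s t).
    apply: ler_wpM2l; first by apply: mulr_ge0 => //; rewrite subr_ge0.
    by rewrite lerD2r; apply: ler_wpM2r => //; lra.
  move: h9; rewrite QgE QzE /W /V.
  move: (C / e) (4 / e) (\int[nu]_z (win 0 t z * sqn dl z)) (\int[nu]_z (win 0 s z * sqn dl z)).
  move: (u s) (u t) (Qg 0 s) (Qg 0 t) (Qz 0 s) (Qz 0 t) => us ut gs gt zs zt Ce' e4' ls lt.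
  lra.
Qed.

End one_step.

(** * From progressive to joint measurability *)

Section progressive_measurability.
Context (R : realType).

Lemma measurable_id_sub d (Om : measurableType d) (F : set_system Om) :
  F `<=` measurable ->
  measurable_fun [set: Om] (fun w => (w : g_sigma_algebraType F)).
Proof.
move=> FM _ A mA; rewrite setTI.
by move: A mA; apply: smallest_sub => //; exact: sigma_algebra_measurable.
Qed.

Lemma measurable_pair_id_sub d1 d2 (S : measurableType d1) (Om : measurableType d2)
    (F : set_system Om) : F `<=` measurable ->
  measurable_fun [set: S * Om] (fun z => (z.1, (z.2 : g_sigma_algebraType F))).
Proof.
move=> FM; apply: measurable_fun_pair; first exact: measurable_fst.
by apply: measurableT_comp (measurable_id_sub FM) _; exact: measurable_snd.
Qed.

Lemma bar_filtration_measurable d (Om : measurableType d) (F : R -> set_system Om) t :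
  F t `<=` measurable -> bar_filtration F t `<=` measurable.
Proof.
move=> FM A mA.
have := measurable_pair_id_sub (S := Om) FM measurableT mA.
by rewrite setTI; congr measurable; apply/seteqP; split => -[].
Qed.

(** The process is cut to 0 outside [0, T], not frozen at T. Progressive measurability at the single
    time T thus makes it jointly measurable on the whole line. *)
Definition stopped (Om : Type) (T : R) (psi : R -> Om -> R) (z : R * Om) : R :=
  if 0 <= z.1 <= T then psi z.1 z.2 else 0.

Lemma measurable_stopped d (Om : measurableType d) (F : R -> set_system Om) T
    (psi : R -> Om -> R) : 0 <= T -> F T `<=` measurable ->
  prog_measurable F T psi ->
  measurable_fun [set: measurableTypeR R * Om] (stopped T psi).
Proof.
move=> T0 FM mpsi.
have TT : 0 <= T <= T by rewrite T0 lexx.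
pose D : set (measurableTypeR R * Om) := `[0, T]%classic `*` setT.
have mD : measurable D by apply: measurableX => //; exact: measurable_itv.
have -> : stopped T psi = (fun z => psi z.1 z.2) \_ D.
  apply/funext => z; rewrite /stopped patchE /D.
  case: ifPn => h; case: ifPn => //; rewrite ?notin_setE ?in_setE /= in_itv /= ?h.
    by case.
  by move=> [h' _]; rewrite h' in h.
apply/(measurable_restrictT _ mD) => _ U mU.
have mid := measurable_pair_id_sub (S := measurableTypeR R) FM.
have := mid measurableT _ (mpsi T TT (measurableX (measurable_itv `[0, T]) measurableT) U mU).
by rewrite setTI; congr measurable; apply/seteqP; split => -[].
Qed.

End progressive_measurability.

(** * The given Ito integrals in terms of elementary integrands *)

Section ito_data.
Context (R : realType) (d : measure_display) (Om : measurableType d).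
Context (P : probability Om R) (P_complete : measure_is_complete P).
Context (n : nat) (B : R -> Om -> 'rV[R]_n).
Hypothesis B_bm : brownian_motion P B.
Local Notation mu := (@lebesgue_measure R).
Local Notation nu := (mu \x P)%E.
Local Notation F := (aug_filtration P B).
Variable T : R.
Hypothesis T0 : 0 <= T.

Lemma enorm_sqr m (u : 'rV[R]_m) : enorm u ^+ 2 = \sum_(i < m) u ord0 i ^+ 2.
Proof.
rewrite /enorm sqr_sqrtr /dot; last by apply: sumr_ge0 => i _; rewrite -expr2 sqr_ge0.
by apply: eq_bigr => i _; rewrite expr2.
Qed.

Lemma iterated_product (f : R * Om -> R) (h : R -> Om -> R) :
  measurable_fun [set: measurableTypeR R * Om] f -> (forall z, 0 <= f z) ->
  (forall z, f z = if 0 <= z.1 <= T then h z.1 z.2 else 0) ->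
  (\int[nu]_z (f z)%:E = \int[P]_w \int[mu]_(s in `[0%R, T]) (h s w)%:E)%E.
Proof.
move=> mf f0 fE.
rewrite fubini_tonelli2; [|exact/measurable_EFinP|by move=> z; rewrite lee_fin].
apply: eq_integral => w _; rewrite /fubini_G [RHS]integral_mkcond.
apply: eq_integral => r _; rewrite patchE mem_setE in_itv /= fE /=.
by case: ifP.
Qed.

Definition stopped_coord (Z : R -> Om -> 'rV[R]_n) (i : 'I_n) : R * Om -> R :=
  stopped T (fun t w => Z t w ord0 i).

Lemma sqn_stopped Z z : sqn (stopped_coord Z) z =
  if 0 <= z.1 <= T then enorm (Z z.1 z.2) ^+ 2 else 0.
Proof.
rewrite enorm_sqr /sqn /stopped_coord /stopped.
by case: ifP => _ //; apply: big1 => i _; rewrite expr0n.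
Qed.

Lemma H2vec_sqintg Z : H2vec P F T Z -> forall i, sqintg nu (stopped_coord Z i).
Proof.
move=> [mZ finZ].
have mZi i : measurable_fun [set: measurableTypeR R * Om] (stopped_coord Z i).
  apply: (@measurable_stopped _ _ _ F) => //; exact: (aug_filtration_measurable P_complete B_bm).
have ms : measurable_fun [set: measurableTypeR R * Om] (sqn (stopped_coord Z)).
  by apply: measurable_sum => i; exact: measurable_funX.
have h := iterated_product (h := fun t w => enorm (Z t w) ^+ 2) ms
  (fun z => sqn_ge0 (stopped_coord Z) z) (sqn_stopped Z).
have is_ : intg nu (sqn (stopped_coord Z)).
  by apply: ge0_intg => //; [exact: sqn_ge0|rewrite h].
move=> i; apply/sqintgP; split => //; apply: intg_dom is_; first exact: measurable_funX.
move=> z; rewrite ger0_norm ?sqr_ge0// /sqn (bigD1 i)//= lerDl.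
by apply: sumr_ge0 => j _; exact: sqr_ge0.
Qed.

(** One element per time interval and coordinate direction, so that vector-valued coefficients
    become scalar weights. *)
Definition step_elems (phi : step_data R Om n) : seq (elem R Om n) :=
  [seq Elem (step_time phi k) (step_time phi k.+1) i (fun w => step_coef phi k w ord0 i)
     | k <- iota 0 (step_size phi), i <- enum 'I_n].

Lemma coord_le_enorm (u : 'rV[R]_n) i : `|u ord0 i| <= enorm u.
Proof.
rewrite -sqrtr_sqr /enorm ler_wsqrtr// /dot (bigD1 i)//= expr2 lerDl.
by apply: sumr_ge0 => j _; rewrite -expr2 sqr_ge0.
Qed.

Lemma step_elems_ok phi : simple_process F T phi ->
  forall x, List.In x (step_elems phi) -> elem_ok P B 0 T x.
Proof.
move=> [ht hm ha [M hM]] x.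
suff H k i : (k < step_size phi)%N -> elem_ok P B 0 T
   (Elem (step_time phi k) (step_time phi k.+1) i (fun w => step_coef phi k w ord0 i)).
  rewrite /step_elems.
  have: forall k, k \in iota 0 (step_size phi) -> (k < step_size phi)%N.
    by move=> k; rewrite mem_iota add0n.
  elim: (iota 0 _) => [//|k s ih hs] /List.in_app_iff[|]; last first.
    by apply: ih => k' k's; apply: hs; rewrite inE k's orbT.
  have kp : (k < step_size phi)%N by apply: hs; rewrite inE eqxx.
  elim: (enum 'I_n) => [//|i t iht] /= [<-|]; [exact: H|exact: iht].
move=> kp; split => /=.
- by have /andP[] := ht k (ltnW kp).
- exact: hm.
- by have /andP[] := ht k.+1 kp.
- exact: ha.
- by exists M => w; apply: le_trans (coord_le_enorm _ _) (hM k kp w).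
Qed.

Lemma step_elems_upto phi t w :
  elem_upto B (step_elems phi) t w = step_integral B phi t w.
Proof.
rewrite /elem_upto /step_elems /step_integral big_allpairs_dep /= -(big_mkord xpredT (fun k =>
  dot (step_coef phi k w) (B (Num.min (step_time phi k.+1) t) w - B (Num.min (step_time phi k) t) w))).
rewrite /index_iota subn0; apply: eq_bigr => k _.
rewrite big_enum /dot; apply: eq_bigr => i _ /=.
by rewrite !mxE.
Qed.

Lemma step_elems_val phi s w i :
  elem_val (step_elems phi) i (s, w) = step_value phi s w ord0 i.
Proof.
rewrite /elem_val /step_elems /step_value summxE big_allpairs_dep /= -(big_mkord xpredT (fun k =>
  (if step_time phi k < s <= step_time phi k.+1 then step_coef phi k w else 0) ord0 i)).
rewrite /index_iota subn0; apply: eq_bigr => k _.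
rewrite big_enum (bigD1 i)//= big1 ?addr0; last first.
  by move=> j /negbTE ->; rewrite !mul0r.
by rewrite eqxx mul1r; case: ifP => _; rewrite ?mul1r ?mul0r ?mxE.
Qed.

Lemma elem_val_outside (l : seq (elem R Om n)) i z :
  (forall x, List.In x l -> elem_ok P B 0 T x) -> ~~ (0 <= z.1 <= T) -> elem_val l i z = 0.
Proof.
move=> ok nz; elim: l ok => [_|e l ih ok]; first by rewrite /elem_val big_nil.
rewrite /elem_val big_cons -/(elem_val l i z) ih ?addr0; last by move=> x xl; apply: ok; right.
have [l0 lh hT _ _] := ok e (or_introl erefl).
have [/andP[h1 h2]|_] := boolP (lo e < z.1 <= hi e); last by rewrite mulr0 mul0r.
by exfalso; move/negP: nz; apply; apply/andP; split; lra.
Qed.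

Lemma is_ito_approx Z I : H2vec P F T Z -> is_ito_integral P F T B Z I ->
  ito_approx P B T I (stopped_coord Z).
Proof.
move=> hZ [aI _ [phi [sphi cZ cI]]].
have sZ := H2vec_sqintg hZ.
have ok j := step_elems_ok (sphi j).
have valE j : (\int[nu]_z (sqn (fun i => elem_val (step_elems (phi j)) i \- stopped_coord Z i) z)%:E =
    \int[P]_w \int[mu]_(s in `[0%R, T]) (enorm (step_value (phi j) s w - Z s w) ^+ 2)%:E)%E.
  apply: iterated_product.
  - apply: measurable_sum => i; apply: measurable_funX; apply: measurable_funB.
      exact: (measurable_elem_val P_complete B_bm i (ok j)).
    by case: (sZ i).
  - by move=> z; exact: sqn_ge0.
  - move=> [r w]; rewrite enorm_sqr /sqn; case: ifPn => h.
      apply: eq_bigr => i _; rewrite /= step_elems_val /stopped_coord /stopped /= h.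
      by rewrite !mxE.
    apply: big1 => i _ /=; rewrite (elem_val_outside i (ok j) h) /stopped_coord /stopped.
    by rewrite (negbTE h) subr0 expr0n.
have small (a : nat -> \bar R) (e : R) : 0 < e -> (forall j, 0 <= a j)%E ->
    a j @[j --> \oo] --> 0%E -> \forall j \near \oo, (a j < e%:E)%E.
  move=> e0 a0 ca.
  have h : nbhs (0%E : \bar R) [set x | (x < e%:E)%E].
    by apply: open_ereal_lt'; rewrite lte_fin.
  exact: (ca _ h).
have nn (x : R) : (0 <= (x ^+ 2)%:E)%E by rewrite lee_fin sqr_ge0.
have mI t : 0 <= t <= T -> measurable_fun [set: Om] (I t).
  by move=> tT; apply: (adapted_at_measurable P_complete B_bm (aI t tT)).
have upE j t : (fun w => step_integral B (phi j) t w - I t w) =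
   (fun w => elem_upto B (step_elems (phi j)) t w - I t w).
  by apply/funext => w; rewrite step_elems_upto.
(* Square integrability of I t is not part of the data: it follows from one simple integral at
   finite L^2 distance from it. *)
have sI t : 0 <= t <= T -> sqintg P (I t).
  move=> tT; have /andP[t0 _] := tT.
  have [N _ /(_ N (leqnn N)) /= hN] :=
    small _ 1 ltr01 (fun j => integral_ge0 _ (fun w _ => nn _)) (cI t tT).
  have sD : sqintg P (fun w => step_integral B (phi N) t w - I t w).
    split; last first.
      apply: lt_trans (ltry 1); apply: le_lt_trans hN.
      by under eq_integral do rewrite -real_normK ?num_real//.
    rewrite upE; apply: measurable_funB; last exact: mI.
    by case: (elem_upto_sqintg P_complete B_bm t0 (ok N)).
  have := sqintgB (elem_upto_sqintg P_complete B_bm t0 (ok N)) sD.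
  by congr sqintg; apply/funext => w; rewrite step_elems_upto; ring.
split => // s t e sT tT e0.
have [N1 _ h1] := small _ e e0 (fun j => integral_ge0 _ (fun w _ => integral_ge0 _ (fun r _ => nn _))) cZ.
have [N2 _ h2] := small _ e e0 (fun j => integral_ge0 _ (fun w _ => nn _)) (cI s sT).
have [N3 _ h3] := small _ e e0 (fun j => integral_ge0 _ (fun w _ => nn _)) (cI t tT).
pose j := maxn N1 (maxn N2 N3).
have bound u : 0 <= u <= T ->
    (\int[P]_w (`|step_integral B (phi j) u w - I u w| ^+ 2)%:E < e%:E)%E ->
    \int[P]_w (elem_upto B (step_elems (phi j)) u w - I u w) ^+ 2 <= e.
  move=> uT hu; have /andP[u0 _] := uT.
  rewrite -lee_fin EFin_int; last first.
    by apply: sqintg_sqr; apply: sqintgB; [exact: (elem_upto_sqintg P_complete B_bm u0 (ok j))|exact: sI].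
  apply: le_trans (ltW hu); rewrite le_eqVlt; apply/orP; left; apply/eqP.
  by apply: eq_integral => w _; rewrite real_normK ?num_real// step_elems_upto.
exists (step_elems (phi j)); split.
- exact: ok.
- rewrite -lee_fin EFin_int; last first.
    by apply: sqn_intg => i; apply: sqintgB => //; exact: (elem_val_sqintg P_complete B_bm _ _ (ok j)).
  by rewrite valE; apply/ltW/h1; rewrite /= /j leq_maxl.
- by apply: bound => //; apply: h2; rewrite /= /j !leq_max leqnn orbT.
- by apply: bound => //; apply: h3; rewrite /= /j !leq_max leqnn !orbT.
Qed.

End ito_data.

(** * Joint measurability by discretization *)

Section discretization.
Context (R : realType) (d : measure_display) (X : measurableType d).

Lemma measurable_glue (K : countType) (f : K -> X -> R) (kap : X -> K) :
  (forall k, measurable [set x | kap x = k]) ->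
  (forall k, measurable_fun [set: X] (f k)) ->
  measurable_fun [set: X] (fun x => f (kap x) x).
Proof.
move=> mk mf _ U mU; rewrite setTI.
have -> : (fun x => f (kap x) x) @^-1` U = \bigcup_m (if unpickle m is Some k
    then [set x | kap x = k] `&` f k @^-1` U else set0).
  apply/seteqP; split => [x Ux|x [m _]].
    by exists (pickle (kap x)) => //; rewrite pickleK.
  by case: (unpickle m) => // k [/= <-].
apply: bigcupT_measurable => m; case: (unpickle m) => // k.
by apply: measurableI => //; rewrite -[X in measurable X]setTI; exact: mf.
Qed.

Definition grid n (x : R) : int := Num.floor (n.+1%:R * x).

Lemma grid_close n (x : R) : (grid n x)%:~R / n.+1%:R <= x < ((grid n x)%:~R + 1) / n.+1%:R.
Proof.
have n0 : 0 < n.+1%:R :> R by rewrite ltr0n.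
have := floor_itv (n.+1%:R * x); rewrite -/(grid n x) intrD => /andP[h1 h2].
by rewrite ler_pdivrMr// ltr_pdivlMr// (mulrC x) h1; exact: h2.
Qed.

Lemma measurable_grid n (V : X -> R) k : measurable_fun [set: X] V ->
  measurable [set x | grid n (V x) = k].
Proof.
move=> mV; have mW : measurable_fun [set: X] (fun x => n.+1%:R * V x).
  by apply: measurable_funM.
have -> : [set x | grid n (V x) = k] =
    (fun x => n.+1%:R * V x) @^-1` (`[k%:~R, (k + 1)%:~R[%classic : set R).
  apply/seteqP; split => x /=; rewrite in_itv /=; first by move=> <-; exact: floor_itv.
  exact: floor_def.
by rewrite -[X in measurable X]setTI; apply: mW => //; exact: measurable_itv.
Qed.

Lemma inv_nat_small (e C : R) : 0 < e -> 0 <= C ->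
  exists N, forall n, (N <= n)%N -> C / n.+1%:R < e.
Proof.
move=> e0 C0; exists (Num.bound (C / e)) => n Nn.
have := archi_boundP (divr_ge0 C0 (ltW e0)); rewrite ltr_pdivrMr// => h.
rewrite ltr_pdivrMr ?ltr0n// mulrC; apply: (lt_le_trans h).
by rewrite ler_wpM2r ?(ltW e0)// ler_nat ltnW.
Qed.

(* A function measurable in its first argument and Lipschitz in its second one is
   jointly measurable: approximate the second argument on finer and finer grids. *)
Lemma measurable_caratheodory (J : finType) (f : X -> (J -> R) -> R) (V : J -> X -> R)
    (C : R) : 0 <= C -> (forall v, measurable_fun [set: X] (f^~ v)) ->
  (forall j, measurable_fun [set: X] (V j)) ->
  (forall x v v', `|f x v - f x v'| <= C * \sum_j `|v j - v' j|) ->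
  measurable_fun [set: X] (fun x => f x (V^~ x)).
Proof.
move=> C0 mf mV lip.
pose kap n x : {ffun J -> int} := [ffun j => grid n (V j x)].
pose h n x := f x (fun j => (kap n x j)%:~R / n.+1%:R).
apply: (@measurable_fun_cvg _ _ _ _ h).
  move=> n; pose fk (k : {ffun J -> int}) x := f x (fun j => (k j)%:~R / n.+1%:R).
  apply: (@measurable_glue _ fk (kap n)).
    move=> k; have -> : [set x | kap n x = k] = \bigcap_(j in [set: J]) [set x | grid n (V j x) = k j].
      apply/seteqP; split => x /=; first by move=> <- j _; rewrite /kap ffunE.
      by move=> hx; apply/ffunP => j; rewrite ffunE; exact: hx.
    by apply: fin_bigcap_measurable => // j _; exact: measurable_grid.
  by move=> k; exact: mf.
move=> x _; apply/cvgrPdist_lt => e e0.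
have [N hN] := inv_nat_small e0 (mulr_ge0 C0 (ler0n R #|J|)).
exists N => // n /= Nn; apply: le_lt_trans (hN n Nn); apply: le_trans (lip _ _ _) _.
rewrite -mulrA ler_wpM2l//.
apply: (@le_trans _ _ (\sum_(j : J) (n.+1%:R : R)^-1)); last first.
  by rewrite sumr_const -[leLHS]mulr_natl.
apply: ler_sum => j _; rewrite /kap ffunE.
have /andP[h1 h2] := grid_close n (V j x).
by rewrite ger0_norm ?subr_ge0//; move: h2; rewrite mulrDl mul1r -ltrBlDl => /ltW.
Qed.

End discretization.

(** * Joint measurability of right-continuous processes *)

Section joint_version.
Context (R : realType) (d : measure_display) (Om : measurableType d).

Lemma measurable_joint_version (Y : R -> Om -> R) (T : R) (N : set Om) : 0 <= T ->
  measurable N -> (forall t, 0 <= t <= T -> measurable_fun [set: Om] (Y t)) ->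
  (forall w, ~ N w -> forall t, 0 <= t < T -> Y s w @[s --> t^'+] --> Y t w) ->
  measurable_fun [set: measurableTypeR R * Om]
    (fun z => if (0 <= z.1 <= T) && (z.2 \notin N) then Y z.1 z.2 else 0).
Proof.
move=> T0 mN mY cY.
(* The right end of the grid cell, clamped to [0, T]. It lies strictly to the right of any t < T in
   the cell, as right continuity demands, and equals T when t = T. *)
pose tau n (k : int) : R := Num.max 0 (Num.min T ((k%:~R + 1) / n.+1%:R)).
have tauT n k : 0 <= tau n k <= T by rewrite /tau le_max lexx /= ge_max T0 ge_min lexx.
pose D := (`[0, T]%classic : set (measurableTypeR R)) `*` ~` N.
have mD : measurable D by apply: measurableX; [exact: measurable_itv|exact: measurableC].
have DE z : (z \in D) = (0 <= z.1 <= T) && (z.2 \notin N).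
  rewrite /D; apply/idP/idP; rewrite in_setE /= in_itv /=.
    by case=> -> /= h; rewrite notin_setE.
  by move=> /andP[-> h]; split => //; rewrite notin_setE in h.
pose h n (z : measurableTypeR R * Om) : R :=
  ((fun z => Y (tau n (grid n z.1)) z.2) \_ D) z.
have m1 : measurable_fun [set: measurableTypeR R * Om] (fun z => (z.1 : R)).
  by apply: (measurable_fun1 (f := fun x => x)); exact: measurable_id.
apply: (@measurable_fun_cvg _ _ _ _ h) => [n|z _].
  apply/(measurable_restrictT _ mD)/measurable_funTS.
  apply: (@measurable_glue _ _ _ _ (fun k z => Y (tau n k) z.2) (fun z => grid n z.1)).
    by move=> k; exact: measurable_grid.
  by move=> k; apply: measurable_fun2; exact: mY.
have hE : (h^~ z) = (fun n => if (0 <= z.1 <= T) && (z.2 \notin N)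
    then Y (tau n (grid n z.1)) z.2 else 0).
  by apply/funext => n; rewrite /h patchE DE.
rewrite hE; case: ifPn => [/andP[/andP[z0 zT] zN]|_]; last exact: cvg_cst.
have tau_gt n : z.1 < ((grid n z.1)%:~R + 1) / n.+1%:R by have /andP[] := grid_close n z.1.
have tau_le n : ((grid n z.1)%:~R + 1) / n.+1%:R <= z.1 + 1 / n.+1%:R.
  by have /andP[+ _] := grid_close n z.1; rewrite mulrDl lerD2r.
move: zT; rewrite le_eqVlt => /predU1P[zT|zT].
  have -> : (fun n => Y (tau n (grid n z.1)) z.2) = (fun=> Y z.1 z.2).
    apply/funext => n; congr (Y _ _); rewrite /tau zT min_l ?max_r//.
    by have := tau_gt n; rewrite zT => /ltW.
  exact: cvg_cst.
apply/cvgrPdist_lt => e e0.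
have zN' : ~ N z.2 by rewrite notin_setE in zN.
have zTT : 0 <= z.1 < T by rewrite z0 zT.
have /cvgrPdist_lt/(_ e e0) := cY _ zN' _ zTT.
rewrite /at_right near_withinE => /nbhs_ballP[del /= del0 hdel].
have [M hM] := inv_nat_small del0 (@ler01 R).
exists M => // n /= Mn; apply: hdel.
  rewrite /ball /= ltr_norml; have := hM n Mn; have := tau_gt n; have := tau_le n.
  rewrite /tau; move: ((_ + 1) / _) (1 / _) => q r h1 h2 h3.
  rewrite max_r; last by rewrite le_min T0 ltW// (le_lt_trans z0).
  have [Tq|Tq] := leP T q; apply/andP; split; lra.
rewrite /tau lt_max lt_min zT tau_gt orbT//.
Qed.

End joint_version.

(** * Sections of null sets of the product space *)

Section almost_everywhere_sections.
Context (R : realType) (d : measure_display) (Om : measurableType d).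
Variable P : probability Om R.

(** Fubini's theorem for the indicator of a measurable null set D covering the exceptions: the
    sections of D have integrable measure with integral 0. *)
Lemma ae_section (Q : Om * Om -> Prop) : {ae (P \x P)%E, forall z, Q z} ->
  {ae P, forall w, {ae P, forall w', Q (w', w)}}.
Proof.
move=> [D [mD D0 QD]].
have D1 : (\int[(P \x P)]_z (\1_D z)%:E = 0 :> \bar R)%E.
  by rewrite integral_indic// setIT; exact: D0.
have iD : intg (P \x P)%E (\1_D : Om * Om -> R).
  apply: ge0_intg; [exact: measurable_indic|by move=> z; rewrite indicE|].
  by rewrite D1.
have [_ [i1 e1]] := real_fubini2 iD.
have q0 w : 0 <= \int[P]_w' (\1_D (w', w) : R) by apply: int_ge0 => w'; rewrite indicE.
have z0 : \int[P]_w (\int[P]_w' (\1_D (w', w) : R)) = 0.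
  by rewrite e1 /Rintegral D1.
have h : ae_eq P [set: Om] (fun w => (\int[P]_w' (\1_D (w', w) : R))%:E) (cst 0%E).
  apply/ae_eq_integral_abs => //; first exact/measurable_EFinP/(intg_mfun i1).
  under eq_integral do rewrite gee0_abs ?lee_fin//.
  by rewrite -EFin_int// z0.
apply: filterS h => w /(_ I) [hw].
have mDw : measurable (ysection D w) by exact: measurable_ysection.
exists (ysection D w); split => //.
  have -> : P (ysection D w) = (\int[P]_w' (\1_(ysection D w) w')%:E)%E.
    by rewrite integral_indic// setIT.
  have iw : intg P (\1_(ysection D w) : Om -> R) by exact: integrable_indic.
  rewrite -EFin_int// -[RHS]/(0%:E); congr EFin; rewrite -[RHS]hw.
  by apply: eq_Rintegral => w' _; rewrite !indicE mem_ysection.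
by move=> w' /= nQ; rewrite /ysection /= inE; apply: QD.
Qed.

End almost_everywhere_sections.

(** * Time and two copies of the probability space *)

Section product_with_copy.
Context (R : realType) (d : measure_display) (Om : measurableType d).
Variable P : probability Om R.
Local Notation mu := (@lebesgue_measure R).
Local Notation nu := (mu \x P)%E.
Local Notation nu' := (nu \x P)%E.

Lemma measurable_copy : measurable_fun [set: (measurableTypeR R * Om) * Om]
  (fun z => (z.1.1, z.2) : measurableTypeR R * Om).
Proof.
apply: measurable_fun_pair; last exact: measurable_snd.
exact: measurableT_comp measurable_fst measurable_fst.
Qed.

Lemma measurable_reassoc : measurable_fun [set: (measurableTypeR R * Om) * Om]
  (fun z => (z.1.1, (z.2, z.1.2)) : measurableTypeR R * (Om * Om)).
Proof.
apply: measurable_fun_pair; first exact: measurableT_comp measurable_fst measurable_fst.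
apply: measurable_fun_pair; first exact: measurable_snd.
exact: measurableT_comp measurable_snd measurable_fst.
Qed.

Lemma product_sigma_finite : sigma_finite [set: measurableTypeR R * Om] nu.
Proof.
have /sigma_finiteP[F [TF ndF Foo]] := sigma_finiteT mu.
exists (fun k => F k `*` [set: Om]).
  rewrite -setXTT TF predeqE => -[x w]; split => /= [[[k _ Fx] _]|[k _ [Fx _]]].
    by exists k.
  by split => //; exists k.
move=> k; have [mF Fk] := Foo k; split; first exact: measurableX.
by rewrite product_measure1E// [X in (_ * X)%E](probability_setT P) mule1.
Qed.

(* The library attaches the sigma-finite structure of a product measure only to
   products of probabilities. *)
Definition product_sf : {sigma_finite_measure set (measurableTypeR R * Om)%type -> \bar R} :=
  HB.pack_for (SigmaFiniteMeasure.type (measurableTypeR R * Om)%type R)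
    (mu \x P)%E
    (Measure_isSigmaFinite.Build _ (measurableTypeR R * Om)%type R (mu \x P)%E
       product_sigma_finite).

Definition pair_prob : probability (Om * Om)%type R := (P \x P)%E.

Lemma tonelli_fst (h : R * Om -> \bar R) :
  measurable_fun [set: measurableTypeR R * Om] h -> (forall z, 0 <= h z)%E ->
  (\int[nu']_z h z.1 = \int[nu]_z h z)%E.
Proof.
move=> mh h0; have mh1 := measurableT_comp mh (@measurable_fst _ _ _ Om).
rewrite (@fubini_tonelli1 _ _ _ _ _ product_sf P _ mh1 (fun z => h0 _)).
apply: eq_integral => z _; rewrite /fubini_F /=.
by rewrite integral_cst// [X in (_ * X)%E](probability_setT P) mule1.
Qed.

Let tonelli3 (h : (R * Om) * Om -> \bar R) :
  measurable_fun [set: (measurableTypeR R * Om) * Om] h -> (forall z, 0 <= h z)%E ->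
  (\int[nu']_z h z = \int[mu]_r \int[P]_w \int[P]_w' h ((r, w), w'))%E.
Proof.
move=> mh h0; rewrite (@fubini_tonelli1 _ _ _ _ _ product_sf P _ mh h0).
have mF : measurable_fun [set: measurableTypeR R * Om] (fubini_F P h).
  exact: measurable_fun_fubini_tonelli_F.
have F0 z : (0 <= fubini_F P h z)%E by rewrite /fubini_F; exact: integral_ge0.
exact: (@fubini_tonelli1 _ _ _ _ _ mu P _ mF F0).
Qed.

(** Coefficients take the pair (w', w), whereas the copy w' comes last here so that it can be
    integrated out; this reconciles the two orders. *)
Lemma tonelli_swap (h : R * (Om * Om) -> \bar R) :
  measurable_fun [set: measurableTypeR R * (Om * Om)] h -> (forall z, 0 <= h z)%E ->
  (\int[nu']_z h (z.1.1, (z.2, z.1.2)) = \int[(mu \x pair_prob)]_z h z)%E.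
Proof.
move=> mh h0; have mhs := measurableT_comp mh measurable_reassoc.
rewrite (tonelli3 mhs (fun z => h0 _)) (@fubini_tonelli1 _ _ _ _ _ mu pair_prob _ mh h0).
apply: eq_integral => r _; rewrite /fubini_F.
have mhr : measurable_fun [set: Om * Om] (fun ww => h (r, ww)).
  by apply: (measurableT_comp mh); exact: measurable_pair1.
by rewrite (@fubini_tonelli2 _ _ _ _ _ P P _ mhr (fun z => h0 _)).
Qed.

Lemma tonelli_copy (h : R * Om -> \bar R) :
  measurable_fun [set: measurableTypeR R * Om] h -> (forall z, 0 <= h z)%E ->
  (\int[nu']_z h (z.1.1, z.2) = \int[nu]_z h z)%E.
Proof.
move=> mh h0; have mhs := measurableT_comp mh measurable_copy.
rewrite (tonelli3 mhs (fun z => h0 _)) (@fubini_tonelli1 _ _ _ _ _ mu P _ mh h0).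
apply: eq_integral => r _; rewrite /fubini_F /=.
by rewrite integral_cst// [X in (_ * X)%E](probability_setT P) mule1.
Qed.

Lemma sqintg_fst (h : R * Om -> R) : sqintg nu h -> sqintg nu' (fun z => h z.1).
Proof.
move=> [mh hoo]; split; first exact: measurableT_comp mh measurable_fst.
rewrite (tonelli_fst (h := fun z => (h z ^+ 2)%:E))// => [|z]; last by rewrite lee_fin sqr_ge0.
exact/measurable_EFinP/measurable_funX.
Qed.

Lemma sqintg_copy (h : R * Om -> R) : sqintg nu h -> sqintg nu' (fun z => h (z.1.1, z.2)).
Proof.
move=> [mh hoo]; split; first exact: measurableT_comp mh measurable_copy.
rewrite (tonelli_copy (h := fun z => (h z ^+ 2)%:E))// => [|z]; last by rewrite lee_fin sqr_ge0.
exact/measurable_EFinP/measurable_funX.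
Qed.

Lemma sqintg_swap (h : R * (Om * Om) -> R) : sqintg (mu \x pair_prob)%E h ->
  sqintg nu' (fun z => h (z.1.1, (z.2, z.1.2))).
Proof.
move=> [mh hoo]; split; first exact: measurableT_comp mh measurable_reassoc.
rewrite (tonelli_swap (h := fun z => (h z ^+ 2)%:E))// => [|z]; last by rewrite lee_fin sqr_ge0.
exact/measurable_EFinP/measurable_funX.
Qed.

(** Averaging over the copy contracts L^2: for almost every z, the mean of G^2 minus the squared
    mean is the integral of a square. *)
Lemma sqintg_mean (G : (R * Om) * Om -> R) : sqintg nu' G -> intg nu' G ->
  {ae nu, forall z, intg P (fun w' => G (z, w'))} /\
  sqintg nu (fun z => \int[P]_w' G (z, w')).
Proof.
move=> sG iG; have [h1 [j1 _]] := @real_fubini1 _ _ _ _ _ product_sf P _ iG.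
have [h2 [j2 _]] := @real_fubini1 _ _ _ _ _ product_sf P _ (sqintg_sqr sG).
split; first exact: h1.
apply/sqintgP; split; first exact: intg_mfun j1.
apply: ae_intg_dom j2; first by apply: measurable_funX; exact: (intg_mfun j1).
have nuF : Filter (almost_everywhere nu) by exact: ae_filter_ringOfSetsType.
apply: (@filterS2 _ _ nuF _ _ _ _ h1 h2) => z i1 i2.
set m := \int[P]_w' G (z, w').
have ic : intg P (fun w' => m) by case: (hasint_cst P m).
rewrite ger0_norm ?sqr_ge0// -subr_ge0.
suff -> : \int[P]_w' (G (z, w') ^+ 2) - m ^+ 2 = \int[P]_w' (G (z, w') - m) ^+ 2.
  by apply: int_ge0 => w'; exact: sqr_ge0.
have [im em] := hasint_cst P (m ^+ 2).
have iGm : intg P (fun w' => (- 2 * m) * G (z, w') + m ^+ 2) by apply: intgD => //; exact: intgZ.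
transitivity (\int[P]_w' (G (z, w') ^+ 2 + ((- 2 * m) * G (z, w') + m ^+ 2))); last first.
  by apply: eq_Rintegral => w' _; ring.
rewrite int_add// int_add// ?em ?int_scale//; last exact: intgZ.
by rewrite -/m; ring.
Qed.

End product_with_copy.

(** * The averaged driver along a solution is square integrable *)

Section mean_field_integrand.
Context (R : realType) (d : measure_display) (Om : measurableType d).
Context (P : probability Om R) (P_complete : measure_is_complete P).
Context (n : nat) (B : R -> Om -> 'rV[R]_n).
Hypothesis B_bm : brownian_motion P B.
Local Notation mu := (@lebesgue_measure R).
Local Notation nu := (mu \x P)%E.
Local Notation F := (aug_filtration P B).
Variable T : R.
Hypothesis T0 : 0 <= T.
Variables (f : coefficient R Om n) (D : set (Om * Om)) (C : R).
Hypotheses (C0 : 0 <= C) (mD : measurable D).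
Hypothesis f_lip : forall ww, ~ D ww -> forall t, 0 <= t <= T ->
  forall y1' z1' y1 z1 y2' z2' y2 z2,
  `|f ww t y1' z1' y1 z1 - f ww t y2' z2' y2 z2| <=
  C * (`|y1' - y2'| + enorm (z1' - z2') + `|y1 - y2| + enorm (z1 - z2)).
Hypotheses (f_driver : driver F T f) (f_A4 : A4 P F T f).
Variables (y : R * Om -> R) (zeta : 'I_n -> R * Om -> R).
Hypotheses (sy : sqintg nu y) (sz : forall i, sqintg nu (zeta i)).

Lemma enorm_le_sum m (u : 'rV[R]_m) : enorm u <= \sum_i `|u ord0 i|.
Proof.
have S0 : 0 <= \sum_i `|u ord0 i| by apply: sumr_ge0.
rewrite -ler_sqr ?nnegrE ?sqrtr_ge0// enorm_sqr expr2 mulr_suml; apply: ler_sum => i _.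
rewrite -real_normK ?num_real// expr2; apply: ler_wpM2l => //.
by rewrite (bigD1 i)//= lerDl; apply: sumr_ge0.
Qed.

(* The copy of Om read at the second component of z carries the primed
   arguments. *)
Definition integrand (z : (R * Om) * Om) : R :=
  if (0 <= z.1.1 <= T) && ((z.2, z.1.2) \notin D) then
    f (z.2, z.1.2) z.1.1 (y (z.1.1, z.2)) (\row_i zeta i (z.1.1, z.2)) (y z.1) (\row_i zeta i z.1)
  else 0.

Let mF : F T `<=` measurable.
Proof. exact: aug_filtration_measurable. Qed.

Let m_frozen y' z' u v : measurable_fun [set: (measurableTypeR R * Om) * Om]
  (fun z => if (0 <= z.1.1 <= T) && ((z.2, z.1.2) \notin D) then f (z.2, z.1.2) z.1.1 y' z' u v else 0).
Proof.
have m1 := measurable_stopped T0 (bar_filtration_measurable mF) (f_driver y' z' u v).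
have m2 : measurable_fun [set: measurableTypeR R * (Om * Om)]
    (fun x => stopped T (fun t ww => f ww t y' z' u v) x * \1_(~` D) x.2).
  apply: measurable_funM; first exact: m1.
  apply: (measurable_fun2 (g := (\1_(~` D) : Om * Om -> R))).
  by apply: measurable_indic; exact: measurableC.
have := measurableT_comp m2 (@measurable_reassoc R _ Om).
apply: eq_measurable_fun => z _; rewrite /= /stopped /= indicE in_setC.
by case: (0 <= _ <= _) => /=; rewrite ?mul0r//; case: (_ \in D); rewrite /= ?mulr0 ?mulr1.
Qed.

Lemma measurable_integrand : measurable_fun [set: (measurableTypeR R * Om) * Om] integrand.
Proof.
(* Indexes the real arguments of f: the boolean tells the primed from the unprimed ones, [ord0] is
   the y-slot and the lifted indices are the coordinates of z. Off D, f is Lipschitz in all of them,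
   so [measurable_caratheodory] applies. *)
pose J := (bool * 'I_n.+1)%type.
pose fx (z : (measurableTypeR R * Om) * Om) (v : J -> R) :=
  if (0 <= z.1.1 <= T) && ((z.2, z.1.2) \notin D) then
    f (z.2, z.1.2) z.1.1 (v (true, ord0)) (\row_i v (true, lift ord0 i))
      (v (false, ord0)) (\row_i v (false, lift ord0 i))
  else 0.
pose V (j : J) (z : (measurableTypeR R * Om) * Om) :=
  (if unlift ord0 j.2 is Some i then zeta i else y) (if j.1 then (z.1.1, z.2) else z.1).
have -> : integrand = fun z => fx z (V^~ z).
  apply/funext => z; rewrite /integrand /fx /V /= unlift_none.
  by case: ifP => // _; congr f; apply/rowP => i; rewrite !mxE liftK.
apply: (@measurable_caratheodory R _ _ J fx V C) => //.
- by move=> v; exact: m_frozen.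
- move=> [b k]; rewrite /V /=.
  have m1 : measurable_fun [set: measurableTypeR R * Om] (if unlift ord0 k is Some i then zeta i else y).
    by case: (unlift _ _) => [i|]; [exact: sqintg_mfun (sz i)|exact: sqintg_mfun sy].
  case: b; first exact: measurableT_comp m1 (@measurable_copy _ _ _).
  exact: measurableT_comp m1 measurable_fst.
- move=> z v v'; rewrite /fx; case: ifPn => [/andP[tT]|_]; last first.
    by rewrite subrr normr0; apply: mulr_ge0 => //; apply: sumr_ge0.
  rewrite notin_setE => nD; apply: le_trans (f_lip nD tT _ _ _ _ _ _ _ _) _.
  apply: ler_wpM2l => //.
  have -> : \sum_j `|v j - v' j| = \sum_b \sum_k `|v (b, k) - v' (b, k)|.
    by rewrite pair_bigA/=; apply: eq_bigr => -[].
  rewrite big_bool/= !big_ord_recl/= addrA.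
  have h b : enorm (\row_i v (b, lift ord0 i) - \row_i v' (b, lift ord0 i)) <=
      \sum_(i < n) `|v (b, lift ord0 i) - v' (b, lift ord0 i)|.
    by apply: le_trans (enorm_le_sum _) _; apply: ler_sum => i _; rewrite !mxE.
  by apply: lerD (h false); rewrite lerD2r; apply: lerD (h true).
Qed.

Let f0_sqintg : sqintg (mu \x pair_prob P)%E (stopped T (fun t ww => f ww t 0 0 0 0)).
Proof.
have [m0 foo] := f_A4.
have m1 := measurable_stopped T0 (bar_filtration_measurable mF) m0.
split; first exact: m1.
rewrite (iterated_product (pair_prob P) (T := T) (h := fun t ww => `|f ww t 0 0 0 0| ^+ 2)).
- exact: foo.
- exact: measurable_funX.
- by move=> z; exact: sqr_ge0.
- move=> z; rewrite /stopped; case: ifP => _; last by rewrite expr0n.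
  by rewrite real_normK ?num_real.
Qed.

Lemma integrand_sqintg : sqintg (nu \x P)%E integrand.
Proof.
pose h (z : (R * Om) * Om) : R :=
  `|stopped T (fun t ww => f ww t 0 0 0 0) (z.1.1, (z.2, z.1.2))| +
  C * (`|y (z.1.1, z.2)| + \sum_i `|zeta i (z.1.1, z.2)| + `|y z.1| + \sum_i `|zeta i z.1|).
have sh : sqintg (nu \x P)%E h.
  apply: sqintgD; first exact/sqintg_norm/(sqintg_swap f0_sqintg).
  apply: sqintgZ; apply: sqintgD; last first.
    by apply: sqintg_sum => i; apply: sqintg_norm; exact: (sqintg_fst (sz i)).
  apply: sqintgD; last by apply: sqintg_norm; exact: (sqintg_fst sy).
  apply: sqintgD; first by apply: sqintg_norm; exact: (sqintg_copy sy).
  by apply: sqintg_sum => i; apply: sqintg_norm; exact: (sqintg_copy (sz i)).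
apply: sqintg_dom sh; first exact: measurable_integrand.
move=> z; apply: le_trans (ler_norm _); rewrite /integrand /h.
case: ifPn => [/andP[tT]|_]; last first.
  rewrite normr0; apply: addr_ge0 => //; apply: mulr_ge0 => //.
  by do ![apply: addr_ge0 => //]; apply: sumr_ge0.
rewrite notin_setE => nD; rewrite /stopped /= tT.
rewrite -[X in `|X|](subrK (f (z.2, z.1.2) z.1.1 0 0 0 0)) [leRHS]addrC.
apply: le_trans (ler_normD _ _) _; rewrite lerD2r.
apply: le_trans (f_lip nD tT _ _ _ _ _ _ _ _) _; rewrite !subr0; apply: ler_wpM2l => //.
have e (u : 'I_n -> R) : enorm (\row_i u i) <= \sum_i `|u i|.
  by apply: le_trans (enorm_le_sum _) _; apply: ler_sum => i _; rewrite mxE.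
by apply: lerD (e _); rewrite lerD2r; apply: lerD (e _).
Qed.

Lemma integrand_intg : intg (nu \x P)%E integrand.
Proof.
(* Time ranges over the whole line, an infinite measure, so square integrability alone does not give
   integrability. Multiplying by the window ]-1, T] repairs this without changing the integrand;
   starting at -1 keeps time 0 inside the half-open window. *)
have T1 : - 1 <= T by apply: le_trans T0; rewrite lerN10.
have := sqintgM (sqintg_fst (win_mulG_sqintg T1 (sqintg1 P))) integrand_sqintg.
apply: eq_intg => z; rewrite /= mulr1 /win /integrand.
case: ifPn => [/andP[/andP[t0 tT] _]|_]; last by rewrite mulr0.
by rewrite tT (lt_le_trans _ t0) ?ltrN10// mul1r.
Qed.

Definition mean_integrand (z : R * Om) : R := \int[P]_w' integrand (z, w').

Lemma mean_integrand_sqintg : {ae nu, forall z, intg P (fun w' => integrand (z, w'))} /\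
  sqintg nu mean_integrand.
Proof. exact: sqintg_mean integrand_sqintg integrand_intg. Qed.

(** D and N are independent of time, so a single null set of w serves all s. For a good w the two
    functions of w' agree almost everywhere, and completeness of P makes the original one
    measurable. *)
Lemma mean_field_driver_ae (N : set Om) (Y : R -> Om -> R) (Z : R -> Om -> 'rV[R]_n) :
  P.-negligible N -> {ae (P \x P)%E, forall ww, ~ D ww} ->
  (forall z, 0 <= z.1 <= T -> ~ N z.2 -> y z = Y z.1 z.2) ->
  (forall i z, 0 <= z.1 <= T -> zeta i z = Z z.1 z.2 ord0 i) ->
  {ae P, forall w, forall s, 0 <= s <= T -> mean_field_driver P f Y Z s w = mean_integrand (s, w)}.
Proof.
move=> N0 /ae_section D0 yY zZ.
have N0' : {ae P, forall w, ~ N w} by apply: negligibleS N0 => w /= /contrapT.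
apply: filterS2 D0 (N0') => w Dw Nw s sT; rewrite /mean_field_driver /mean_integrand /Rintegral.
have zZr w' : \row_i zeta i (s, w') = Z s w' by apply/rowP => i; rewrite mxE zZ.
have ae : ae_eq P [set: Om] (fun w' => (integrand ((s, w), w'))%:E)
    (fun w' => (f (w', w) s (Y s w') (Z s w') (Y s w) (Z s w))%:E).
  apply: filterS2 Dw N0' => w' nD nN' _; have nDD : (w', w) \notin D by rewrite notin_setE.
  rewrite /integrand /= sT nDD /=.
  by rewrite !zZr !yY.
have mI : measurable_fun [set: Om] (fun w' => (integrand ((s, w), w'))%:E).
  apply/measurable_EFinP; apply: (measurableT_comp measurable_integrand); exact: measurable_pair1.
by congr fine; apply/esym/ae_eq_integral => //; exact: (ae_measurable_fun P_complete ae).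
Qed.

End mean_field_integrand.

(** * Jointly measurable versions and the integral equation *)

Section solution_data.
Context (R : realType) (d : measure_display) (Om : measurableType d).
Context (P : probability Om R) (P_complete : measure_is_complete P).
Context (n : nat) (B : R -> Om -> 'rV[R]_n).
Hypothesis B_bm : brownian_motion P B.
Local Notation mu := (@lebesgue_measure R).
Local Notation nu := (mu \x P)%E.
Local Notation F := (aug_filtration P B).
Variable T : R.
Hypothesis T0 : 0 <= T.

(** Paths are cadlag off a null set N only; erasing N and the times outside [0, T] gives a process
    which is jointly measurable and still adapted. *)
Definition version (N : set Om) (Y : R -> Om -> R) (z : R * Om) : R :=
  if (0 <= z.1 <= T) && (z.2 \notin N) then Y z.1 z.2 else 0.

Lemma version_off (N : set Om) Y z : 0 <= z.1 <= T -> ~ N z.2 -> version N Y z = Y z.1 z.2.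
Proof.
move=> zT nN; have nN' : z.2 \notin N by rewrite notin_setE.
by rewrite /version zT nN'.
Qed.

Section process.
Variables (N : set Om) (Y : R -> Om -> R).
Hypotheses (mN : measurable N) (N0 : P.-negligible N) (sY : S2 P F T Y).
Hypothesis cY : forall w, ~ N w -> cadlag T (Y ^~ w).

Lemma version_adapted t : 0 <= t <= T -> adapted_at P B t (fun w => version N Y (t, w)).
Proof.
move=> tT; have [aY _ _] := sY; apply: adapted_at_modif N0 _ (aY t tT) => w nN.
by rewrite version_off.
Qed.

Lemma measurable_version : measurable_fun [set: measurableTypeR R * Om] (version N Y).
Proof.
apply: measurable_joint_version => //.
  by move=> t tT; have [aY _ _] := sY; apply: (adapted_at_measurable P_complete B_bm (aY t tT)).
by move=> w /cY[h _].
Qed.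

Definition sup_moment : R :=
  fine (\int[P]_w ereal_sup [set (`|Y t w| ^+ 2)%:E | t in `[0%R, T]])%E.

Let sup_ge w t : 0 <= t <= T ->
  ((Y t w ^+ 2)%:E <= ereal_sup [set (`|Y t w| ^+ 2)%:E | t in `[0%R, T]])%E.
Proof.
move=> tT; apply: ereal_sup_ubound; exists t; first by rewrite /= in_itv.
by rewrite real_normK ?num_real.
Qed.

Let sup_ge0 w : (0 <= ereal_sup [set (`|Y t w| ^+ 2)%:E | t in `[0%R, T]])%E.
Proof.
have TT : 0 <= T <= T by rewrite T0 lexx.
by apply: le_trans (sup_ge w TT); rewrite lee_fin sqr_ge0.
Qed.

Let sup_momentE :
  (sup_moment%:E = \int[P]_w ereal_sup [set (`|Y t w| ^+ 2)%:E | t in `[0%R, T]])%E.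
Proof.
have [_ _ foo] := sY; rewrite /sup_moment fineK// ge0_fin_numE//.
by apply: integral_ge0 => w _; exact: sup_ge0.
Qed.

Lemma sup_moment_ge0 : 0 <= sup_moment.
Proof. by apply/fine_ge0/integral_ge0 => w _; exact: sup_ge0. Qed.

Let version_le t :
  (\int[P]_w (version N Y (t, w) ^+ 2)%:E <= sup_moment%:E)%E.
Proof.
rewrite sup_momentE; apply: ge0_le_integral_nomeas => w; first by rewrite lee_fin sqr_ge0.
rewrite /version /=; case: ifPn => [/andP[tT _]|_]; first exact: sup_ge.
by rewrite expr0n.
Qed.

Lemma version_moment t : 0 <= t <= T -> sqintg P (fun w => version N Y (t, w)) /\
  \int[P]_w (version N Y (t, w) ^+ 2) <= sup_moment.
Proof.
move=> tT.
have s : sqintg P (fun w => version N Y (t, w)).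
  split; last by apply: le_lt_trans (version_le t) (ltry _).
  exact: (adapted_at_measurable P_complete B_bm (version_adapted tT)).
by split => //; rewrite -lee_fin EFin_int ?version_le//; exact: sqintg_sqr.
Qed.

Lemma version_sqintg : sqintg nu (version N Y).
Proof.
have mv := measurable_version.
split => //.
have mv2 : measurable_fun [set: measurableTypeR R * Om] (fun z => (version N Y z ^+ 2)%:E).
  exact/measurable_EFinP/measurable_funX.
rewrite (@fubini_tonelli1 _ _ _ _ _ mu P _ mv2) => [|z]; last by rewrite lee_fin sqr_ge0.
apply: (@le_lt_trans _ _ (\int[mu]_(r in `[0%R, T]) sup_moment%:E)%E).
  rewrite [leRHS]integral_mkcond; apply: ge0_le_integral_nomeas => r.
    by rewrite /fubini_F; apply: integral_ge0 => w _; rewrite lee_fin sqr_ge0.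
  rewrite patchE mem_setE in_itv /= /fubini_F; case: ifPn => [_|rT]; first exact: version_le.
  by rewrite integral0_eq// => w _; rewrite /version /= (negbTE rT) expr0n.
rewrite integral_cst; last exact: measurable_itv.
by rewrite [X in (_ * X)%E]lebesgue_measure_itv /=; case: ifP => _; rewrite ?mule0// -EFinB -EFinM ltry.
Qed.

End process.

Section drift_additivity.
Variable g : R * Om -> R.
Hypothesis sg : sqintg nu g.

(** Integrability over the full window ]0, T] holds for almost every w and passes to all smaller
    windows, so the null set does not depend on s and t. *)
Lemma drift_intg : {ae P, forall w, forall s t, 0 <= s -> t <= T ->
  intg mu (fun r => win s t (r, w) * g (r, w))}.
Proof.
have i0 : intg nu (fun z => win 0 T z * g z).
  apply: sqintgM sg; have := win_mulG_sqintg T0 (sqintg1 P).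
  by congr sqintg; apply/funext => z; rewrite mulr1.
have [h _] := real_fubini2 i0; apply: filterS h => w iw s t s0 tT.
have mw : measurable_fun [set: measurableTypeR R] (fun r => win s t (r, w)).
  by apply: (measurableT_comp (measurable_win s t)); exact: measurable_pair2.
apply: eq_intg (intg_mulbnd mw (fun r => win_le1 s t (r, w)) iw) => r /=.
rewrite mulrA; congr (_ * _); rewrite /win /=; have [/andP[sr rt]|_] := boolP (s < r <= t); last by rewrite mul0r.
by rewrite (le_trans rt tT) (le_lt_trans s0 sr) mul1r.
Qed.

Lemma drift_add : {ae P, forall w, forall s t, 0 <= s -> s <= t -> t <= T ->
  drift g s T w = drift g s t w + drift g t T w}.
Proof.
apply: filterS drift_intg => w iw s t s0 st tT.
rewrite /drift -int_add; [|exact: iw|by apply: iw => //; exact: le_trans st].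
apply: eq_Rintegral => r _; rewrite -mulrDl; congr (_ * _); rewrite /win /=.
have [rs|sr] := leP r s; first by rewrite [t < r]ltNge (le_trans rs st) addr0.
have [rt|tr] := leP r t; first by rewrite (le_trans rt tT) addr0.
by rewrite add0r.
Qed.

End drift_additivity.

Lemma drift_sub g1 g2 : sqintg nu g1 -> sqintg nu g2 ->
  {ae P, forall w, forall s t, 0 <= s -> t <= T ->
    drift (fun z => g1 z - g2 z) s t w = drift g1 s t w - drift g2 s t w}.
Proof.
move=> /drift_intg i1 /drift_intg i2; apply: filterS2 i1 i2 => w i1 i2 s t s0 tT.
rewrite /drift -int_sub; [|exact: i1|exact: i2].
by apply: eq_Rintegral => r _; rewrite mulrBr.
Qed.

Section equation.
Variables (f : coefficient R Om n) (xi : Om -> R) (Y : R -> Om -> R) (Z : R -> Om -> 'rV[R]_n).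
Variables (I : R -> Om -> R) (g : R * Om -> R).
Hypothesis sg : sqintg nu g.
Hypothesis gE : {ae P, forall w, forall s, 0 <= s <= T -> mean_field_driver P f Y Z s w = g (s, w)}.
Hypothesis eqY : {ae P, forall w, forall t, 0 <= t <= T -> Y t w = xi w
  + Rintegral mu `[t, T] (mean_field_driver P f Y Z ^~ w) - (I T w - I t w)}.

Lemma solution_equation : {ae P, forall w, forall t, 0 <= t <= T ->
  Y t w = xi w + drift g t T w - (I T w - I t w)}.
Proof.
apply: filterS3 gE eqY (drift_intg sg) => w gw eqw iw t tT; have /andP[t0 tT'] := tT; rewrite eqw//.
congr (_ + _ - _); rewrite /drift.
transitivity (\int[mu]_(r in `[t, T]) g (r, w)).
  apply: eq_Rintegral => r; rewrite mem_setE in_itv /= => /andP[tr rT].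
  by rewrite gw// rT (le_trans t0).
have restr : (EFin \o (fun r => g (r, w))) \_ `]t, T] = EFin \o (fun r => win t T (r, w) * g (r, w)).
  apply/funext => r; rewrite patchE mem_setE in_itv /= /win /=.
  by case: (t < r <= T); rewrite /= ?mul1r ?mul0r.
(* The equation integrates over the closed interval, [win] over the one open at t; the endpoint has
   measure 0. *)
rewrite -Rintegral_itv_obnd_cbnd; last first.
  by rewrite integrable_mkcond ?restr; [exact: iw|exact: measurable_itv].
rewrite Rintegral_mkcond; apply: eq_Rintegral => r _.
by rewrite patchE mem_setE in_itv /= /win /=; case: (t < r <= T); rewrite /= ?mul1r ?mul0r.
Qed.

Lemma solution_increment : {ae P, forall w, forall s t, 0 <= s -> s <= t -> t <= T ->
  Y t w - Y s w = (I t w - I s w) - drift g s t w}.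
Proof.
apply: filterS2 solution_equation (drift_add sg) => w eqw dw s t s0 st tT.
rewrite !eqw ?(dw s t)//; last 2 first.
- by rewrite s0 (le_trans st).
- by rewrite tT (le_trans s0).
ring.
Qed.

Lemma solution_terminal : {ae P, forall w, Y T w = xi w}.
Proof.
apply: filterS eqY => w eqw; have TT : 0 <= T <= T by rewrite T0 lexx.
by rewrite eqw// set_itv1 Rintegral_set1 addr0 subrr subr0.
Qed.

End equation.

End solution_data.

(** * Comparison of the two drivers and of their means *)

Section comparison_of_drivers.
Context (R : realType) (n : nat).

(* Only the positive part of y1' - y2' and no z' enters the bound: this is where
   conditions (i) and (ii) act. *)
Lemma driver_gap (a1 a2 : R -> 'rV[R]_n -> R -> 'rV[R]_n -> R) (C : R) :
  (forall y1' z1' y1 z1 y2' z2' y2 z2, `|a1 y1' z1' y1 z1 - a1 y2' z2' y2 z2| <=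
    C * (`|y1' - y2'| + enorm (z1' - z2') + `|y1 - y2| + enorm (z1 - z2))) ->
  (forall y1' z1' y1 z1 y2' z2' y2 z2, `|a2 y1' z1' y1 z1 - a2 y2' z2' y2 z2| <=
    C * (`|y1' - y2'| + enorm (z1' - z2') + `|y1 - y2| + enorm (z1 - z2))) ->
  (forall y' z1' z2' y z, a1 y' z1' y z = a1 y' z2' y z) \/
  (forall y' z1' z2' y z, a2 y' z1' y z = a2 y' z2' y z) ->
  (forall y1' y2' z' y z, y1' <= y2' -> a1 y1' z' y z <= a1 y2' z' y z) \/
  (forall y1' y2' z' y z, y1' <= y2' -> a2 y1' z' y z <= a2 y2' z' y z) ->
  (forall y' z' y z, a1 y' z' y z <= a2 y' z' y z) ->
  forall y1' z1' y1 z1 y2' z2' y2 z2, a1 y1' z1' y1 z1 - a2 y2' z2' y2 z2 <=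
    C * (Num.max (y1' - y2') 0 + `|y1 - y2| + enorm (z1 - z2)).
Proof.
move=> l1 l2 indep mono le12 y1' z1' y1 z1 y2' z2' y2 z2.
set M := Num.max _ _.
have M0 : 0 <= M by rewrite /M le_max lexx orbT.
have My : y1' <= y2' + M by rewrite addrC -lerBlDr /M le_max lexx.
have e0 m (u : 'rV[R]_m) : enorm (u - u) = 0.
  rewrite subrr /enorm /dot big1 ?sqrtr0// => i _; by rewrite mxE mul0r.
(* The passage from y1' to y2' takes place in the monotone coefficient, by raising y1' to y2' + M
   and coming back with the Lipschitz bound; the order a1 <= a2 is used after this passage if a1 is
   monotone and before it if a2 is. *)
have shift z' : a1 y1' z' y1 z1 - a2 y2' z' y1 z1 <= C * M.
  case: mono => mono.
    have := l1 (y2' + M) z' y1 z1 y2' z' y1 z1.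
    rewrite !e0 subrr normr0 !addr0 addrAC subrr add0r (ger0_norm M0) => h.
    have := mono _ _ z' y1 z1 My; have := le12 y2' z' y1 z1.
    by have := le_trans (ler_norm _) h; lra.
  have := l2 (y2' + M) z' y1 z1 y2' z' y1 z1.
  rewrite !e0 subrr normr0 !addr0 addrAC subrr add0r (ger0_norm M0) => h.
  have := mono _ _ z' y1 z1 My; have := le12 y1' z' y1 z1.
  by have := le_trans (ler_norm _) h; lra.
have lip z' : a2 y2' z' y1 z1 - a2 y2' z' y2 z2 <= C * (`|y1 - y2| + enorm (z1 - z2)).
  apply: le_trans (ler_norm _) (le_trans (l2 _ _ _ _ _ _ _ _) _).
  by rewrite !e0 subrr normr0 !add0r.
rewrite -addrA mulrDr.
(* The coefficient ignoring z' is evaluated at the z' of the other one, so that [shift] and [lip]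
   apply with a common z'. *)
case: indep => indep.
  by rewrite (indep _ z1' z2'); have := shift z2'; have := lip z2'; lra.
by rewrite (indep _ z2' z1'); have := shift z1'; have := lip z1'; lra.
Qed.

End comparison_of_drivers.

Section comparison_of_means.
Context (R : realType) (d : measure_display) (Om : measurableType d).
Context (P : probability Om R) (n : nat) (T : R).
Local Notation mu := (@lebesgue_measure R).
Local Notation nu := (mu \x P)%E.
Variables (f1 f2 : coefficient R Om n) (D : set (Om * Om)) (C : R).
Hypothesis C0 : 0 <= C.
Hypothesis gap : forall ww, ~ D ww -> forall t, 0 <= t <= T ->
  forall y1' z1' y1 z1 y2' z2' y2 z2, f1 ww t y1' z1' y1 z1 - f2 ww t y2' z2' y2 z2 <=
    C * (Num.max (y1' - y2') 0 + `|y1 - y2| + enorm (z1 - z2)).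
Variables (y1 y2 : R * Om -> R) (zeta1 zeta2 : 'I_n -> R * Om -> R).
Local Notation G1 := (integrand T f1 D y1 zeta1).
Local Notation G2 := (integrand T f2 D y2 zeta2).

Lemma mean_gap (z : R * Om) :
  intg P (fun w' => G1 (z, w')) -> intg P (fun w' => G2 (z, w')) ->
  sqintg P (fun w' => y1 (z.1, w') - y2 (z.1, w')) ->
  mean_integrand P T f1 D y1 zeta1 z - mean_integrand P T f2 D y2 zeta2 z <=
  C * (\int[P]_w Num.max (y1 (z.1, w) - y2 (z.1, w)) 0 + `|y1 z - y2 z| +
       Num.sqrt (sqn (fun i => zeta1 i \- zeta2 i) z)).
Proof.
move=> i1 i2 sy; rewrite /mean_integrand -int_sub//.
have ip : intg P (fun w => Num.max (y1 (z.1, w) - y2 (z.1, w)) 0).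
  have iy := sqintgM (sqintg1 P) sy.
  apply: (@intg_dom _ _ _ _ _ (fun w => `|1 * (y1 (z.1, w) - y2 (z.1, w))|)).
  - by apply: measurable_maxr => //; exact: sqintg_mfun sy.
  - move=> w; rewrite mul1r ger0_norm ?le_max ?lexx ?orbT//.
    by rewrite ge_max normr_ge0 ler_norm.
  - exact: intg_norm iy.
set a := `|_|; set b := Num.sqrt _; have [ic ec] := hasint_cst P (a + b).
rewrite -addrA -ec -int_add// -int_scale; last exact: intgD.
apply: le_int; first exact: intgB; first by apply: intgZ; exact: intgD.
move=> w; rewrite /integrand /=.
have a0 : 0 <= a by exact: normr_ge0.
have b0 : 0 <= b by exact: sqrtr_ge0.
case: ifPn => [/andP[zT]|_]; last first.
  by rewrite subrr; apply: mulr_ge0 => //; apply: addr_ge0; [rewrite le_max lexx orbT|exact: addr_ge0].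
rewrite notin_setE => nD; apply: le_trans (gap nD zT _ _ _ _ _ _ _ _) _.
rewrite addrA; apply: ler_wpM2l => //; rewrite lerD2l /b /enorm /dot /sqn le_eqVlt.
by apply/orP; left; apply/eqP; congr Num.sqrt; apply: eq_bigr => i _; rewrite !mxE expr2.
Qed.

End comparison_of_means.

(** A strict reversal at t would persist on a small interval to the right of t, which contains a
    rational. *)
Lemma right_continuous_le (R : realType) (T : R) (u v : R -> R) :
  (forall t, 0 <= t < T -> u s @[s --> t^'+] --> u t) ->
  (forall t, 0 <= t < T -> v s @[s --> t^'+] --> v t) ->
  (forall q : rat, 0 <= (ratr q : R) < T -> u (ratr q) <= v (ratr q)) ->
  forall t, 0 <= t < T -> u t <= v t.
Proof.
move=> cu cv uv t tT; rewrite leNgt; apply/negP => vu.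
pose e := (u t - v t) / 2.
have e0 : 0 < e by rewrite /e; lra.
have /cvgrPdist_lt/(_ e e0) hu := cu t tT.
have /cvgrPdist_lt/(_ e e0) hv := cv t tT.
have /= [del /= del0 hdel] : \forall s \near (t : R), t < s -> `|u t - u s| < e /\ `|v t - v s| < e.
  move: hu hv; rewrite /at_right !near_withinE => hu hv.
  by near=> s => ts; split; [move: ts; near: s|move: ts; near: s].
have /andP[t0 tT'] := tT.
have [q] := @rat_in_itvoo R t (Num.min T (t + del)) ltac:(by rewrite lt_min tT' ltrDl).
rewrite in_itv /= lt_min => /and3P[tq qT qd].
have [] := hdel (ratr q) _ tq.
  by rewrite /ball /= ltr_norml; apply/andP; split; lra.
have := uv q ltac:(by rewrite qT (le_trans t0 (ltW tq))).
rewrite !ltr_norml => h /andP[h1 h2] /andP[h3 h4]; move: h h1 h2 h3 h4; rewrite /e; lra.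
Unshelve. all: by end_near.
Qed.

Theorem theorem3p2 (R : realType) (disp : measure_display)
    (Om : measurableType disp) (P : probability Om R)
    (P_complete : measure_is_complete P)
    (T : R) (T_gt0 : 0 < T)
    (d : nat) (d_gt0 : (0 < d)%N)
    (B : R -> Om -> 'rV[R]_d) (B_bm : brownian_motion P B)
    (f1 f2 : coefficient R Om d)
    (f1_driver : driver (aug_filtration P B) T f1)
    (f2_driver : driver (aug_filtration P B) T f2)
    (f1_A3 : A3 P T f1) (f2_A3 : A3 P T f2)
    (f1_A4 : A4 P (aug_filtration P B) T f1)
    (f2_A4 : A4 P (aug_filtration P B) T f2)
    (cond_i : independent_of_z' P T f1 \/ independent_of_z' P T f2)
    (cond_ii : nondecreasing_in_y' P T f1 \/ nondecreasing_in_y' P T f2)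
    (xi1 xi2 : Om -> R)
    (xi1_L2 : L2 P (aug_filtration P B T) xi1)
    (xi2_L2 : L2 P (aug_filtration P B T) xi2)
    (Y1 Y2 : R -> Om -> R) (Z1 Z2 : R -> Om -> 'rV[R]_d)
    (sol1 : mfbsde_solution P B T xi1 f1 Y1 Z1)
    (sol2 : mfbsde_solution P B T xi2 f2 Y2 Z2)
    (xi_le : {ae P, forall w, xi1 w <= xi2 w})
    (f_le : coefficient_le P T f1 f2) :
  {ae P, forall w, forall t, 0 <= t <= T -> Y1 t w <= Y2 t w}.
Proof.
have T0 : 0 <= T := ltW T_gt0.
have [sY1 hZ1 [I1 ito1 eq1]] := sol1; have [sY2 hZ2 [I2 ito2 eq2]] := sol2.
have [C1 C10 lip1] := f1_A3; have [C2 C20 lip2] := f2_A3.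
(* A Lipschitz constant common to both drivers. *)
pose C := C1 + C2; have C0 : 0 <= C by exact: addr_ge0.
have widen (a b c e : R) : 0 <= b -> 0 <= c -> 0 <= e -> a <= b * e -> a <= (b + c) * e /\ a <= (c + b) * e.
  move=> b0 c0 e0 h; have ce := mulr_ge0 c0 e0; rewrite !mulrDl; split; lra.
have dist0 (y1' y2' y1 y2 : R) (z1' z2' z1 z2 : 'rV[R]_d) :
    0 <= `|y1' - y2'| + enorm (z1' - z2') + `|y1 - y2| + enorm (z1 - z2).
  by do ![apply: addr_ge0 => //]; exact: sqrtr_ge0.
pose lip (f : coefficient R Om d) (ww : Om * Om) := forall t, 0 <= t <= T ->
  forall y1' z1' y1 z1 y2' z2' y2 z2, `|f ww t y1' z1' y1 z1 - f ww t y2' z2' y2 z2| <=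
    C * (`|y1' - y2'| + enorm (z1' - z2') + `|y1 - y2| + enorm (z1 - z2)).
pose gap (ww : Om * Om) := forall t, 0 <= t <= T ->
  forall y1' z1' y1 z1 y2' z2' y2 z2, f1 ww t y1' z1' y1 z1 - f2 ww t y2' z2' y2 z2 <=
    C * (Num.max (y1' - y2') 0 + `|y1 - y2| + enorm (z1 - z2)).
have nuF : Filter (almost_everywhere (P \x P)%E) by exact: ae_filter_ringOfSetsType.
have L1 : {ae (P \x P)%E, forall ww, lip f1 ww}.
  apply: (@filterS _ _ nuF) lip1 => ww h t tT y1' z1' y1 z1 y2' z2' y2 z2.
  by case: (widen _ _ _ _ C10 C20 (dist0 y1' y2' y1 y2 z1' z2' z1 z2) (h t tT y1' z1' y1 z1 y2' z2' y2 z2)).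
have L2 : {ae (P \x P)%E, forall ww, lip f2 ww}.
  apply: (@filterS _ _ nuF) lip2 => ww h t tT y1' z1' y1 z1 y2' z2' y2 z2.
  by case: (widen _ _ _ _ C20 C10 (dist0 y1' y2' y1 y2 z1' z2' z1 z2) (h t tT y1' z1' y1 z1 y2' z2' y2 z2)).
pose indep (f : coefficient R Om d) (ww : Om * Om) := forall t, 0 <= t <= T ->
  forall y' z1' z2' y z, f ww t y' z1' y z = f ww t y' z2' y z.
(* Conditions (i) and (ii) become pointwise alternatives, so that all four combinations are handled
   at once by [driver_gap]. *)
have LI : {ae (P \x P)%E, forall ww, indep f1 ww \/ indep f2 ww}.
  by case: cond_i => h; apply: (@filterS _ _ nuF) h => ww h; [left|right].
pose mono (f : coefficient R Om d) (ww : Om * Om) := forall t, 0 <= t <= T ->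
  forall y1' y2' z' y z, y1' <= y2' -> f ww t y1' z' y z <= f ww t y2' z' y z.
have LM : {ae (P \x P)%E, forall ww, mono f1 ww \/ mono f2 ww}.
  by case: cond_ii => h; apply: (@filterS _ _ nuF) h => ww h; [left|right].
(* One measurable null set outside which every assumption on the drivers holds; both integrands are
   set to 0 on it. *)
have [D [mD D0 QD]] : {ae (P \x P)%E, forall ww, [/\ lip f1 ww, lip f2 ww & gap ww]}.
  have H12 := @filterI _ _ nuF _ _ L1 L2; have HIM := @filterI _ _ nuF _ _ LI LM.
  apply: (@filterS3 _ _ nuF) H12 HIM f_le => ww [l1 l2] [hi hm] hle; split => // t tT.
  apply: driver_gap; [exact: l1|exact: l2| | |exact: hle].
    by case: hi => h; [left|right]; exact: h.
  by case: hm => h; [left|right]; exact: h.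
have nD ww : ~ D ww -> [/\ lip f1 ww, lip f2 ww & gap ww].
  by move=> h; apply: contrapT => h'; apply: h; exact: QD.
have aeD : {ae (P \x P)%E, forall ww, ~ D ww}.
  by exists D; split => // ww /= /contrapT.
have [N [mN N0 QN]] : {ae P, forall w, cadlag T (Y1 ^~ w) /\ cadlag T (Y2 ^~ w)}.
  have [_ c1 _] := sY1; have [_ c2 _] := sY2.
  by apply: filterS2 c1 c2 => w.
have nN w : ~ N w -> cadlag T (Y1 ^~ w) /\ cadlag T (Y2 ^~ w).
  by move=> h; apply: contrapT => h'; apply: h; exact: QN.
have negN : P.-negligible N by exists N; split.
have aeN : {ae P, forall w, ~ N w} by exists N; split => // w /= /contrapT.
pose y1 := version T N Y1; pose y2 := version T N Y2.
pose z1 := stopped_coord T Z1; pose z2 := stopped_coord T Z2.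
have sy1 := version_sqintg P_complete B_bm T0 mN sY1 (fun w h => (nN w h).1).
have sy2 := version_sqintg P_complete B_bm T0 mN sY2 (fun w h => (nN w h).2).
have sz1 := H2vec_sqintg P_complete B_bm T0 hZ1.
have sz2 := H2vec_sqintg P_complete B_bm T0 hZ2.
have lD1 ww (h : ~ D ww) : lip f1 ww by case: (nD ww h).
have lD2 ww (h : ~ D ww) : lip f2 ww by case: (nD ww h).
have gD ww (h : ~ D ww) : gap ww by case: (nD ww h).
pose g1 := mean_integrand P T f1 D y1 z1; pose g2 := mean_integrand P T f2 D y2 z2.
have [i1 sg1] := mean_integrand_sqintg P_complete B_bm T0 C0 mD lD1 f1_driver f1_A4 sy1 sz1.
have [i2 sg2] := mean_integrand_sqintg P_complete B_bm T0 C0 mD lD2 f2_driver f2_A4 sy2 sz2.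
have coordE (Z : R -> Om -> 'rV[R]_d) i (z : R * Om) : 0 <= z.1 <= T ->
    stopped_coord T Z i z = Z z.1 z.2 ord0 i.
  by move=> zT; rewrite /stopped_coord /stopped zT.
have m1 := mean_field_driver_ae P_complete B_bm T0 C0 mD lD1 f1_driver sy1 sz1 negN aeD
  (fun z => @version_off _ _ _ _ _ _ z) (fun i z => @coordE Z1 i z).
have m2 := mean_field_driver_ae P_complete B_bm T0 C0 mD lD2 f2_driver sy2 sz2 negN aeD
  (fun z => @version_off _ _ _ _ _ _ z) (fun i z => @coordE Z2 i z).
have inc1 := solution_increment T0 sg1 m1 eq1.
have inc2 := solution_increment T0 sg2 m2 eq2.
have term1 := solution_terminal T0 eq1.
have term2 := solution_terminal T0 eq2.
pose X (z : R * Om) := y1 z - y2 z.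
have mom t (tT : 0 <= t <= T) := version_moment P_complete B_bm T0 negN sY1 tT.
have mom' t (tT : 0 <= t <= T) := version_moment P_complete B_bm T0 negN sY2 tT.
(* Bounds the second moment of X uniformly in time, by (a - b)^2 <= 2 a^2 + 2 b^2. *)
pose S := 2 * sup_moment P T Y1 + 2 * sup_moment P T Y2.
have S0 : 0 <= S.
  by apply: addr_ge0; apply: mulr_ge0 => //; exact: sup_moment_ge0.
have sX t : 0 <= t <= T -> sqintg P (fun w => X (t, w)) /\ \int[P]_w (X (t, w) ^+ 2) <= S.
  move=> tT; have [s1 e1] := mom t tT; have [s2 e2] := mom' t tT.
  by split; [exact: sqintgB|exact: int_sqr_sub].
have XE t w : 0 <= t <= T -> ~ N w -> X (t, w) = Y1 t w - Y2 t w.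
  by move=> tT nw; rewrite /X /y1 /y2 !version_off.
have TT : 0 <= T <= T by rewrite T0 lexx.
have XT : {ae P, forall w, X (T, w) <= 0}.
  apply: filterS2 (filterI aeN xi_le) (filterI term1 term2) => w [nw hxi] [t1 t2].
  by rewrite XE// t1 t2 subr_le0.
(* E[phi(X_t)] = 0 makes phi(X_t) vanish almost surely, but on an event depending on t. Rational
   times and right continuity then yield a common event. *)
have XT0 t : 0 <= t < T -> {ae P, forall w, X (t, w) <= 0}.
  move=> /andP[t0 tT]; have tTT : 0 <= t <= T by rewrite t0 ltW.
  have p0 : \int[P]_w phi (X (t, w)) = 0.
    apply: (@comparison_at R _ Om P P_complete d B B_bm T X (fun z => g1 z - g2 z)
      (fun t w => I1 t w - I2 t w) (fun i => z1 i \- z2 i) S C) => //.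
    - apply: measurable_funB; [exact: sqintg_mfun sy1|exact: sqintg_mfun sy2].
    - move=> r rT; have a1 := version_adapted negN sY1 rT; have a2 := version_adapted negN sY2 rT.
      exact: measurable_funB a1 a2.
    - by apply: ito_approxB => //; exact: is_ito_approx.
    - exact: sqintgB.
    - move=> r s r0 rs sT.
      have rT : 0 <= r <= T by rewrite r0 (le_trans rs).
      have sT' : 0 <= s <= T by rewrite sT (le_trans r0).
      apply: filterS3 (filterI aeN (drift_sub T0 sg1 sg2)) inc1 inc2 => w [nw dw] e1 e2.
      rewrite !XE// dw//; have := e1 r s r0 rs sT; have := e2 r s r0 rs sT.
      rewrite -/g1 -/g2; lra.
    - have nuF' : Filter (almost_everywhere (@lebesgue_measure R \x P)%E) by exact: ae_filter_ringOfSetsType.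
      apply: (@filterS2 _ _ nuF') i1 i2 => z j1 j2 zT.
      by apply: mean_gap => //; case: (sX _ zT).
  have ip := phi_intg sX tTT.
  have z0 : ae_eq P [set: Om] (fun w => (phi (X (t, w)))%:E) (cst 0%E).
    apply/ae_eq_integral_abs => //; first exact/measurable_EFinP/(intg_mfun ip).
    under eq_integral do rewrite gee0_abs ?lee_fin ?phi_ge0//.
    by rewrite -EFin_int// p0.
  by apply: filterS z0 => w /(_ I) [] h; apply: phi_le0; rewrite h.
have rats : {ae P, forall w, forall q : rat, 0 <= (ratr q : R) < T -> X (ratr q, w) <= 0}.
  (* Rationals are encoded by natural numbers, for which the countable intersection of almost sure
     events is available. *)
  have h k : {ae P, forall w, if unpickle k is Some q then 0 <= (ratr q : R) < T -> X (ratr q, w) <= 0 else True}.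
    case: (unpickle k) => [q|]; last by apply: filterE.
    have [qT|qT] := boolP (0 <= (ratr q : R) < T); last by apply: filterE => w.
    by apply: filterS (XT0 _ qT) => w + _.
  by apply: filterS (ae_foralln h) => w hw q; have := hw (pickle q); rewrite pickleK.
apply: filterS3 (filterI aeN rats) (filterI term1 term2) xi_le => w [nw hq] [t1 t2] hxi t /andP[t0].
(* Right continuity says nothing at T, where the terminal values are compared directly. *)
rewrite le_eqVlt => /predU1P[->|tT]; first by rewrite t1 t2.
have [[c1 _] [c2 _]] := nN w nw.
apply: (right_continuous_le c1 c2) => [q qT|]; last by rewrite t0.
have /andP[q0 qT'] := qT.
by have := hq q qT; rewrite XE// ?subr_le0// q0 ltW.
Qed.
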